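(* Consider the EC-LSVRG algorithm described in the context for the smooth problem $\min_x f(x)$ (i.e. $\psi=0$), where $Q$ and $Q_1$ are contraction compressors with parameters $\delta$ and $\delta_1$ respectively, which also satisfy $\mathbb{E}[Q(x)]=\delta x$ and $\mathbb{E}[Q_1(x)]=\delta_1x$; each $f_i^{(\tau)}$ is $L$-smooth, each $f^{(\tau)}$ is $\bar L$-smooth, and $f$ is $L_f$-smooth and $\mu$-strongly convex. Put $\rho:=\min\{\frac{\mu\eta}{2},\frac{\delta}{4},\frac{\delta_1}{4},\frac p4\}$, $w_k:=(1-\rho)^{-k}$, $W_k:=\sum_{i=0}^k w_i$, $\bar x^k:=\frac1{W_k}\sum_{i=0}^k w_i x^i$, and $$\eta_{\max}:=\min\left\{\tfrac1{4L_f+33L/n},\ \tfrac{\delta}{60\sqrt{1-\delta}\,L_f},\ \tfrac{\sqrt{n\delta}}{229\sqrt{(1-\delta)L_fL}},\ \tfrac{\sqrt n\,\delta}{360\sqrt{(1-\delta)L_f\bar L}},\ \tfrac{\delta\sqrt{\delta_1}}{120\sqrt{(1-\delta)pL_f\left(L_f+\frac{12\bar L}n\right)\left(1+\frac{2p}{\delta_1}\right)}}\right\}.$$ (i) Let $\eta\le\eta_{\max}$. If $\mu>0$, then $$\mathbb{E}[f(\bar x^k)-f(x^* )]\le\frac{18\mu\|x^0-x^*\|^2+\frac2{L_fn}\sum_{\tau=1}^n\|\nabla f^{(\tau)}(x^0)-h_\tau^0\|^2+5\big(f(x^0)-f(x^* )\big)}{1-(1-\rho)^{k+1}}(1-\rho)^k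 .$$ If $\mu=0$, then $$\mathbb{E}[f(\bar x^k)-f(x^* )]\le\frac1{k+1}\left(\frac{36}\eta\|x^0-x^*\|^2+\frac6{L_fpn}\sum_{\tau=1}^n\|\nabla f^{(\tau)}(x^0)-h_\tau^0\|^2+\frac{18}p\big(f(x^0)-f(x^* )\big)\right).$$ (ii) Let $\eta=\eta_{\max}$ and $p\le O(\delta_1)$. If $\mu>0$ and $\epsilon\le 9\mu\|x^0-x^*\|^2+\frac1{L_fn}\sum_{\tau=1}^n\|\nabla f^{(\tau)}(x^0)-h_\tau^0\|^2+3\big(f(x^0)-f(x^* )\big)$, then $\mathbb{E}[f(\bar x^k)-f(x^* )]\le\epsilon$ as long as $$k\ge O\left(\left(\frac1\delta+\frac1p+\frac{L_f}\mu+\frac L{n\mu}+\frac{\sqrt{1-\delta}\,L_f}{\mu\delta}\right)\ln\frac1\epsilon\right).$$ If $\mu=0$, then $\mathbb{E}[f(\bar x^k)-f(x^* )]\le\epsilon$ as long as $$k\ge O\left(\left(\frac1p+L_f+\frac Ln+\frac{\sqrt{1-\delta}\,L_f}\delta\right)\frac1\epsilon\right).$$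
   Context: Problem: $\min_{x\in\mathbb{R}^d}f(x)$, where $f=\frac1n\sum_{\tau=1}^n f^{(\tau)}$, $f^{(\tau)}=\frac1m\sum_{i=1}^m f_i^{(\tau)}$, and each $f_i^{(\tau)}:\mathbb{R}^d\to\mathbb{R}$ is convex and smooth; $x^*$ is an optimal solution (assumed to exist). $\|\cdot\|$ is the Euclidean norm. ''$L$-smooth'' means differentiable with $L$-Lipschitz gradient. ''$\mu$-strongly convex'' ($\mu\ge0$) means $f-\frac\mu2\|\cdot\|^2$ is convex. A possibly randomized map $Q:\mathbb{R}^d\to\mathbb{R}^d$ is a contraction compressor with parameter $\delta\in(0,1]$ if $\mathbb{E}\|x-Q(x)\|^2\le(1-\delta)\|x\|^2$ for all $x\in\mathbb{R}^d$. EC-LSVRG algorithm (case $\psi=0$). Parameters: stepsize $\eta>0$, probability $p\in(0,1]$. Initialization: $x^0=w^0\in\mathbb{R}^d$, $e_\tau^0=0$, $h_\tau^0\in\mathbb{R}^d$ for $1\le\tau\le n$, $h^0=\frac1n\sum_\tau h_\tau^0$. For $k=0,1,2,\dots$: for each $\tau$, sample $i_k^\tau$ uniformly and independently from $\{1,\dots,m\}$ and set $g_\tau^k=\nabla f^{(\tau)}_{i_k^\tau}(x^k)-\nabla f^{(\tau)}_{i_k^\tau}(w^k)+\nabla f^{(\tau)}(w^k)-h_\tau^k$, $\;y_\tau^k=Q(\eta g_\tau^k+e_\tau^k)$, $\;e_\tau^{k+1}=e_\tau^k+\eta g_\tau^k-y_\tau^k$, $\;z_\tau^k=Q_1(\nabla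 f^{(\tau)}(w^k)-h_\tau^k)$, $\;h_\tau^{k+1}=h_\tau^k+z_\tau^k$. Then $y^k=\frac1n\sum_\tau y_\tau^k$, $z^k=\frac1n\sum_\tau z_\tau^k$, $x^{k+1}=x^k-(y^k+\eta h^k)$; $w^{k+1}=x^k$ with probability $p$ and $w^{k+1}=w^k$ with probability $1-p$; $h^{k+1}=h^k+z^k$.
   Formalization: In (ii) it is assumed that L̄ ≤ n·L_f and, for μ>0, that ε ≤ ε₀ for a fixed ε₀<1; the O-constants may depend on ε₀, on the constant in p ≤ O(δ₁) and on a bound of the initial quantities; L_f>0 is assumed throughout. *)

(* Defs.v *)
From HB Require Import structures.
From mathcomp Require Import all_boot all_order all_algebra.
From mathcomp Require Import all_classical all_reals all_analysis.

Set Implicit Arguments.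
Unset Strict Implicit.
Unset Printing Implicit Defensive.

Import Order.TTheory GRing.Theory Num.Theory.
Import numFieldNormedType.Exports.

Local Open Scope classical_set_scope.
Local Open Scope ring_scope.

(* The library norm on 'rV[R]_d is the sup norm; [enorm] is the Euclidean one.
   [differentiable] does not depend on this choice, since d is finite. *)
Definition enorm (R : realType) (d : nat) (x : 'rV[R]_d) : R :=
  Num.sqrt (\sum_(j < d) x 0 j ^+ 2).

Definition grad (R : realType) (d : nat) (f : 'rV[R]_d -> R) (x : 'rV[R]_d) :
    'rV[R]_d :=
  \row_(j < d) 'D_(delta_mx 0 j : 'rV[R]_d) f x.

Definition smooth (R : realType) (d : nat) (L : R) (f : 'rV[R]_d -> R) : Prop :=
  (forall x : 'rV[R]_d, differentiable f x) /\
  (forall x y : 'rV[R]_d, enorm (grad f x - grad f y) <= L * enorm (x - y)).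

Definition convex (R : realType) (d : nat) (f : 'rV[R]_d -> R) : Prop :=
  @convex_function R 'rV[R]_d setT f.

Definition strongly_convex (R : realType) (d : nat) (mu : R)
    (f : 'rV[R]_d -> R) : Prop :=
  convex (fun x => f x - mu / 2 * enorm x ^+ 2).

(* A possibly randomized map of R^d is a jointly measurable family Q of maps
   indexed by a random seed s of law [law]; every evaluation of the map in the
   algorithm uses a fresh seed.  Tuples carry the product sigma-algebra, row
   vectors have none in the library, hence the detour through [d.-tuple R]. *)
Definition random_map (R : realType) (d : nat) (ds : measure_display)
    (S : measurableType ds) (Q : S -> 'rV[R]_d -> 'rV[R]_d) : Prop :=
  forall j : 'I_d, measurable_fun [set: S * d.-tuple R]
    (fun sx : S * d.-tuple R => Q sx.1 (\row_(l < d) tnth sx.2 l) 0 j).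

Definition contraction_compressor (R : realType) (d : nat)
    (ds : measure_display) (S : measurableType ds) (law : probability S R)
    (Q : S -> 'rV[R]_d -> 'rV[R]_d) (delta : R) : Prop :=
  [/\ 0 < delta <= 1,
      random_map Q &
      forall x : 'rV[R]_d,
        ('E_law[fun s => (enorm (x - Q s x) ^+ 2)%R] <=
         ((1 - delta) * enorm x ^+ 2)%:E)%E].

Definition mean_scaling (R : realType) (d : nat)
    (ds : measure_display) (S : measurableType ds) (law : probability S R)
    (Q : S -> 'rV[R]_d -> 'rV[R]_d) (delta : R) : Prop :=
  forall (x : 'rV[R]_d) (j : 'I_d),
    'E_law[fun s => (Q s x 0 j)%R]%E = (delta * x 0 j)%:E.

Definition mutually_independent (R : realType) (dO : measure_display)
    (Omega : measurableType dO) (P : probability Omega R) (J : eqType)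
    (G : J -> set (set Omega)) : Prop :=
  forall (s : seq J) (A : J -> set Omega),
    uniq s -> (forall j, j \in s -> G j (A j)) ->
    P (\bigcap_(j in [set` s]) A j) = (\prod_(j <- s) P (A j))%E.

(* The problem data, the parameters of the method, the compressors, and the
   random draws of one run.  At iteration k, worker t draws the sample index
   [draw_i k t], the seed [draw_Q k t] of Q and the seed [draw_Q1 k t] of Q_1;
   [draw_w k] is the coin (common to all workers) deciding w^{k+1}. *)
Record ec_lsvrg (R : realType) := EcLsvrg {
  dim : nat;
  n : nat;
  m : nat;
  fi : 'I_n -> 'I_m -> 'rV[R]_dim -> R;
  xstar : 'rV[R]_dim;
  L : R;
  Lbar : R;
  Lf : R;
  mu : R;
  eta : R;
  p : R;
  x0 : 'rV[R]_dim;
  h0 : 'I_n -> 'rV[R]_dim;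
  delta : R;
  dispQ : measure_display;
  seedQ : measurableType dispQ;
  lawQ : probability seedQ R;
  Q : seedQ -> 'rV[R]_dim -> 'rV[R]_dim;
  delta1 : R;
  dispQ1 : measure_display;
  seedQ1 : measurableType dispQ1;
  lawQ1 : probability seedQ1 R;
  Q1 : seedQ1 -> 'rV[R]_dim -> 'rV[R]_dim;
  dispO : measure_display;
  Omega : measurableType dispO;
  P : probability Omega R;
  draw_i : nat -> 'I_n -> Omega -> 'I_m;
  draw_Q : nat -> 'I_n -> {RV P >-> seedQ};
  draw_Q1 : nat -> 'I_n -> {RV P >-> seedQ1};
  draw_w : nat -> {RV P >-> bool}
}.

Arguments fi {R} _ _ _ _.
Arguments h0 {R} _ _.
Arguments Q {R} _ _ _.
Arguments Q1 {R} _ _ _.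
Arguments draw_i {R} _ _ _ _.
Arguments draw_Q {R} _ _ _.
Arguments draw_Q1 {R} _ _ _.
Arguments draw_w {R} _ _.

Section Run.
Variables (R : realType) (E : ec_lsvrg R).
Local Notation V := 'rV[R]_(dim E).

Definition fw (t : 'I_(n E)) (x : V) : R :=
  (m E)%:R^-1 * \sum_(i < m E) fi E t i x.

Definition fobj (x : V) : R :=
  (n E)%:R^-1 * \sum_(t < n E) fw t x.

Record state := State {
  st_x : V;
  st_w : V;
  st_e : 'I_(n E) -> V;
  st_ht : 'I_(n E) -> V;
  st_h : V
}.

Definition init : state :=
  State (x0 E) (x0 E) (fun=> 0) (h0 E) ((n E)%:R^-1 *: \sum_(t < n E) h0 E t).

Definition step (k : nat) (om : Omega E) (s : state) : state :=
  let: State x w e ht h := s in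
  let g t := grad (fi E t (draw_i E k t om)) x
             - grad (fi E t (draw_i E k t om)) w + grad (fw t) w - ht t in
  let y t := Q E (draw_Q E k t om) (eta E *: g t + e t) in
  let z t := Q1 E (draw_Q1 E k t om) (grad (fw t) w - ht t) in
  State
    (x - ((n E)%:R^-1 *: \sum_(t < n E) y t + eta E *: h))
    (if draw_w E k om then x else w)
    (fun t => e t + eta E *: g t - y t)
    (fun t => ht t + z t)
    (h + (n E)%:R^-1 *: \sum_(t < n E) z t).

Fixpoint run (k : nat) (om : Omega E) : state :=
  if k is k'.+1 then step k' om (run k' om) else init.

Definition iterate (k : nat) (om : Omega E) : V := st_x (run k om).

Definition draw_index : eqType :=
  (nat * 'I_(n E) + nat * 'I_(n E) + nat * 'I_(n E) + nat)%type.

Definition draw_events (j : draw_index) : set (set (Omega E)) :=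
  match j with
  | inl (inl (inl (k, t))) => preimage_set_system setT (draw_i E k t) setT
  | inl (inl (inr (k, t))) =>
      preimage_set_system setT (draw_Q E k t) measurable
  | inl (inr (k, t)) => preimage_set_system setT (draw_Q1 E k t) measurable
  | inr k => preimage_set_system setT (draw_w E k) measurable
  end.

Record draws_ok : Prop := DrawsOk {
  draw_i_uniform : forall k t a,
    measurable (draw_i E k t @^-1` [set a]) /\
    P E (draw_i E k t @^-1` [set a]) = ((m E)%:R^-1)%:E;
  draw_Q_law : forall k t B, measurable B ->
    distribution (P E) (draw_Q E k t) B = lawQ E B;
  draw_Q1_law : forall k t B, measurable B ->
    distribution (P E) (draw_Q1 E k t) B = lawQ1 E B;
  draw_w_law : forall k, P E (draw_w E k @^-1` [set true]) = (p E)%:E;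
  draws_independent : mutually_independent (P E) draw_events
}.

Record assumptions : Prop := Assumptions {
  n_gt0 : (0 < n E)%N;
  m_gt0 : (0 < m E)%N;
  fi_convex : forall t i, convex (fi E t i);
  fi_smooth : forall t i, smooth (L E) (fi E t i);
  fw_smooth : forall t, smooth (Lbar E) (fw t);
  fobj_smooth : smooth (Lf E) fobj;
  (* the bounds divide by L_f *)
  Lf_gt0 : 0 < Lf E;
  mu_ge0 : 0 <= mu E;
  fobj_strongly_convex : strongly_convex (mu E) fobj;
  xstar_optimal : forall x, fobj (xstar E) <= fobj x;
  eta_gt0 : 0 < eta E;
  p_range : 0 < p E <= 1;
  Q_compressor : contraction_compressor (lawQ E) (Q E) (delta E);
  Q_mean : mean_scaling (lawQ E) (Q E) (delta E);
  Q1_compressor : contraction_compressor (lawQ1 E) (Q1 E) (delta1 E);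
  Q1_mean : mean_scaling (lawQ1 E) (Q1 E) (delta1 E);
  draws_assumption : draws_ok
}.

Definition rho : R :=
  Num.min (mu E * eta E / 2)
    (Num.min (delta E / 4) (Num.min (delta1 E / 4) (p E / 4))).

Definition weight (k : nat) : R := (1 - rho) ^- k.

Definition Weight (k : nat) : R := \sum_(i < k.+1) weight i.

Definition xbar (k : nat) (om : Omega E) : V :=
  (Weight k)^-1 *: \sum_(i < k.+1) weight i *: iterate i om.

(* An extended real, so that a term with denominator 0 (e.g. when delta = 1)
   is +oo and does not constrain the minimum: in [\bar R], 0^-1 = +oo. *)
Definition eta_max : \bar R :=
  let nR : R := (n E)%:R in
  let d := delta E in
  let d1 := delta1 E in
  Order.min (1%:E / (4 * Lf E + 33 * L E / nR)%:E)%E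
 (Order.min (d%:E / (60 * Num.sqrt (1 - d) * Lf E)%:E)%E
 (Order.min ((Num.sqrt (nR * d))%:E /
             (229 * Num.sqrt ((1 - d) * Lf E * L E))%:E)%E
 (Order.min ((Num.sqrt nR * d)%:E /
             (360 * Num.sqrt ((1 - d) * Lf E * Lbar E))%:E)%E
            ((d * Num.sqrt d1)%:E /
             (120 * Num.sqrt ((1 - d) * p E * Lf E *
                              (Lf E + 12 * Lbar E / nR) *
                              (1 + 2 * p E / d1)))%:E)%E))).

Definition expected_gap (k : nat) : \bar R :=
  'E_(P E)[fun om => (fobj (xbar k om) - fobj (xstar E))%R]%E.

Definition dist0 : R := enorm (x0 E - xstar E) ^+ 2.

Definition gradgap0 : R :=
  \sum_(t < n E) enorm (grad (fw t) (x0 E) - h0 E t) ^+ 2.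

Definition fgap0 : R := fobj (x0 E) - fobj (xstar E).

End Run.

(* Main.v *)
(** With y = x - (mean of the e_tau), the compression Q cancels from the step of
    y, so y makes an exact stochastic gradient step taken at the perturbed point
    x; the perturbation costs 5 eta L_f |mean e|^2.  The function
      |y - xs|^2 + a (|mean e|^2 + (4/n^2) sum |e_tau|^2)
        + b |mean r|^2 + (c/n^2) sum |r_tau|^2 + (eta/2p) (f w - f xs),
    where xs is the minimiser and r_tau = grad f_tau(w) - h_tau, shrinks in mean
    by the factor 1 - rho up to a gain of (2/5) eta (f x - f xs).  Both averages
    and sums of squares are needed: unbiasedness of Q and Q_1 lets the averages
    contract with constants of order L_f, while the workers' individual terms
    only enter with a factor 1/n.  The draws of step k are independent of the state they act on, so by
    Fubini they may be averaged with that state frozen.  Summing with the weights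
    w_k and Jensen's inequality give (i); (ii) follows from a lower bound on
    eta_max. *)

From HB Require Import structures.
From mathcomp Require Import all_boot all_order all_algebra.
From mathcomp Require Import all_classical all_reals all_analysis.
From mathcomp Require Import measurable_realfun ring lra.
Require Import Defs.

Set Implicit Arguments.
Unset Strict Implicit.
Unset Printing Implicit Defensive.

Import Order.TTheory GRing.Theory Num.Theory.
Import numFieldNormedType.Exports.

Local Open Scope classical_set_scope.
Local Open Scope ring_scope.

(** * Gradients and the Euclidean inner product *)

(** The weights are solved for in cascade. [rho] takes at most a quarter of [delta], [delta1] and
    [p]; what is left of the contraction of one part of the function pays for that part's appearance
    in the bounds of the others. So [a] is fixed by the price of the perturbation, [b] by what |mean
    r|^2 adds to the error recursion, and [c] by what the individual residuals add to the recursions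
    of both the errors and |mean r|^2. Integrability of the iterates is not given. Conditional means
    are therefore taken as extended integrals of nonnegative functions, and integrability passes
    from step [k] to step [k+1] together with the bound. The gap needs no estimate of its own: the
    mean of the next value of the function is nonnegative, so the one-step inequality itself bounds
    the gap by the current value. Freezing the state rests on seeing the sample space through two
    smaller sigma-algebras: under independence the map [w |-> (w, w)] has a product law. In
    dimension 0 the Lipschitz constants may be negative; the gap is then 0 and this case is split
    off. *)

Section dot.
Variables (R : realType) (d : nat).
Implicit Types x y z : 'rV[R]_d.

Definition dot x y : R := \sum_(j < d) x 0 j * y 0 j.

Lemma dotC x y : dot x y = dot y x.
Proof. by apply: eq_bigr => j _; rewrite mulrC. Qed.

Lemma dotDl x y z : dot (x + y) z = dot x z + dot y z.
Proof. by rewrite -big_split; apply: eq_bigr => j _; rewrite mxE mulrDl. Qed.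

Lemma dotZl a x z : dot (a *: x) z = a * dot x z.
Proof. by rewrite mulr_sumr; apply: eq_bigr => j _; rewrite mxE mulrA. Qed.

Lemma dotNl x z : dot (- x) z = - dot x z.
Proof. by rewrite -scaleN1r dotZl mulN1r. Qed.

Lemma dotDr x y z : dot z (x + y) = dot z x + dot z y.
Proof. by rewrite dotC dotDl !(dotC z). Qed.

Lemma dotZr a x z : dot z (a *: x) = a * dot z x.
Proof. by rewrite dotC dotZl (dotC z). Qed.

Lemma dotNr x z : dot z (- x) = - dot z x.
Proof. by rewrite dotC dotNl (dotC z). Qed.

Definition dotE := (dotDl, dotDr, dotNl, dotNr, dotZl, dotZr).

Lemma dot0l z : dot 0 z = 0.
Proof. by rewrite -(scale0r z) dotZl mul0r. Qed.

Lemma dot0r z : dot z 0 = 0.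
Proof. by rewrite dotC dot0l. Qed.

Lemma dot_suml (I : Type) (r : seq I) (P : pred I) (F : I -> 'rV[R]_d) z :
  dot (\sum_(i <- r | P i) F i) z = \sum_(i <- r | P i) dot (F i) z.
Proof. by apply: (big_morph (dot^~ z)) => [x y|]; rewrite ?dotDl ?dot0l. Qed.

Lemma dot_ge0 x : 0 <= dot x x.
Proof. by apply: sumr_ge0 => j _; rewrite -expr2 sqr_ge0. Qed.

Lemma enorm_sq x : enorm x ^+ 2 = dot x x.
Proof.
rewrite /enorm sqr_sqrtr; first by apply: eq_bigr => j _; rewrite expr2.
by apply: sumr_ge0 => j _; rewrite sqr_ge0.
Qed.

Lemma dot_eq0 x : dot x x <= 0 -> x = 0.
Proof.
move=> h; apply/rowP => j; rewrite mxE; apply/eqP.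
have h0 : dot x x == 0 by rewrite eq_le h dot_ge0.
move: h0; rewrite psumr_eq0; last by move=> i _; rewrite -expr2 sqr_ge0.
by move/allP/(_ j); rewrite mem_index_enum mulf_eq0 orbb; apply.
Qed.

Lemma dot_le_enorm x y : dot x y <= enorm x * enorm y.
Proof.
have a0 : 0 <= enorm x by rewrite sqrtr_ge0.
have b0 : 0 <= enorm y by rewrite sqrtr_ge0.
have := dot_ge0 (enorm y *: x - enorm x *: y).
rewrite !dotE (dotC y x) -!enorm_sq.
case: (eqVneq (enorm x) 0) => [x0 _|x0].
  have -> : x = 0 by apply: dot_eq0; rewrite -enorm_sq x0 expr0n.
  by rewrite dot0l mulr_ge0// sqrtr_ge0.
case: (eqVneq (enorm y) 0) => [y0 _|y0].
  have -> : y = 0 by apply: dot_eq0; rewrite -enorm_sq y0 expr0n.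
  by rewrite dot0r mulr_ge0// sqrtr_ge0.
have a1 : 0 < enorm x by rewrite lt_def x0.
have b1 : 0 < enorm y by rewrite lt_def y0.
have ab : 0 < enorm x * enorm y by rewrite mulr_gt0.
set a := enorm x in a0 a1 ab *; set b := enorm y in b0 b1 ab *.
move=> h; have : 0 <= (a * b) * (a * b - dot x y) by nra.
by rewrite pmulr_rge0// subr_ge0.
Qed.

Lemma dot_young (s : R) x y : 0 < s ->
  dot (x + y) (x + y) <= (1 + s) * dot x x + (1 + s^-1) * dot y y.
Proof.
move=> s0; have := dot_ge0 (s *: x - y); rewrite !dotE (dotC y x) => h.
have sV : 0 < s^-1 by rewrite invr_gt0.
have e : s^-1 * (s * (s * dot x x) - dot x y * s + (- (s * dot x y) + dot y y))
  = s * dot x x - 2 * dot x y + s^-1 * dot y y by field; rewrite gt_eqF.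
have : 0 <= s * dot x x - 2 * dot x y + s^-1 * dot y y.
  rewrite -e; apply: mulr_ge0; first exact: ltW.
  by move: h; lra.
lra.
Qed.

End dot.

Section gradient.
Variables (R : realType) (d : nat).
Implicit Types (f : 'rV[R]_d -> R) (x y v : 'rV[R]_d).

Lemma derive_dot f x v : differentiable f x -> 'D_v f x = dot (grad f x) v.
Proof.
move=> df; rewrite deriveE//.
rewrite [in LHS](row_sum_delta v) linear_sum; apply: eq_bigr => j _.
by rewrite linearZ /= mxE deriveE// mulrC.
Qed.

Lemma line_is_derive f x v (t : R) : (forall z, differentiable f z) ->
  is_derive t (1 : R) (fun t : R => f (x + t *: v)) (dot (grad f (x + t *: v)) v).
Proof.
move=> df; rewrite -derive_dot//.
have e : (fun h : R => h^-1 *: (((fun t : R => f (x + t *: v)) \o shift t) (h *: 1)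
            - f (x + t *: v)))
  = (fun h : R => h^-1 *: ((f \o shift (x + t *: v)) (h *: v) - f (x + t *: v))).
  apply/funext => h /=; congr (_ *: (f _ - _)).
  by rewrite scalerDl addrCA [h%:A]mulr1.
apply: DeriveDef; last by rewrite /derive e.
rewrite /derivable e.
exact: (@diff_derivable R _ _ f (x + t *: v) v).
Qed.

Lemma is_derive_sub_quadratic (phi : R -> R) (dphi a b t : R) :
  is_derive t (1 : R) phi dphi ->
  is_derive t (1 : R) (fun t => phi t - t * a - b * t ^+ 2)
    (dphi - a - 2 * b * t).
Proof.
move=> h.
have -> : (fun t => phi t - t * a - b * t ^+ 2) = phi - a \*: id - b \*: (id * id).
  by apply/funext => u; rewrite [u * _]mulrC expr2.
apply: is_derive_eq; rewrite /GRing.scale /=; ring.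
Qed.

(** The mean value theorem is applied on [[0, 1]] to [psi], the restriction of [f] to the segment
    minus its claimed quadratic majorant. Its derivative is at most 0 by Cauchy-Schwarz and the
    Lipschitz bound, so no integral of the gradient is needed. *)
Lemma smooth_descent (L : R) f x y : smooth L f ->
  f y <= f x + dot (grad f x) (y - x) + L / 2 * dot (y - x) (y - x).
Proof.
move=> [df lip]; set v := y - x; set N := dot v v; set c := dot _ v.
pose psi := fun t : R => f (x + t *: v) - t * c - L / 2 * N * t ^+ 2.
have dpsi (t : R) : is_derive t (1 : R) psi (dot (grad f (x + t *: v)) v - c - L * N * t).
  rewrite (_ : L * N * t = 2 * (L / 2 * N) * t); last by field.
  exact/is_derive_sub_quadratic/line_is_derive.
have cpsi : {within `[0, 1], continuous psi}.
  apply: continuous_subspaceT => t; apply: differentiable_continuous.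
  by apply/derivable1_diffP; apply: (@ex_derive _ _ _ _ _ _ _ (dpsi t)).
have [t] := MVT_segment ler01 (fun t _ => dpsi t) cpsi.
rewrite in_itv /= => /andP[t0 t1].
rewrite /psi scale1r scale0r addr0 [x + v]addrC subrK => e.
suff : dot (grad f (x + t *: v)) v - c - L * N * t <= 0 by lra.
have := dot_le_enorm (grad f (x + t *: v) - grad f x) v.
rewrite dotDl dotNl -/c => h1.
have := lip (x + t *: v) x; rewrite [x + _ - x]addrAC subrr add0r => h2.
have e1 : enorm (t *: v) = t * enorm v.
  rewrite /enorm; under eq_bigr do rewrite mxE exprMn.
  by rewrite -mulr_sumr sqrtrM ?sqr_ge0// sqrtr_sqr ger0_norm.
have e2 : N = enorm v * enorm v by rewrite /N -enorm_sq expr2.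
have h3 := ler_wpM2r (sqrtr_ge0 _ : 0 <= enorm v) h2.
rewrite e1 in h3; rewrite e2; lra.
Qed.

Lemma strongly_convexE (mu : R) f x y (t : R) :
  strongly_convex mu f -> 0 <= t <= 1 ->
  f (x + t *: (y - x)) <= (1 - t) * f x + t * f y
    - mu / 2 * (t * (1 - t)) * dot (y - x) (y - x).
Proof.
move=> sc /andP[t0 t1].
have := sc (@Itv01 _ t t0 t1) y x; rewrite !inE => /(_ I I).
have cE (E : lmodType R) (a b : convex_lmodType E) :
  conv (Itv01 t0 t1) a b = t *: (a : E) + (1 - t) *: (b : E) by [].
rewrite !cE !enorm_sq.
rewrite (_ : t *: y + (1 - t) *: x = x + t *: (y - x)); last first.
  by apply/rowP => j; rewrite !mxE; ring.
move=> h.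
suff e : dot (x + t *: (y - x)) (x + t *: (y - x)) =
  (1 - t) * dot x x + t * dot y y - t * (1 - t) * dot (y - x) (y - x).
  rewrite e in h.
  have {}h : _ <= t * (f y - mu / 2 * dot y y) + (1 - t) * (f x - mu / 2 * dot x x)
    := h.
  lra.
rewrite !dotE (dotC y x); ring.
Qed.

(** On the segment, strong convexity says [psi h <= psi 0] for [h] in [[0, 1]]. The right difference
    quotients of [psi] at 0 are thus nonpositive, hence so is its derivative there, which is the
    claim. *)
Lemma strongly_convex_grad (mu : R) f x y :
  strongly_convex mu f -> (forall z, differentiable f z) ->
  f x + dot (grad f x) (y - x) + mu / 2 * dot (y - x) (y - x) <= f y.
Proof.
move=> sc df; set v := y - x; set N := dot v v; set c := dot _ v.
pose psi := fun t : R => f (x + t *: v) - t * (f y - f x - mu / 2 * N) - mu / 2 * N * t ^+ 2.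
have dpsi : is_derive (0 : R) (1 : R) psi (c - (f y - f x - mu / 2 * N)).
  have := is_derive_sub_quadratic (f y - f x - mu / 2 * N) (mu / 2 * N)
    (line_is_derive x v 0 df).
  by rewrite mulr0 subr0 scale0r addr0.
suff : c - (f y - f x - mu / 2 * N) <= 0 by lra.
have [dv <-] := dpsi.
have /cvg_dnbhs_at_right cv : derivable psi 0 1 by [].
have -> : 'D_1 psi 0 = lim ((fun h => h^-1 *: ((psi \o shift 0) (h *: 1) - psi 0)) @ (0:R)^'+).
  by apply/esym/cvg_lim => //; apply: cvg_dnbhs_at_right; exact: dv.
apply: limr_le; first by apply: cvgP; apply: cvg_dnbhs_at_right; exact: dv.
near=> h.
have h0 : 0 < h by [].
have h1 : h <= 1 by near: h; exact: nbhs_right_le.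
rewrite /= [_%:A]mulr1 addr0 /GRing.scale /= pmulr_rle0 ?invr_gt0//.
rewrite /psi scale0r addr0.
have := @strongly_convexE mu f x y h sc.
rewrite (ltW h0) h1 => /(_ isT); rewrite -/v -/N; nra.
Unshelve. all: by end_near.
Qed.

(** The tangent-plane form of convexity: it passes to averages of functions and is the form that
    cocoercivity and Jensen's inequality consume. *)
Definition gradient_convex f : Prop :=
  forall x y, f x + dot (grad f x) (y - x) <= f y.

Lemma convex_gradient_convex f : convex f -> (forall z, differentiable f z) ->
  gradient_convex f.
Proof.
move=> cf df x y.
have sc : strongly_convex 0 f.
  rewrite /strongly_convex [X in convex X](_ : _ = f)//.
  by apply/funext => z; rewrite mul0r mul0r subr0.
have := strongly_convex_grad x y sc df; lra.
Qed.

(** The value at [z = x - g / L], with [g] the difference of gradients, is bounded below by the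
    tangent plane at [y] and above by the descent inequality at [x]. *)
Lemma smooth_cocoercive (L : R) f x y : 0 <= L -> smooth L f ->
  gradient_convex f ->
  dot (grad f x - grad f y) (grad f x - grad f y)
    <= 2 * L * (f x - f y - dot (grad f y) (x - y)).
Proof.
move=> L0 sf cf; set g := grad f x - grad f y.
have gE : g = grad f x - grad f y by [].
clearbody g.
(* For [L = 0] the step of length [1 / L] makes no sense, but then the gradient is constant and both
   sides vanish. *)
case: (eqVneq L 0) => [L_0|Ln0].
  have := sf.2 x y; rewrite -gE L_0 mul0r => h.
  have := sqr_ge0 (enorm g); rewrite -enorm_sq mulr0 mul0r.
  have g0 : enorm g = 0 by apply/eqP; rewrite eq_le h sqrtr_ge0.
  by rewrite g0 expr0n.
have Lp : 0 < L by rewrite lt_def Ln0.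
pose z := x - L^-1 *: g.
have h1 := cf y z.
have h2 := smooth_descent x z sf.
have e1 : z - x = - (L^-1 *: g) by rewrite /z addrAC subrr add0r.
have e2 : z - y = (x - y) - L^-1 *: g by rewrite /z addrAC.
move: h1 h2; rewrite e1 e2 !dotE.
have e3 : dot (grad f x) g = dot (grad f y) g + dot g g.
  by rewrite -dotDl; congr (dot _ _); rewrite gE addrC subrK.
have e4 : L / 2 * - - (L^-1 * (L^-1 * dot g g)) = L^-1 / 2 * dot g g.
  by field.
rewrite e3 => h1 h2.
have : L^-1 / 2 * dot g g <= f x - f y - (dot (grad f y) x - dot (grad f y) y) by nra.
move=> h; have := ler_wpM2l (mulr_ge0 (ler0n R 2) L0) h.
by have -> : 2 * L * (L^-1 / 2 * dot g g) = dot g g by field.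
Qed.

(** A gradient step of length [1 / L] from [x] decreases [f] by at least |grad|^2 / (2L) and cannot
    go below the minimum. At [x = y] this also yields that the gradient vanishes at a minimiser. *)
Lemma smooth_grad_le (L : R) f x y : 0 < L -> smooth L f ->
  (forall z, f y <= f z) -> dot (grad f x) (grad f x) <= 2 * L * (f x - f y).
Proof.
move=> L0 sf miny; set g := grad f x.
have := smooth_descent x (x - L^-1 *: g) sf.
rewrite (_ : x - _ - x = - (L^-1 *: g)); last by rewrite addrAC subrr add0r.
rewrite !dotE -/g.
have -> : L / 2 * - - (L^-1 * (L^-1 * dot g g)) = L^-1 / 2 * dot g g.
  by field; rewrite gt_eqF.
move=> h; have h2 := miny (x - L^-1 *: g).
have : L^-1 / 2 * dot g g <= f x - f y by lra.
move=> h3; have := ler_wpM2l (mulr_ge0 (ler0n R 2) (ltW L0)) h3.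
by have -> : 2 * L * (L^-1 / 2 * dot g g) = dot g g by field; rewrite gt_eqF.
Qed.

Lemma grad_mean (n : nat) (F : 'I_n -> 'rV[R]_d -> R) x :
  (forall t z, differentiable (F t) z) ->
  grad (fun x => n%:R^-1 * \sum_(t < n) F t x) x
    = n%:R^-1 *: \sum_(t < n) grad (F t) x.
Proof.
move=> dF; apply/rowP => j; rewrite !mxE summxE.
rewrite [X in derive X](_ : _ = n%:R^-1 \*: (\sum_(t < n) F t)); last first.
  by apply/funext => z /=; rewrite fct_sumE.
rewrite deriveZ; last by apply: derivable_sum => t; exact: diff_derivable.
rewrite derive_sum; last by move=> t; exact: diff_derivable.
by congr (_ * _); apply: eq_bigr => t _; rewrite mxE.
Qed.

Lemma gradient_convex_mean (n : nat) (F : 'I_n -> 'rV[R]_d -> R) :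
  (forall t z, differentiable (F t) z) -> (forall t, gradient_convex (F t)) ->
  gradient_convex (fun x => n%:R^-1 * \sum_(t < n) F t x).
Proof.
move=> dF cF x y; rewrite grad_mean// dotZl dot_suml -mulrDr -big_split /=.
by apply: ler_wpM2l; [rewrite invr_ge0|apply: ler_sum => t _; exact: cF].
Qed.

(** The tangent-plane inequalities at the barycentre are averaged; their linear terms cancel. *)
Lemma jensen_gradient_convex f (I : finType) (a : I -> R) (X : I -> 'rV[R]_d) :
  gradient_convex f -> (forall i, 0 <= a i) -> \sum_i a i = 1 ->
  f (\sum_i a i *: X i) <= \sum_i a i * f (X i).
Proof.
move=> cf a0 a1; set y := \sum_i _.
have h i : a i * f y + a i * dot (grad f y) (X i - y) <= a i * f (X i).
  by rewrite -mulrDr; apply: ler_wpM2l => //; exact: cf.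
have := ler_sum (index_enum I) (fun i (_ : true) => h i).
rewrite big_split /= -mulr_suml a1 mul1r.
suff -> : \sum_i a i * dot (grad f y) (X i - y) = 0 by rewrite addr0.
under eq_bigr do rewrite dotDr dotNr mulrBr -dotZr dotC.
by rewrite sumrB -dot_suml -/y -mulr_suml a1 mul1r dotC subrr.
Qed.

End gradient.

(** * Independent groups of draws *)

Section independence.
Local Open Scope ereal_scope.
Context d (T : measurableType d) (R : realType) (P : probability T R).
Context (J : eqType) (G : J -> set (set T)).
Hypothesis GI : forall j, setI_closed (G j).
Hypothesis GT : forall j, G j setT.
Hypothesis Gm : forall j, G j `<=` measurable.
Hypothesis indepG : mutually_independent P G.

Definition gen (K : set J) : set (set T) := \bigcup_(j in K) G j.

(** The pi-system on which [mutually_independent] speaks directly. [gen K] generates the same events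
    but need not be closed under intersection. *)
Definition cylinders (K : set J) : set (set T) :=
  [set A | exists (s : seq J) (B : J -> set T),
     [/\ uniq s, forall j, j \in s -> K j /\ G j (B j) &
         A = \bigcap_(j in [set` s]) B j]].

Lemma setI_closed_cylinders K : setI_closed (cylinders K).
Proof.
move=> _ _ [s1 [B1 [u1 h1 ->]]] [s2 [B2 [u2 h2 ->]]].
exists (undup (s1 ++ s2)), (fun j => (if j \in s1 then B1 j else setT) `&`
   (if j \in s2 then B2 j else setT)); split.
- exact: undup_uniq.
- move=> j; rewrite mem_undup mem_cat => /orP js; split.
    by case: js => [/h1[]|/h2[]].
  by apply: GI; [case: ifPn => [/h1[_ ?]|_]|case: ifPn => [/h2[_ ?]|_]].
- apply/seteqP; split => [w [w1 w2] j /=|w h].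
    by move=> _; split; case: ifPn => // js; [exact: w1|exact: w2].
  split => j /= js.
    by have := h j; rewrite /= mem_undup mem_cat js => /(_ isT)[].
  by have := h j; rewrite /= mem_undup mem_cat js orbT => /(_ isT)[].
Qed.

Lemma cylinders_measurable K : cylinders K `<=` measurable.
Proof.
move=> _ [s [B [_ h ->]]]; apply: fin_bigcap_measurable => //.
by move=> j /= /h[_ /Gm].
Qed.

Lemma gen_measurable K : gen K `<=` measurable.
Proof. by move=> A [j _ /Gm]. Qed.

Lemma sigma_gen_measurable K A : <<s gen K >> A -> measurable A.
Proof.
apply: smallest_sub; first exact: sigma_algebra_measurable.
exact: gen_measurable.
Qed.

Lemma sigma_gen_cylinders K : <<s gen K >> `<=` <<s cylinders K >>.
Proof.
apply: smallest_sub; first exact: smallest_sigma_algebra.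
move=> A [j Kj GjA]; apply: sub_sigma_algebra; exists [:: j], (fun=> A); split => //.
- by move=> i; rewrite inE => /eqP ->.
- by rewrite set_cons1 bigcap_set1.
Qed.

Lemma cylindersT K : cylinders K setT.
Proof. by exists [::], (fun=> setT); split => //; rewrite set_nil bigcap_set0. Qed.

Lemma indep_cylinders K1 K2 A B : K1 `&` K2 = set0 ->
  cylinders K1 A -> cylinders K2 B -> P (A `&` B) = P A * P B.
Proof.
move=> K12 [s1 [B1 [u1 h1 ->]]] [s2 [B2 [u2 h2 ->]]].
have dis j : j \in s1 -> j \in s2 -> False.
  move=> /h1[k1 _] /h2[k2 _].
  by have : (K1 `&` K2) j by []; rewrite K12.
(* One family of events for both cylinders: as the index lists are disjoint, independence can be
   applied to their concatenation. *)
pose BB j := if j \in s1 then B1 j else B2 j.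
have -> : \bigcap_(j in [set` s1]) B1 j = \bigcap_(j in [set` s1]) BB j.
  by apply: eq_bigcapr => j /= js; rewrite /BB js.
have -> : \bigcap_(j in [set` s2]) B2 j = \bigcap_(j in [set` s2]) BB j.
  apply: eq_bigcapr => j /= js; rewrite /BB; case: ifPn => // js1.
  by have := dis _ js1 js.
have u : uniq (s1 ++ s2).
  rewrite cat_uniq u1 u2 andbT /=; apply/hasPn => j js2.
  by apply/negP => js1; exact: (dis j).
have hB j : j \in s1 ++ s2 -> G j (BB j).
  by rewrite mem_cat /BB; case: ifPn => [/h1[]//|_ /= /h2[]].
rewrite -bigcap_setU (_ : [set` s1] `|` [set` s2] = [set` s1 ++ s2]); last first.
  by apply/seteqP; split => j /=; rewrite mem_cat => /orP.
rewrite !indepG//; first by rewrite big_cat.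
- by move=> j js; apply: hB; rewrite mem_cat js orbT.
- by move=> j js; apply: hB; rewrite mem_cat js.
Qed.

(** The product formula is extended from cylinders one factor at a time: first [B] becomes arbitrary
    against a fixed cylinder, then [A] against the arbitrary [B]. *)
Lemma indep_sigma K1 K2 A B : K1 `&` K2 = set0 ->
  <<s gen K1 >> A -> <<s gen K2 >> B -> P (A `&` B) = P A * P B.
Proof.
move=> K12 sA sB.
have finP C : measurable C -> P C \is a fin_num by move=> ?; exact: fin_num_measure.
(* As functions of [C], both sides are finite measures: [P] restricted to [D], and [P] scaled by the
   number [P D]. They agree on a pi-system containing [setT], hence on the sigma-algebra it
   generates. *)
have step K3 (D : set T) : measurable D ->
    (forall C, cylinders K3 C -> P (C `&` D) = P D * P C) ->
    forall C, <<s gen K3 >> C -> P (C `&` D) = P D * P C.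
  move=> mD h C /sigma_gen_cylinders sC.
  have nn : (0 <= fine (P D))%R by rewrite fine_ge0.
  have -> : P D * P C = mscale (NngNum nn) P C by rewrite /mscale /= fineK ?finP.
  apply: (@g_sigma_algebra_measure_unique _ _ _ (cylinders K3) _ (fun=> setT)
    _ _ (mrestr P mD) (mscale (NngNum nn) P)) => //.
  - exact: cylinders_measurable.
  - by move=> _; exact: cylindersT.
  - by rewrite bigcup_const.
  - exact: setI_closed_cylinders.
  - by move=> E cE; rewrite [LHS]h// -[in LHS](fineK (finP _ mD)).
  - by move=> _; rewrite [ltLHS](_ : _ = P D) ?ltey_eq ?finP// -[in RHS](setTI D).
have mA := sigma_gen_measurable sA; have mB := sigma_gen_measurable sB.
rewrite muleC; apply: (step K1) => // C cC; rewrite setIC.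
rewrite muleC; apply: (step K2) => //; first exact: (cylinders_measurable cC).
by move=> E cE; rewrite setIC (indep_cylinders K12).
Qed.

(* The sample space, observed only through the draws whose index lies in K. *)
Definition known (K : set J) : measurableType (gen K).-sigma :=
  g_sigma_algebraType (gen K).
Local Notation TK K := (known K).

Definition forget (K : set J) : T -> TK K := id.

Lemma measurable_forget K : measurable_fun [set: T] (forget K).
Proof.
by move=> _ A mA; rewrite setTI; exact: (sigma_gen_measurable mA).
Qed.

HB.instance Definition _ K :=
  isMeasurableFun.Build _ _ _ _ (forget K) (@measurable_forget K).

Definition history (K : set J) : probability (TK K) R :=
  distribution P (forget K).

(** A single outcome seen twice, through the draws in [K1] and through those in [K2]. Independence
    of the two groups amounts to its law being a product measure. *)
Definition diag (K1 K2 : set J) (w : T) : TK K1 * TK K2 := (w, w).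

Lemma measurable_diag K1 K2 : measurable_fun [set: T] (@diag K1 K2).
Proof. by apply: measurable_fun_pair; exact: measurable_forget. Qed.

HB.instance Definition _ K1 K2 :=
  isMeasurableFun.Build _ _ _ _ (@diag K1 K2) (@measurable_diag K1 K2).

Section two_groups.
Variables (K1 K2 : set J).
Hypothesis K12 : K1 `&` K2 = set0.

Lemma distribution_diag X : measurable X ->
  (history K1 \x history K2) X = distribution P (@diag K1 K2) X.
Proof.
apply: product_measure_unique => A B mA mB.
rewrite /= /pushforward /=.
exact: (indep_sigma K12).
Qed.

(** Since the law of [diag] is the product of the two histories, Tonelli's theorem replaces the
    second copy of [w] by an independent one. Nonnegativity of [f] stands in for integrability. *)
Lemma decouple (f : TK K1 * TK K2 -> \bar R) :
  measurable_fun [set: TK K1 * TK K2] f -> (forall z, 0 <= f z) ->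
  \int[P]_w f (w, w) = \int[P]_w \int[P]_w' f (w, w').
Proof.
move=> mf f0.
transitivity (\int[distribution P (@diag K1 K2)]_z f z).
  by rewrite ge0_integral_distribution.
rewrite (eq_measure_integral (history K1 \x history K2)%E); last first.
  by move=> A mA _; apply: esym; exact: distribution_diag.
rewrite fubini_tonelli1// ge0_integral_distribution//; last 2 first.
- exact: measurable_fun_fubini_tonelli_F.
- by move=> x; apply: integral_ge0 => y _; exact: f0.
apply: eq_integral => x _ /=.
rewrite /fubini_F ge0_integral_distribution//.
exact: measurableT_comp.
Qed.

(** Integrability of the product comes from [decouple] applied to its absolute value, where the
    double integral factors; Fubini on the product law then gives the mean. *)
Lemma indep_mul (X : TK K1 -> R) (Y : TK K2 -> R) :
  measurable_fun setT X -> measurable_fun setT Y ->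
  P.-integrable setT (EFin \o (X : T -> R)) ->
  P.-integrable setT (EFin \o (Y : T -> R)) ->
  P.-integrable setT (EFin \o (fun w : T => X w * Y w)%R) /\
  (\int[P]_w (X w * Y w) = \int[P]_w (X w) * \int[P]_w (Y w))%R.
Proof.
move=> mX mY iX iY.
pose f (z : TK K1 * TK K2) := (X z.1 * Y z.2)%:E.
have mf : measurable_fun [set: TK K1 * TK K2] f.
  apply/measurable_EFinP; apply: measurable_funM.
    by apply: measurableT_comp mX _; exact: measurable_fst.
  by apply: measurableT_comp mY _; exact: measurable_snd.
have fX := integrable_fin_num measurableT iX.
have fY := integrable_fin_num measurableT iY.
have iXY : P.-integrable setT (f \o (@diag K1 K2)).
  apply/integrableP; split; first by apply: measurableT_comp => //; exact: measurable_diag.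
  have -> : \int[P]_x `|(f \o (@diag K1 K2)) x| = \int[P]_x (abse \o f) (x, x) by [].
  have maf : measurable_fun [set: TK K1 * TK K2] (abse \o f).
    by apply: measurableT_comp => //; exact: abse_measurable.
  have [mY' fY'] := integrableP _ _ _ iY; have [mX' fX'] := integrableP _ _ _ iX.
  have mYn : measurable_fun setT (abse \o (EFin \o (Y : T -> R))).
    by apply: measurableT_comp => //; exact: abse_measurable.
  have mXn : measurable_fun setT (abse \o (EFin \o (X : T -> R))).
    by apply: measurableT_comp => //; exact: abse_measurable.
  rewrite (decouple maf); last by move=> z; exact: abse_ge0.
  have -> : \int[P]_w \int[P]_w' (abse \o f) (w, w') =
     \int[P]_w (`|(X w)%:E| * \int[P]_w' `|(Y w')%:E|).
    apply: eq_integral => w _ /=; rewrite -ge0_integralZl//.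
    by apply: eq_integral => w' _; rewrite normrM EFinM.
  rewrite ge0_integralZr//; last exact: integral_ge0.
  by rewrite lte_mul_pinfty// ?integral_ge0// ge0_fin_numE// integral_ge0.
split => //.
have fXY := integrable_fin_num measurableT iXY.
apply: EFin_inj.
rewrite /Rintegral EFinM !fineK//.
transitivity (\int[distribution P (@diag K1 K2)]_z f z).
  by rewrite integral_distribution.
have ipr : (history K1 \x history K2).-integrable setT f.
  apply/integrableP; split => //.
  rewrite (eq_measure_integral (distribution P (@diag K1 K2))).
    have := integrable_pushforward (@measurable_diag K1 K2) mf iXY measurableT.
    by move=> /integrableP[].
  by move=> A mA _; exact: distribution_diag.
rewrite (eq_measure_integral (history K1 \x history K2)%E); last first.
  by move=> A mA _; apply: esym; exact: distribution_diag.
rewrite -integral12_prod_meas1//.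
have iY' : (history K2).-integrable setT (EFin \o Y).
  by apply: integrable_pushforward => //; exact/measurable_EFinP.
have YE : \int[history K2]_y (Y y)%:E = \int[P]_y (Y y)%:E.
  by rewrite integral_distribution//; exact/measurable_EFinP.
have fE x : fubini_F (history K2) f x = \int[P]_y (Y y)%:E * (X x)%:E.
  rewrite /fubini_F /f /=; under eq_integral do rewrite EFinM.
  by rewrite integralZl// YE muleC.
rewrite (eq_integral (fun x => \int[P]_y (Y y)%:E * (X x)%:E)); last first.
  by move=> x _; exact: fE.
rewrite -(fineK fY) integralZl//; last first.
  by apply: integrable_pushforward => //; exact/measurable_EFinP.
by rewrite muleC integral_distribution//; exact/measurable_EFinP.
Qed.

End two_groups.

End independence.

(** * Measurable random vectors *)

Section vector_measurability.
Context d0 (T : measurableType d0) (R : realType) (d : nat).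
Implicit Types X Y : T -> 'rV[R]_d.

Definition vmeas X := forall j, measurable_fun [set: T] (fun w => X w 0 j).

Lemma vmeas_cst (v : 'rV[R]_d) : vmeas (fun=> v).
Proof. by move=> j; exact: measurable_cst. Qed.

Lemma vmeasD X Y : vmeas X -> vmeas Y -> vmeas (fun w => X w + Y w).
Proof.
move=> mX mY j; rewrite (_ : (fun w => _) = (fun w => X w 0 j) \+ (fun w => Y w 0 j)).
  exact: measurable_funD.
by apply/funext => w; rewrite mxE.
Qed.

Lemma vmeasZ (a : R) X : vmeas X -> vmeas (fun w => a *: X w).
Proof.
move=> mX j; rewrite (_ : (fun w => _) = (fun w => a * X w 0 j)).
  by apply: measurable_funM => //; exact: measurable_cst.
by apply/funext => w; rewrite mxE.
Qed.

Lemma vmeasB X Y : vmeas X -> vmeas Y -> vmeas (fun w => X w - Y w).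
Proof.
move=> mX mY; rewrite (_ : (fun w => _) = (fun w => X w + (-1) *: Y w)).
  by apply: vmeasD => //; exact: vmeasZ.
by apply/funext => w; rewrite scaleN1r.
Qed.

Lemma vmeas_sum (I : Type) (s : seq I) (X : I -> T -> 'rV[R]_d) :
  (forall i, vmeas (X i)) -> vmeas (fun w => \sum_(i <- s) X i w).
Proof.
move=> mX j; rewrite (_ : (fun w => _) = (fun w => \sum_(i <- s) X i w 0 j)).
  by apply: measurable_sum => i; exact: mX.
by apply/funext => w; rewrite summxE.
Qed.

Lemma vmeas_dot X Y : vmeas X -> vmeas Y ->
  measurable_fun [set: T] (fun w => dot (X w) (Y w)).
Proof. by move=> mX mY; apply: measurable_sum => j; exact: measurable_funM. Qed.

Lemma vmeas_if (b : T -> bool) X Y : measurable_fun [set: T] b ->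
  vmeas X -> vmeas Y -> vmeas (fun w => if b w then X w else Y w).
Proof.
move=> mb mX mY j.
rewrite (_ : (fun w => _) = (fun w => if b w then X w 0 j else Y w 0 j)).
  exact: measurable_fun_ifT.
by apply/funext => w; case: ifP.
Qed.

Lemma measurable_fun_countable (C : countType) (Z : T -> C) (g : C -> R) :
  (forall c, measurable (Z @^-1` [set c])) ->
  measurable_fun [set: T] (fun w => g (Z w)).
Proof.
move=> mZ _ B mB; rewrite setTI.
rewrite (_ : _ @^-1` _ =
  \bigcup_(c in [set: C]) (if `[< B (g c) >] then Z @^-1` [set c] else set0)).
  apply: countable_bigcupT_measurable => // c.
  by case: ifP.
apply/seteqP; split => [w /= Bw|w [c _]].
  by exists (Z w) => //; rewrite asboolT.
by case: ifPn => //= /asboolP Bc ->.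
Qed.

Lemma vmeas_finite_index (I : finType) (i : T -> I) (X : I -> T -> 'rV[R]_d) :
  (forall a, measurable (i @^-1` [set a])) -> (forall a, vmeas (X a)) ->
  vmeas (fun w => X (i w) w).
Proof.
move=> mi mX j.
rewrite (_ : (fun w => _) = (fun w => \sum_a (i w == a)%:R * X a w 0 j)).
  apply: measurable_sum => a; apply: measurable_funM; last exact: mX.
  exact: (measurable_fun_countable (Z := i) (fun b => (b == a)%:R)).
apply/funext => w; rewrite (bigD1 (i w))//= eqxx mul1r big1 ?addr0// => a.
by rewrite eq_sym => /negbTE ->; rewrite mul0r.
Qed.

Lemma coord_le_norm (x : 'rV[R]_d) j : `|x 0 j| <= `|x|.
Proof.
rewrite -[leRHS]/(mx_norm x) mx_normrE.
exact: (le_bigmax_cond _ (fun ij => `|x ij.1 ij.2|) (erefl : xpredT (0, j))).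
Qed.

Lemma norm_le_coord (x : 'rV[R]_d) (e : R) : 0 <= e ->
  (forall j, `|x 0 j| <= e) -> `|x| <= e.
Proof.
move=> e0 h; rewrite -[leLHS]/(mx_norm x) mx_normrE.
by apply/bigmax_leP; split => // -[i j] _ /=; rewrite (ord1 i).
Qed.

Definition round_down (n : nat) (x : 'rV[R]_d) : 'rV[R]_d :=
  \row_j ((Num.floor (x 0 j * n.+1%:R))%:~R / n.+1%:R).

Lemma round_down_cvg (x : 'rV[R]_d) : round_down n x @[n --> \oo] --> x.
Proof.
apply/cvgrPdist_lt => e e0.
near=> n.
have n1 : (n.+1%:R : R)^-1 < e.
  rewrite invf_plt ?posrE//.
  apply: (@lt_le_trans _ _ n%:R); last by rewrite ler_nat.
  near: n; exact: nbhs_infty_gtr.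
apply: le_lt_trans n1; apply: norm_le_coord => // j.
rewrite !mxE; set y := x 0 j; set N := n.+1%:R.
have N0 : 0 < N by rewrite ltr0n.
have e1 : y - (Num.floor (y * N))%:~R / N = (y * N - (Num.floor (y * N))%:~R) / N.
  by field; rewrite gt_eqF.
rewrite e1 normrM [`|N^-1|]gtr0_norm ?invr_gt0// ler_piMl ?invr_ge0 ?ltW//.
have h1 := ge_floor (y * N); have h2 := lt_succ_floor (y * N).
rewrite intrD in h2.
rewrite ger0_norm; lra.
Unshelve. all: by end_near.
Qed.

(** [f (X w)] is the limit of [f] at grid points of mesh [1 / (n+1)]. The rounded vector takes
    countably many values, each on an event cut out by finitely many coordinate conditions, so
    coordinatewise measurability is enough. *)
Lemma vmeas_continuous (f : 'rV[R]_d -> R) X : continuous f -> vmeas X ->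
  measurable_fun [set: T] (fun w => f (X w)).
Proof.
move=> cf mX.
apply: (@measurable_fun_cvg _ _ _ _ (fun n w => f (round_down n (X w)))).
  move=> n.
  pose Z w : {ffun 'I_d -> int} := [ffun j => Num.floor (X w 0 j * n.+1%:R)].
  rewrite (_ : (fun w => _) = (fun w => f (\row_j ((Z w j)%:~R / n.+1%:R)))).
    apply: (measurable_fun_countable (Z := Z)
      (fun z : {ffun 'I_d -> int} => f (\row_j ((z j)%:~R / n.+1%:R)))) => z.
    rewrite (_ : _ @^-1` _ = \bigcap_(j in [set: 'I_d])
      ((fun w => X w 0 j * n.+1%:R) @^-1` `[(z j)%:~R, (z j + 1)%:~R[)).
      apply: fin_bigcap_measurable => // j _; rewrite -[X in measurable X]setTI.
      have mXj : measurable_fun [set: T] (fun w => X w 0 j * n.+1%:R).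
        by apply: measurable_funM => //; exact: measurable_cst.
      exact: mXj.
    apply/seteqP; split => w /=.
      move=> <- j _ /=; rewrite ffunE in_itv /= ge_floor lt_succ_floor//.
    move=> h; apply/ffunP => j; rewrite ffunE; apply: floor_def.
    by have := h j I; rewrite /= in_itv.
  by apply/funext => w; congr f; apply/rowP => j; rewrite !mxE ffunE.
move=> w _; apply: continuous_cvg; first exact: cf.
exact: round_down_cvg.
Qed.

End vector_measurability.

Section continuity.
Context (R : realType) (d : nat).
Implicit Type f : 'rV[R]_d -> R.

Lemma enorm_le_norm (x : 'rV[R]_d) : enorm x <= Num.sqrt d%:R * `|x|.
Proof.
have -> : Num.sqrt d%:R * `|x| = Num.sqrt (d%:R * `|x| ^+ 2).
  by rewrite sqrtrM ?ler0n// sqrtr_sqr normr_id.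
apply: ler_wsqrtr.
have -> : d%:R * `|x| ^+ 2 = \sum_(j < d) `|x| ^+ 2.
  by rewrite sumr_const card_ord mulr_natl.
apply: ler_sum => j _; rewrite -[x 0 j ^+ 2]real_normK ?num_real//.
by rewrite ler_pXn2r ?nnegrE// coord_le_norm.
Qed.

Lemma coord_le_enorm (x : 'rV[R]_d) j : `|x 0 j| <= enorm x.
Proof.
rewrite -sqrtr_sqr; apply: ler_wsqrtr; rewrite (bigD1 j)//= lerDl.
by apply: sumr_ge0 => i _; exact: sqr_ge0.
Qed.

Lemma lipschitz_enorm_continuous (L : R) f :
  (forall x y, `|f x - f y| <= L * enorm (x - y)) -> continuous f.
Proof.
move=> lip x; apply/(@cvgrPdist_lt _ _ _ _ (@nbhs_filter 'rV[R]_d x)) => e e0.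
(* The added 1 keeps [K] positive when [L] or [d] is 0. *)
pose K := `|L| * Num.sqrt d%:R + 1.
have K0 : 0 < K by rewrite ltr_wpDl// mulr_ge0// sqrtr_ge0.
near=> y.
have xy : `|x - y| < e / K.
  near: y; apply/(@nbhs_normP _ 'rV[R]_d); exists (e / K) => //=.
  by rewrite divr_gt0.
apply: le_lt_trans (lip x y) _.
apply: (@le_lt_trans _ _ (K * `|x - y|)); last by rewrite mulrC -ltr_pdivlMr.
have h1 := enorm_le_norm (x - y).
have h2 : 0 <= enorm (x - y) by rewrite sqrtr_ge0.
have h3 := ler_norm L.
apply: (@le_trans _ _ (`|L| * (Num.sqrt d%:R * `|x - y|))).
  by apply: le_trans (ler_wpM2r h2 h3) _; apply: ler_wpM2l.
rewrite mulrA ler_wpM2r// /K; lra.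
Unshelve. all: by end_near.
Qed.

Lemma smooth_continuous (L : R) f : smooth L f -> continuous f.
Proof. by move=> [df _] x; exact: differentiable_continuous. Qed.

Lemma vmeas_grad d0 (T : measurableType d0) (L : R) f (X : T -> 'rV[R]_d) :
  smooth L f -> vmeas X -> vmeas (fun w => grad f (X w)).
Proof.
move=> [_ lip] mX j; apply: (vmeas_continuous (f := fun x => grad f x 0 j) _ mX).
apply: (@lipschitz_enorm_continuous L) => x y; apply: le_trans (lip x y).
by have := coord_le_enorm (grad f x - grad f y) j; rewrite !mxE.
Qed.

Lemma vmeas_random_map d0 (T : measurableType d0) ds (S : measurableType ds)
    (Q : S -> 'rV[R]_d -> 'rV[R]_d) (q : T -> S) (X : T -> 'rV[R]_d) :
  random_map Q -> measurable_fun [set: T] q -> vmeas X ->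
  vmeas (fun w => Q (q w) (X w)).
Proof.
move=> mQ mq mX j.
have mt : measurable_fun [set: T] (fun w => [tuple X w 0 l | l < d]).
  apply/measurable_fun_tnthP => l.
  rewrite (_ : _ \o _ = fun w => X w 0 l)//.
  by apply/funext => w /=; rewrite tnth_mktuple.
have := measurableT_comp (mQ j) (measurable_fun_pair mq mt).
congr (measurable_fun _ _); apply/funext => w /=; congr (Q _ _ 0 j).
by apply/rowP => l; rewrite mxE tnth_mktuple.
Qed.

End continuity.

(** * Means, and averages of independent terms *)

Section mean_le.
Context d (T : measurableType d) (R : realType) (P : probability T R).
Implicit Types X Y : T -> R.

Definition rintegrable X := P.-integrable [set: T] (EFin \o X).

Lemma rintegrable_fin X : rintegrable X ->
  (\int[P]_w (X w)%:E = (\int[P]_w X w)%:E)%E.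
Proof. by move=> iX; rewrite /Rintegral fineK//; exact: integrable_fin_num. Qed.

Lemma rintegrableD X Y : rintegrable X -> rintegrable Y ->
  rintegrable (fun w => X w + Y w).
Proof. by move=> iX iY; exact: (integrableD measurableT iX iY). Qed.

Lemma rintegrableZ (a : R) X : rintegrable X -> rintegrable (fun w => a * X w).
Proof. by move=> iX; exact: (integrableZl measurableT a iX). Qed.

Lemma rintegrable_cst (a : R) : rintegrable (fun=> a).
Proof. exact: finite_measure_integrable_cst. Qed.

Lemma rintegrable_sum (I : Type) (s : seq I) (X : I -> T -> R) :
  (forall i, rintegrable (X i)) -> rintegrable (fun w => \sum_(i <- s) X i w).
Proof.
move=> iX; elim: s => [|i s IH].
  by under eq_fun do rewrite big_nil; exact: rintegrable_cst.
by under eq_fun do rewrite big_cons; exact: rintegrableD.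
Qed.

Lemma mean_cst (a : R) : \int[P]_w a = a.
Proof.
rewrite [LHS]Rintegral_cst// (_ : fine _ = 1) ?mulr1//.
by rewrite (_ : _ [set: T] = 1%E)//; exact: probability_setT.
Qed.

Lemma meanD X Y : rintegrable X -> rintegrable Y ->
  \int[P]_w (X w + Y w) = \int[P]_w X w + \int[P]_w Y w.
Proof. by move=> iX iY; exact: RintegralD. Qed.

Lemma meanZ (a : R) X : rintegrable X -> \int[P]_w (a * X w) = a * \int[P]_w X w.
Proof. by move=> iX; exact: RintegralZl. Qed.

Lemma mean_sum (I : Type) (s : seq I) (X : I -> T -> R) :
  (forall i, rintegrable (X i)) ->
  \int[P]_w (\sum_(i <- s) X i w) = \sum_(i <- s) \int[P]_w X i w.
Proof.
move=> iX; elim: s => [|i s IH].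
  by rewrite big_nil; under eq_Rintegral do rewrite big_nil; rewrite mean_cst.
rewrite big_cons -IH -meanD//; last exact: rintegrable_sum.
by apply: eq_Rintegral => w _; rewrite big_cons.
Qed.

Lemma rintegrable_dom X Y : measurable_fun [set: T] X -> rintegrable Y ->
  (forall w, `|X w| <= Y w) -> rintegrable X.
Proof.
move=> mX iY XY; apply: (le_integrable measurableT _ _ iY).
  exact/measurable_EFinP.
by move=> w _; rewrite /= lee_fin; apply: le_trans (XY w) _; exact: ler_norm.
Qed.

Lemma rintegrable_sq_dom X : measurable_fun [set: T] X ->
  rintegrable (fun w => X w ^+ 2) -> rintegrable X.
Proof.
move=> mX iX; apply: (rintegrable_dom mX (rintegrableD (rintegrable_cst 1) iX)).
move=> w; rewrite -[X w ^+ 2]real_normK ?num_real//.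
have := normr_ge0 (X w); set a := `|X w| => a0; nra.
Qed.

(** Integrability is carried along with the bound, since the integral of a non-integrable function
    could satisfy the inequality by convention alone. *)
Definition mean_le X (b : R) := rintegrable X /\ \int[P]_w X w <= b.

Lemma mean_leD X Y a b : mean_le X a -> mean_le Y b ->
  mean_le (fun w => X w + Y w) (a + b).
Proof.
move=> [iX Xa] [iY Yb]; split; first exact: rintegrableD.
by rewrite meanD// lerD.
Qed.

Lemma mean_leZ (c : R) X a : 0 <= c -> mean_le X a ->
  mean_le (fun w => c * X w) (c * a).
Proof.
move=> c0 [iX Xa]; split; first exact: rintegrableZ.
by rewrite meanZ// ler_wpM2l.
Qed.

Lemma mean_le_sum (I : Type) (s : seq I) (X : I -> T -> R) (a : I -> R) :
  (forall i, mean_le (X i) (a i)) ->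
  mean_le (fun w => \sum_(i <- s) X i w) (\sum_(i <- s) a i).
Proof.
move=> h; split; first by apply: rintegrable_sum => i; case: (h i).
rewrite mean_sum; last by move=> i; case: (h i).
by apply: ler_sum => i _; case: (h i).
Qed.

Lemma mean_leW X a b : mean_le X a -> a <= b -> mean_le X b.
Proof. by move=> [iX Xa] ab; split => //; exact: le_trans ab. Qed.

Lemma mean_le_dom X Y a : measurable_fun [set: T] X -> (forall w, 0 <= X w <= Y w) ->
  mean_le Y a -> mean_le X a.
Proof.
move=> mX XY [iY Ya].
have iX : rintegrable X.
  by apply: (rintegrable_dom mX iY) => w; have /andP[? ?] := XY w; rewrite ger0_norm.
split => //; apply: le_trans Ya; apply: le_Rintegral => // w _.
by have /andP[] := XY w.
Qed.

End mean_le.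

Section independent_mean.
Context d (T : measurableType d) (R : realType) (P : probability T R).
Context (J : eqType) (G : J -> set (set T)).
Hypothesis GI : forall j, setI_closed (G j).
Hypothesis GT : forall j, G j setT.
Hypothesis Gm : forall j, G j `<=` measurable.
Hypothesis indepG : mutually_independent P G.
Local Notation TK K := (known G K).

Lemma known_measurable K d' (U : measurableType d') (X : TK K -> U) :
  measurable_fun [set: TK K] X -> measurable_fun [set: T] (X : T -> U).
Proof. by move=> mX; exact: (measurableT_comp mX (measurable_forget Gm (K := K))). Qed.

(** Off the diagonal the mean of a product factors, so only the [n] variances remain beside the
    square of the mean. The weight [n^-2] on them is the source of every factor [1/n] in the
    rate. *)
Lemma mean_sq_indep (n : nat) (K : 'I_n -> set J) (Y : 'I_n -> T -> R) :
  (forall t u, t != u -> K t `&` K u = set0) ->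
  (forall t, measurable_fun [set: TK (K t)] (Y t : TK (K t) -> R)) ->
  (forall t, rintegrable P (fun w => Y t w ^+ 2)) ->
  rintegrable P (fun w => (n%:R^-1 * \sum_t Y t w) ^+ 2) /\
  \int[P]_w ((n%:R^-1 * \sum_t Y t w) ^+ 2) =
    (n%:R^-1 * \sum_t \int[P]_w Y t w) ^+ 2 +
    n%:R^-1 ^+ 2 * \sum_t (\int[P]_w (Y t w ^+ 2) - (\int[P]_w Y t w) ^+ 2).
Proof.
move=> K0 mY iY2.
have iY t : rintegrable P (Y t).
  by apply: rintegrable_sq_dom => //; exact: known_measurable (mY t).
have iYY t u : rintegrable P (fun w => Y t w * Y u w).
  have [<-|tu] := eqVneq t u; first by under eq_fun do rewrite -expr2; exact: iY2.
  exact: (indep_mul GI GT Gm indepG (K0 _ _ tu) (mY t) (mY u) (iY t) (iY u)).1.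
have e w : (n%:R^-1 * \sum_t Y t w) ^+ 2 =
    n%:R^-1 ^+ 2 * \sum_t \sum_u Y t w * Y u w.
  rewrite exprMn; congr (_ * _); rewrite expr2 mulr_suml.
  by apply: eq_bigr => t _; rewrite mulr_sumr.
have iS : rintegrable P (fun w => \sum_t \sum_u Y t w * Y u w).
  by apply: rintegrable_sum => t; exact: rintegrable_sum.
split; first by under eq_fun do rewrite e; exact: rintegrableZ.
under eq_Rintegral do rewrite e.
rewrite meanZ// mean_sum; last by move=> t; exact: rintegrable_sum.
rewrite exprMn -mulrDr; congr (_ * _).
rewrite [in RHS]expr2 mulr_suml -big_split; apply: eq_bigr => t _ /=.
rewrite mean_sum// mulr_sumr (bigD1 t)//= [in RHS](bigD1 t)//=.
rewrite (eq_bigr (fun u => \int[P]_w Y t w * \int[P]_w Y u w)); last first.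
  move=> u; rewrite eq_sym => tu.
  exact: (indep_mul GI GT Gm indepG (K0 _ _ tu) (mY t) (mY u) (iY t) (iY u)).2.
have -> : \int[P]_w (Y t w * Y t w) = \int[P]_w (Y t w ^+ 2) by [].
ring.
Qed.

Section sample_and_seed.
Variables (m : nat) (K1 K2 : set J).
Hypothesis K12 : K1 `&` K2 = set0.
Variable i : T -> 'I_m.
Hypothesis mi : forall a, @measurable _ (TK K1) (i @^-1` [set a]).
Hypothesis ui : forall a, P (i @^-1` [set a]) = (m%:R^-1)%:E.
Context ds (S : measurableType ds) (law : probability S R) (q : {RV P >-> S}).
Hypothesis mq : measurable_fun [set: TK K2] (q : TK K2 -> S).
Hypothesis lq : forall B, measurable B -> distribution P q B = law B.

Lemma rintegrable_law (f : S -> R) : measurable_fun [set: S] f ->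
  rintegrable law f -> rintegrable P (f \o q) /\ \int[P]_w f (q w) = \int[law]_s f s.
Proof.
move=> mf ilf.
have mfE : measurable_fun [set: S] (EFin \o f) by exact/measurable_EFinP.
have iq : rintegrable P (f \o q).
  apply/integrableP; split.
    by apply/measurable_EFinP; exact: measurableT_comp.
  have := integrableP _ _ _ ilf => -[_].
  rewrite (eq_measure_integral (distribution P q)); last by move=> *; rewrite /= lq.
  rewrite ge0_integral_distribution//.
  by apply: measurableT_comp => //; exact: abse_measurable.
split => //; rewrite /Rintegral; congr fine.
rewrite [RHS](eq_measure_integral (distribution P q)); last by move=> *; rewrite /= lq.
by rewrite integral_distribution.
Qed.

(** Splitting along the value of the sample index writes the integrand as a sum of products of an
    indicator and a function of the seed, which are independent. *)
Lemma mean_sample_seed (phi : 'I_m -> S -> R) :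
  (forall a, measurable_fun [set: S] (phi a)) ->
  (forall a, rintegrable law (phi a)) ->
  rintegrable P (fun w => phi (i w) (q w)) /\
  \int[P]_w (phi (i w) (q w)) = m%:R^-1 * \sum_a \int[law]_s (phi a s).
Proof.
move=> mphi iphi.
have e w : phi (i w) (q w) = \sum_a (i w == a)%:R * phi a (q w).
  rewrite (bigD1 (i w))//= eqxx mul1r big1 ?addr0// => a.
  by rewrite eq_sym => /negbTE ->; rewrite mul0r.
have mind a : measurable_fun [set: TK K1] (fun w : TK K1 => (i w == a)%:R : R).
  exact: (measurable_fun_countable (Z := i : TK K1 -> 'I_m) (fun b => (b == a)%:R)).
have indE a : (fun w => (i w == a)%:R) = \1_(i @^-1` [set a]) :> (T -> R).
  apply/funext => w; rewrite indicE; congr (_%:R); congr nat_of_bool.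
  by apply/eqP/idP; rewrite inE.
have mia a : measurable (i @^-1` [set a]) by exact: (sigma_gen_measurable Gm (mi a)).
have iind a : rintegrable P (fun w => (i w == a)%:R).
  apply: (rintegrable_dom _ (rintegrable_cst P 1)).
    exact: known_measurable (mind a).
  by move=> w; case: (i w == a); rewrite ?normr1 ?normr0.
have eind a : \int[P]_w ((i w == a)%:R : R) = m%:R^-1.
  transitivity (fine (P (i @^-1` [set a]))); last by rewrite ui.
  by rewrite indE /Rintegral integral_indic// setIT.
have iphiq a : rintegrable P (fun w => phi a (q w)).
  by case: (rintegrable_law (mphi a) (iphi a)).
have mphiq a : measurable_fun [set: TK K2] (fun w : TK K2 => phi a (q w)).
  exact: (measurableT_comp (mphi a) mq).
have h a := indep_mul GI GT Gm indepG K12 (mind a) (mphiq a) (iind a) (iphiq a).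
have ih a : rintegrable P (fun w => (i w == a)%:R * phi a (q w)) by case: (h a).
split; first by under eq_fun do rewrite e; exact: rintegrable_sum.
under eq_Rintegral do rewrite e.
rewrite mean_sum// mulr_sumr; apply: eq_bigr => a _.
by rewrite (h a).2 eind; case: (rintegrable_law (mphi a) (iphi a)) => _ ->.
Qed.

End sample_and_seed.

End independent_mean.

Definition vmean (R : realType) (d n : nat) (v : 'I_n -> 'rV[R]_d) : 'rV[R]_d :=
  n%:R^-1 *: \sum_t v t.

Lemma sub_known d0 (T : measurableType d0) (J : eqType) (G : J -> set (set T)) (K1 K2 : set J) A :
  K1 `<=` K2 -> <<s gen G K1 >> A -> <<s gen G K2 >> A.
Proof.
move=> K12; apply: sub_smallest2r; first exact: smallest_sigma_algebra.
by move=> B [j K1j GB]; exists j => //; exact: K12.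
Qed.

Section one_compression.
Context (R : realType) (d : nat) (delta : R) ds (S : measurableType ds)
  (law : probability S R) (Q : S -> 'rV[R]_d -> 'rV[R]_d).
Hypothesis mQ : random_map Q.
Hypothesis cQ : forall x : 'rV[R]_d,
  ('E_law[fun s => (enorm (x - Q s x) ^+ 2)%R] <= ((1 - delta) * enorm x ^+ 2)%:E)%E.
Hypothesis sQ : mean_scaling law Q delta.

Lemma vmeas_residual (x : 'rV[R]_d) : vmeas (fun s => x - Q s x).
Proof.
apply: vmeasB; first exact: vmeas_cst.
by apply: (vmeas_random_map mQ) => //; exact: vmeas_cst.
Qed.

Lemma mean_residual_sq (x : 'rV[R]_d) :
  mean_le law (fun s => dot (x - Q s x) (x - Q s x)) ((1 - delta) * dot x x).
Proof.
have := cQ x; rewrite unlock enorm_sq => h.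
have m2 : measurable_fun setT (fun s => dot (x - Q s x) (x - Q s x)).
  by apply: vmeas_dot; exact: vmeas_residual.
have {}h : (\int[law]_s (dot (x - Q s x) (x - Q s x))%:E <= ((1 - delta) * dot x x)%:E)%E.
  by apply: le_trans h; under [leRHS]eq_integral do rewrite enorm_sq.
(* The compressor inequality is between extended reals, so its finite right-hand side gives square
   integrability of the residual. *)
have i2 : rintegrable law (fun s => dot (x - Q s x) (x - Q s x)).
  apply/integrableP; split; first exact/measurable_EFinP.
  under eq_integral do rewrite /= ger0_norm ?dot_ge0//.
  by apply: le_lt_trans h _; rewrite ltry.
by split => //; rewrite -lee_fin -rintegrable_fin.
Qed.

Lemma rintegrable_residual_sq (x : 'rV[R]_d) j :
  rintegrable law (fun s => (x - Q s x) 0 j ^+ 2).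
Proof.
apply: rintegrable_dom (mean_residual_sq x).1 _.
  by apply: measurable_funX; exact: vmeas_residual.
move=> s; rewrite ger0_norm ?sqr_ge0// /dot (bigD1 j)//= -expr2 lerDl.
by apply: sumr_ge0 => i _; rewrite -expr2 sqr_ge0.
Qed.

Lemma mean_residual (x : 'rV[R]_d) j :
  rintegrable law (fun s => (x - Q s x) 0 j) /\
  \int[law]_s (x - Q s x) 0 j = (1 - delta) * x 0 j.
Proof.
have i1 : rintegrable law (fun s => (x - Q s x) 0 j).
  apply: rintegrable_sq_dom; first exact: vmeas_residual.
  exact: rintegrable_residual_sq.
split => //.
have iQ : rintegrable law (fun s => Q s x 0 j).
  have := rintegrableD (rintegrable_cst law (x 0 j)) (rintegrableZ (-1) i1).
  by congr (rintegrable _ _); apply/funext => s; rewrite !mxE; ring.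
have := sQ x j; rewrite unlock rintegrable_fin// => -[eQ].
transitivity (\int[law]_s (x 0 j + (-1) * Q s x 0 j)).
  by apply: eq_Rintegral => s _; rewrite !mxE mulN1r.
rewrite meanD ?meanZ ?mean_cst ?eQ//; [|exact: rintegrable_cst|exact: rintegrableZ].
by rewrite mulN1r mulrBl mul1r.
Qed.

End one_compression.

Section compressed_average.
Context d0 (T : measurableType d0) (R : realType) (P : probability T R).
Context (J : eqType) (G : J -> set (set T)).
Hypothesis GI : forall j, setI_closed (G j).
Hypothesis GT : forall j, G j setT.
Hypothesis Gm : forall j, G j `<=` measurable.
Hypothesis indepG : mutually_independent P G.
Local Notation TK K := (known G K).
Variables (n m d : nat) (Ki Kq : 'I_n -> set J).
Hypothesis Kiq : forall t, Ki t `&` Kq t = set0.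
Hypothesis Kdis : forall t u, t != u -> (Ki t `|` Kq t) `&` (Ki u `|` Kq u) = set0.
Variable i : 'I_n -> T -> 'I_m.
Hypothesis mi : forall t a, @measurable _ (TK (Ki t)) (i t @^-1` [set a]).
Hypothesis ui : forall t a, P (i t @^-1` [set a]) = (m%:R^-1)%:E.
Context (delta : R) ds (S : measurableType ds) (law : probability S R)
  (q : 'I_n -> {RV P >-> S}).
Hypothesis mq : forall t, measurable_fun [set: TK (Kq t)] (q t : TK (Kq t) -> S).
Hypothesis lq : forall t B, measurable B -> distribution P (q t) B = law B.
Variable Q : S -> 'rV[R]_d -> 'rV[R]_d.
Hypothesis mQ : random_map Q.
Hypothesis cQ : forall x : 'rV[R]_d,
  ('E_law[fun s => (enorm (x - Q s x) ^+ 2)%R] <= ((1 - delta) * enorm x ^+ 2)%:E)%E.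
Hypothesis sQ : mean_scaling law Q delta.
Variable u : 'I_n -> 'I_m -> 'rV[R]_d.

Let Y t w := u t (i t w) - Q (q t w) (u t (i t w)).

Let vY t : @vmeas _ (TK (Ki t `|` Kq t)) _ _ (Y t).
Proof.
apply: (@vmeas_finite_index _ (TK (Ki t `|` Kq t)) _ _ _ (i t)
  (fun a w => u t a - Q (q t w) (u t a))).
  by move=> a; apply: sub_known (@mi t a) => j; left.
move=> a; apply: vmeasB; first exact: vmeas_cst.
apply: (vmeas_random_map mQ); last exact: vmeas_cst.
move=> mT B mB; apply: (@sub_known _ _ _ _ (Kq t)) => [j|]; first by right.
exact: (@mq t measurableT B mB).
Qed.

Lemma mean_compressed_sq t :
  mean_le P (fun w => dot (Y t w) (Y t w))
    ((1 - delta) * (m%:R^-1 * \sum_a dot (u t a) (u t a))).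
Proof.
have [iY eY] := mean_sample_seed GI GT Gm indepG (Kiq t) (@mi t) (@ui t) (@mq t) (@lq t)
  (fun a => vmeas_dot (vmeas_residual mQ (u t a)) (vmeas_residual mQ (u t a)))
  (fun a => (mean_residual_sq mQ cQ (u t a)).1).
split => //; rewrite eY mulrCA ler_wpM2l ?invr_ge0// mulr_sumr.
by apply: ler_sum => a _; exact: (mean_residual_sq mQ cQ (u t a)).2.
Qed.

(** Coordinate by coordinate this is mean plus variance for the independent workers. The mean of
    each residual is [(1 - delta) *: vmean (u t)], which produces the squared factor
    [(1 - delta) ^+ 2]. The subtracted square is kept: for [delta = 0] the bracket is then the plain
    sampling variance, and in general the part coming from [vmean (u t)] is only
    [delta * (1 - delta)] times its square. *)
Lemma mean_compressed_average :
  mean_le P (fun w => dot (vmean (Y ^~ w)) (vmean (Y ^~ w)))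
    ((1 - delta) ^+ 2 * dot (vmean (fun t => vmean (u t))) (vmean (fun t => vmean (u t)))
     + n%:R^-1 ^+ 2 * \sum_t ((1 - delta) * (m%:R^-1 * \sum_a dot (u t a) (u t a))
          - (1 - delta) ^+ 2 * dot (vmean (u t)) (vmean (u t)))).
Proof.
have iY2 t j : rintegrable P (fun w => Y t w 0 j ^+ 2).
  have := mean_sample_seed GI GT Gm indepG (Kiq t) (@mi t) (@ui t) (@mq t) (@lq t)
    (fun a => measurable_funX 2 (vmeas_residual mQ (u t a) j))
    (fun a => rintegrable_residual_sq mQ cQ (u t a) j).
  by case.
have eY t j : \int[P]_w Y t w 0 j = (1 - delta) * vmean (u t) 0 j.
  have [_ ->] := mean_sample_seed GI GT Gm indepG (Kiq t) (@mi t) (@ui t) (@mq t) (@lq t)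
    (fun a => vmeas_residual mQ (u t a) j)
    (fun a => (mean_residual mQ cQ sQ (u t a) j).1).
  under eq_bigr do rewrite (mean_residual mQ cQ sQ _ j).2.
  by rewrite -mulr_sumr mulrCA /vmean mxE summxE.
have h j := mean_sq_indep GI GT Gm indepG (Y := fun t w => Y t w 0 j) Kdis
  (fun t => @vY t j) (fun t => iY2 t j).
have e w : dot (vmean (Y ^~ w)) (vmean (Y ^~ w)) = \sum_j (n%:R^-1 * \sum_t Y t w 0 j) ^+ 2.
  by apply: eq_bigr => j _; rewrite mxE summxE expr2.
split; first by under eq_fun do rewrite e; apply: rintegrable_sum => j; exact: (h j).1.
under eq_Rintegral do rewrite e.
rewrite mean_sum; last by move=> j; exact: (h j).1.
under eq_bigr do rewrite (h _).2.
rewrite big_split /=; apply: lerD.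
  rewrite /dot mulr_sumr; apply: ler_sum => j _.
  under eq_bigr do rewrite eY.
  rewrite -mulr_sumr mulrCA exprMn.
  suff -> : (n%:R^-1 * \sum_t vmean (u t) 0 j) = vmean (fun t => vmean (u t)) 0 j.
    by rewrite -expr2.
  by rewrite /vmean mxE summxE.
rewrite -mulr_sumr ler_wpM2l ?sqr_ge0// exchange_big; apply: ler_sum => t _ /=.
rewrite sumrB; apply: lerB.
  rewrite -mean_sum//; apply: le_trans (mean_compressed_sq t).2.
  by under eq_Rintegral do under eq_bigr do rewrite expr2.
rewrite /dot mulr_sumr; apply: ler_sum => j _.
by rewrite eY exprMn -expr2.
Qed.

End compressed_average.

(** * The run as a measurable process *)

Section run.
Context (R : realType) (E : ec_lsvrg R).
Hypothesis HE : assumptions E.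
Local Notation V := 'rV[R]_(dim E).
Local Notation TK K := (known (@draw_events R E) K).

Lemma setI_closed_draw_events j : setI_closed (@draw_events R E j).
Proof.
have aux (U : Type) (f : Omega E -> U) (F : set (set U)) :
    setI_closed F -> setI_closed (preimage_set_system setT f F).
  move=> FI _ _ [A FA <-] [B FB <-]; exists (A `&` B); first exact: FI.
  by rewrite !setTI preimage_setI.
case: j => [[[[k t]|[k t]]|[k t]]|k]; apply: aux => //; exact: measurableI.
Qed.

Lemma draw_eventsT j : @draw_events R E j setT.
Proof. by case: j => [[[[k t]|[k t]]|[k t]]|k]; exists setT; rewrite ?setTI. Qed.

Lemma draw_events_measurable j : @draw_events R E j `<=` measurable.
Proof.
case: j => [[[[k t]|[k t]]|[k t]]|k] _ [B mB <-]; rewrite setTI.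
- rewrite (_ : _ @^-1` B = \bigcup_(a in B) draw_i E k t @^-1` [set a]).
    apply: fin_bigcup_measurable => // a _.
    exact: (draw_i_uniform (draws_assumption HE) k t a).1.
  apply/seteqP; split => [w Bw|w [a Ba /= ->//]].
  by exists (draw_i E k t w).
- by rewrite -[X in measurable X]setTI; exact: measurable_funP.
- by rewrite -[X in measurable X]setTI; exact: measurable_funP.
- by rewrite -[X in measurable X]setTI; exact: measurable_funP.
Qed.

(** The draws are read through a map [D] from an arbitrary space, because the same measurability
    argument is run on [Omega], on the coarser spaces [known K], and on products of two such spaces,
    where past and present draws come from different coordinates. *)
Record draws_measurable d0 (T : measurableType d0) (D : T -> Omega E) (k : nat) : Prop :=
  DrawsMeasurable {
    measurable_draw_i : forall t a, measurable ((draw_i E k t \o D) @^-1` [set a]);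
    measurable_draw_Q : forall t, measurable_fun setT (draw_Q E k t \o D);
    measurable_draw_Q1 : forall t, measurable_fun setT (draw_Q1 E k t \o D);
    measurable_draw_w : measurable_fun setT (draw_w E k \o D) }.

Definition draw_step (j : draw_index E) : nat :=
  match j with
  | inl (inl (inl (k, _))) => k
  | inl (inl (inr (k, _))) => k
  | inl (inr (k, _)) => k
  | inr k => k
  end.

Lemma known_draw_i K k t a : K (inl (inl (inl (k, t)))) ->
  @measurable _ (TK K) (draw_i E k t @^-1` [set a]).
Proof.
move=> Kj; apply: sub_sigma_algebra; exists (inl (inl (inl (k, t)))) => //=.
by exists [set a]; rewrite ?setTI.
Qed.

Lemma known_draw_Q K k t : K (inl (inl (inr (k, t)))) ->
  measurable_fun [set: TK K] (draw_Q E k t : TK K -> seedQ E).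
Proof.
move=> Kj _ B mB; apply: sub_sigma_algebra; exists (inl (inl (inr (k, t)))) => //=.
by exists B.
Qed.

Lemma known_draw_Q1 K k t : K (inl (inr (k, t))) ->
  measurable_fun [set: TK K] (draw_Q1 E k t : TK K -> seedQ1 E).
Proof.
move=> Kj _ B mB; apply: sub_sigma_algebra; exists (inl (inr (k, t))) => //=.
by exists B.
Qed.

Lemma known_draw_w K k : K (inr k) ->
  measurable_fun [set: TK K] (draw_w E k : TK K -> bool).
Proof.
move=> Kj _ B mB; apply: sub_sigma_algebra; exists (inr k) => //=.
by exists B.
Qed.

Lemma draws_measurable_id k : @draws_measurable _ (Omega E) id k.
Proof.
split => [t a|t|t|]; [|exact: measurable_funP..].
exact: (draw_i_uniform (draws_assumption HE) k t a).1.
Qed.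

Lemma draws_measurable_known K k : [set j | draw_step j = k] `<=` K ->
  @draws_measurable _ (TK K) id k.
Proof.
move=> hK; split => [t a|t|t|].
- by apply: known_draw_i; exact: hK.
- by apply: known_draw_Q; exact: hK.
- by apply: known_draw_Q1; exact: hK.
- by apply: known_draw_w; exact: hK.
Qed.

Lemma draws_measurable_comp d0 (T : measurableType d0) d1 (U : measurableType d1)
    (D : T -> Omega E) (f : U -> T) k :
  measurable_fun setT f -> draws_measurable D k -> draws_measurable (D \o f) k.
Proof.
move=> mf [h1 h2 h3 h4]; split => [t a|t|t|].
- by have := mf measurableT _ (h1 t a); rewrite setTI.
- exact: measurableT_comp (h2 t) mf.
- exact: measurableT_comp (h3 t) mf.
- exact: measurableT_comp h4 mf.
Qed.

Record state_measurable d0 (T : measurableType d0) (r : T -> state E) : Prop :=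
  StateMeasurable {
    vmeas_x : vmeas (fun w => st_x (r w));
    vmeas_w : vmeas (fun w => st_w (r w));
    vmeas_e : forall t, vmeas (fun w => st_e (r w) t);
    vmeas_ht : forall t, vmeas (fun w => st_ht (r w) t);
    vmeas_h : vmeas (fun w => st_h (r w)) }.

Definition residual (s : state E) (t : 'I_(n E)) : V :=
  grad (fw t) (st_w s) - st_ht s t.

Definition gradient_estimate (s : state E) (t : 'I_(n E)) (a : 'I_(m E)) : V :=
  grad (fi E t a) (st_x s) - grad (fi E t a) (st_w s) + grad (fw t) (st_w s)
  - st_ht s t.

Definition compressor_input (s : state E) t a : V :=
  eta E *: gradient_estimate s t a + st_e s t.

Section step_components.
Variables (k : nat) (om : Omega E) (s : state E).
Let u t := compressor_input s t (draw_i E k t om).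

Lemma step_x : st_x (step k om s) =
  st_x s - (vmean (fun t => Q E (draw_Q E k t om) (u t)) + eta E *: st_h s).
Proof. by rewrite /u; case: s. Qed.

Lemma step_w : st_w (step k om s) = if draw_w E k om then st_x s else st_w s.
Proof. by case: s. Qed.

Lemma step_e t : st_e (step k om s) t = u t - Q E (draw_Q E k t om) (u t).
Proof. by rewrite /u /compressor_input; case: s => x w e ht h /=; congr (_ - _); exact: addrC. Qed.

Lemma step_ht t : st_ht (step k om s) t =
  st_ht s t + Q1 E (draw_Q1 E k t om) (residual s t).
Proof. by case: s. Qed.

Lemma step_h : st_h (step k om s) =
  st_h s + vmean (fun t => Q1 E (draw_Q1 E k t om) (residual s t)).
Proof. by case: s. Qed.

End step_components.

Section measurable_state.
Context d0 (T : measurableType d0).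

Lemma vmeas_mean (X : 'I_(n E) -> T -> V) :
  (forall t, vmeas (X t)) -> vmeas (fun w => vmean (X ^~ w)).
Proof. by move=> mX; apply: vmeasZ; exact: vmeas_sum. Qed.

Lemma state_measurable_step (r : T -> state E) (D : T -> Omega E) k :
  state_measurable r -> draws_measurable D k ->
  state_measurable (fun w => step k (D w) (r w)).
Proof.
move=> [mx mw me mht mh] [di dQ dQ1 dw].
have mres t : vmeas (fun w => residual (r w) t).
  by apply: vmeasB => //; exact: vmeas_grad (fw_smooth HE t) mw.
have mu t : vmeas (fun w => compressor_input (r w) t (draw_i E k t (D w))).
  apply: (vmeas_finite_index (i := draw_i E k t \o D)
    (X := fun a w => compressor_input (r w) t a)) => // a.
  apply: vmeasD => //; apply: vmeasZ; apply: vmeasB => //; apply: vmeasD.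
    by apply: vmeasB; exact: vmeas_grad (fi_smooth HE t a) _.
  exact: vmeas_grad (fw_smooth HE t) mw.
have [_ mQ _] := Q_compressor HE; have [_ mQ1 _] := Q1_compressor HE.
split.
- under eq_fun do rewrite step_x.
  apply: vmeasB => //; apply: vmeasD; last exact: vmeasZ.
  by apply: vmeas_mean => t; exact: (vmeas_random_map mQ (dQ t) (mu t)).
- by under eq_fun do rewrite step_w; exact: vmeas_if.
- move=> t; under eq_fun do rewrite step_e.
  by apply: vmeasB => //; exact: (vmeas_random_map mQ (dQ t) (mu t)).
- move=> t; under eq_fun do rewrite step_ht.
  by apply: vmeasD => //; exact: (vmeas_random_map mQ1 (dQ1 t) (mres t)).
- under eq_fun do rewrite step_h.
  apply: vmeasD => //; apply: vmeas_mean => t.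
  exact: (vmeas_random_map mQ1 (dQ1 t) (mres t)).
Qed.

Lemma state_measurable_run (D : T -> Omega E) k :
  (forall i, (i < k)%N -> draws_measurable D i) ->
  state_measurable (fun w => run k (D w)).
Proof.
elim: k => [_|k IH hD].
  by split => *; exact: vmeas_cst.
apply: (@state_measurable_step (fun w => run k (D w))); last exact: hD.
by apply: IH => i ik; apply: hD; exact: ltnW.
Qed.

End measurable_state.

(** The state after [k] steps depends only on draws of index below [k], and step [k] only on those
    of index [k]; these groups are disjoint, so [decouple] applies. Measurability of [Psi] is asked
    over every space because it is used on the product of the two observed spaces. *)
Lemma run_mean_rec (Psi : state E -> R) k : (forall s, 0 <= Psi s) ->
  (forall d0 (T : measurableType d0) (r : T -> state E), state_measurable r ->
     measurable_fun setT (fun w => Psi (r w))) ->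
  (\int[P E]_w (Psi (run k.+1 w))%:E =
   \int[P E]_w \int[P E]_w' (Psi (step k w' (run k w)))%:E)%E.
Proof.
move=> Psi0 mPsi.
pose K1 := [set j : draw_index E | (draw_step j < k)%N].
pose K2 := [set j : draw_index E | draw_step j = k].
have K12 : K1 `&` K2 = set0.
  apply/seteqP; split => // j [h jk]; have {}h : (draw_step j < k)%N := h.
  by have {}jk : draw_step j = k := jk; rewrite jk ltnn in h.
have := @decouple _ _ _ (P E) _ _ setI_closed_draw_events draw_eventsT
  draw_events_measurable (draws_independent (draws_assumption HE)) _ _ K12
  (fun z => (Psi (step k z.2 (run k z.1)))%:E).
apply; last by move=> z; rewrite lee_fin.
apply/measurable_EFinP; apply: mPsi.
apply: (@state_measurable_step _ (TK K1 * TK K2)%type (fun z => run k z.1) snd).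
  apply: state_measurable_run => i ik.
  apply: (draws_measurable_comp (D := id : TK K1 -> Omega E)); first exact: measurable_fst.
  apply: draws_measurable_known => j ji; have {}ji : draw_step j = i := ji.
  by rewrite /K1 /mkset ji.
apply: (draws_measurable_comp (D := id : TK K2 -> Omega E)); first exact: measurable_snd.
exact: draws_measurable_known.
Qed.

Lemma measurable_step_mean (Psi : state E -> R) k : (forall s, 0 <= Psi s) ->
  (forall d0 (T : measurableType d0) (r : T -> state E), state_measurable r ->
     measurable_fun setT (fun w => Psi (r w))) ->
  measurable_fun setT
    (fun w : Omega E => \int[P E]_w' (Psi (step k w' (run k w)))%:E)%E.
Proof.
move=> Psi0 mPsi.
apply: (@measurable_fun_fubini_tonelli_F _ _ _ _ _ (P E)
  (fun z : Omega E * Omega E => (Psi (step k z.2 (run k z.1)))%:E)).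
  apply/measurable_EFinP; apply: mPsi.
  apply: (@state_measurable_step _ (Omega E * Omega E)%type (fun z => run k z.1) snd).
    apply: state_measurable_run => i _.
    exact: (draws_measurable_comp measurable_fst (draws_measurable_id i)).
  exact: (draws_measurable_comp measurable_snd (draws_measurable_id k)).
by move=> z; rewrite lee_fin.
Qed.

(** This invariant makes the shifts [h_tau] cancel on average, so that the mean of the [g_tau] plus
    [h] is an unbiased estimate of the gradient of [fobj]. *)
Lemma run_h k (om : Omega E) : st_h (run k om) = vmean (st_ht (run k om)).
Proof.
elim: k => [//|k IH]; rewrite [run _ _]/= step_h IH -scalerDr -big_split.
by congr (_ *: _); apply: eq_bigr => t _; rewrite step_ht.
Qed.

End run.

(** * Averages of vectors, variance and averaged cocoercivity *)

Section vector_means.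
Context (R : realType) (d : nat).
Implicit Types (a b c x y : 'rV[R]_d).

Lemma dot_sub_le a b c :
  dot (a - b) (a - b) <= 2 * dot (a - c) (a - c) + 2 * dot (b - c) (b - c).
Proof.
have := dot_ge0 ((a - c) + (b - c)).
rewrite (_ : a - b = (a - c) - (b - c)); last by rewrite opprB addrA subrK.
move: (a - c) (b - c) => u v; rewrite !dotE (dotC v u); lra.
Qed.

Lemma dot_add_le a b : dot (a + b) (a + b) <= 2 * dot a a + 2 * dot b b.
Proof. by have := dot_ge0 (a - b); rewrite !dotE (dotC b a); lra. Qed.

Lemma dot_vmean n (v : 'I_n -> 'rV[R]_d) x :
  dot (vmean v) x = n%:R^-1 * \sum_t dot (v t) x.
Proof. by rewrite dotZl dot_suml. Qed.

Lemma vmeanD n (v w : 'I_n -> 'rV[R]_d) :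
  vmean (fun t => v t + w t) = vmean v + vmean w.
Proof. by rewrite /vmean big_split scalerDr. Qed.

Lemma vmeanZ n (v : 'I_n -> 'rV[R]_d) (k : R) :
  vmean (fun t => k *: v t) = k *: vmean v.
Proof. by rewrite /vmean -scaler_sumr !scalerA mulrC. Qed.

Lemma vmeanN n (v : 'I_n -> 'rV[R]_d) : vmean (fun t => - v t) = - vmean v.
Proof. by rewrite /vmean sumrN scalerN. Qed.

Lemma vmeanB n (v w : 'I_n -> 'rV[R]_d) :
  vmean (fun t => v t - w t) = vmean v - vmean w.
Proof. by rewrite vmeanD vmeanN. Qed.

Lemma eq_vmean n (v w : 'I_n -> 'rV[R]_d) : v =1 w -> vmean v = vmean w.
Proof. by move=> vw; rewrite /vmean; under eq_bigr do rewrite vw. Qed.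

Lemma mean_const n (k : R) : (0 < n)%N -> n%:R^-1 * \sum_(t < n) k = k.
Proof.
move=> n0; rewrite sumr_const card_ord -[k *+ n]mulr_natl mulKf// pnatr_eq0.
by rewrite -lt0n.
Qed.

Lemma vmean_cst n x : (0 < n)%N -> vmean (fun _ : 'I_n => x) = x.
Proof.
move=> n0; rewrite /vmean sumr_const card_ord -[x *+ n]scaler_nat scalerA mulVf ?scale1r//.
by rewrite pnatr_eq0 -lt0n.
Qed.

Lemma mean_sq_shift m (g : 'I_m -> 'rV[R]_d) c : (0 < m)%N ->
  m%:R^-1 * \sum_a dot (g a - c) (g a - c) =
  m%:R^-1 * \sum_a dot (g a) (g a) - 2 * dot (vmean g) c + dot c c.
Proof.
move=> m0.
rewrite (eq_bigr (fun a : 'I_m => dot (g a) (g a) + (-2) * dot (g a) c + dot c c)); last first.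
  by move=> a _; rewrite !dotE (dotC c (g a)); ring.
rewrite !big_split /= !mulrDr (mean_const _ m0) -mulr_sumr dot_vmean; ring.
Qed.

(** The variance is at most the mean square distance to any point; leaving [c] free allows a centre
    for which that distance is explicit. *)
Lemma variance_le m (g : 'I_m -> 'rV[R]_d) c : (0 < m)%N ->
  m%:R^-1 * \sum_a dot (g a) (g a)
    <= dot (vmean g) (vmean g) + m%:R^-1 * \sum_a dot (g a - c) (g a - c).
Proof.
move=> m0; rewrite mean_sq_shift//.
have := dot_ge0 (vmean g - c); rewrite !dotE (dotC c); lra.
Qed.

Lemma dot_vmean_le n (v : 'I_n -> 'rV[R]_d) : (0 < n)%N ->
  dot (vmean v) (vmean v) <= n%:R^-1 * \sum_t dot (v t) (v t).
Proof.
move=> n0.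
have : 0 <= n%:R^-1 * \sum_t dot (v t - vmean v) (v t - vmean v).
  by rewrite mulr_ge0 ?invr_ge0//; apply: sumr_ge0 => t _; exact: dot_ge0.
rewrite mean_sq_shift//; lra.
Qed.

Lemma mean_cocoercive n (L : R) (f : 'I_n -> 'rV[R]_d -> R) x y :
  0 <= L -> (forall t, smooth L (f t)) -> (forall t, gradient_convex (f t)) ->
  n%:R^-1 * \sum_t dot (grad (f t) x - grad (f t) y) (grad (f t) x - grad (f t) y)
  <= 2 * L * (n%:R^-1 * \sum_t f t x - n%:R^-1 * \sum_t f t y
        - dot (vmean (fun t => grad (f t) y)) (x - y)).
Proof.
move=> L0 sf cf; rewrite dot_vmean -!mulrBr -!sumrB mulrCA ler_wpM2l ?invr_ge0//.
rewrite mulr_sumr; apply: ler_sum => t _; exact: smooth_cocoercive.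
Qed.

(** In dimension 0 all distances vanish and a negative constant is admissible, whence the condition
    on [d]. *)
Lemma smooth_ge0 (L : R) (f : 'rV[R]_d -> R) : (0 < d)%N -> smooth L f -> 0 <= L.
Proof.
move=> d0 [_ lip]; pose x : 'rV[R]_d := const_mx 1.
have := lip x 0; rewrite subr0 => h.
have x0 : 0 < enorm x.
  rewrite sqrtr_gt0 (bigD1 (Ordinal d0))//= mxE expr1n ltr_wpDr//.
  by apply: sumr_ge0 => j _; exact: sqr_ge0.
have := le_trans (sqrtr_ge0 _) h.
by rewrite pmulr_lge0.
Qed.

End vector_means.

(** * One step of the method *)

Section problem.
Context (R : realType) (E : ec_lsvrg R).
Hypothesis HE : assumptions E.
Hypothesis L0 : 0 <= L E.
Hypothesis Lbar0 : 0 <= Lbar E.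
Local Notation V := 'rV[R]_(dim E).
Local Notation xs := (xstar E).
Implicit Types (x w : V) (t : 'I_(n E)).

Definition gap x : R := fobj x - fobj xs.

Lemma gap_ge0 x : 0 <= gap x.
Proof. by rewrite subr_ge0; exact: xstar_optimal. Qed.

Lemma grad_fw t x : grad (fw t) x = vmean (fun a => grad (fi E t a) x).
Proof. by rewrite grad_mean// => a z; case: (fi_smooth HE t a). Qed.

Lemma grad_fobj x : grad (@fobj _ E) x = vmean (fun t => grad (fw t) x).
Proof. by rewrite grad_mean// => t z; case: (fw_smooth HE t). Qed.

Lemma fi_gradient_convex t a : gradient_convex (fi E t a).
Proof. by apply: convex_gradient_convex; [exact: fi_convex|case: (fi_smooth HE t a)]. Qed.

Lemma fw_gradient_convex t : gradient_convex (@fw _ E t).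
Proof.
apply: gradient_convex_mean => a; first by case: (fi_smooth HE t a).
exact: fi_gradient_convex.
Qed.

Lemma fobj_gradient_convex : gradient_convex (@fobj _ E).
Proof.
apply: gradient_convex_mean => t; first by case: (fw_smooth HE t).
exact: fw_gradient_convex.
Qed.

Lemma grad_sq_le x : dot (grad (@fobj _ E) x) (grad (@fobj _ E) x) <= 2 * Lf E * gap x.
Proof. exact: smooth_grad_le (Lf_gt0 HE) (fobj_smooth HE) (xstar_optimal HE). Qed.

Lemma grad_xstar : grad (@fobj _ E) xs = 0.
Proof. by apply: dot_eq0; apply: le_trans (grad_sq_le xs) _; rewrite /gap subrr mulr0. Qed.

(** The workers' gradients at the minimiser need not vanish individually. Only their average does,
    and this is what removes the linear term from the averaged cocoercivity bounds. *)
Lemma dot_vmean_grad_xstar x : dot (vmean (fun t => grad (fw t) xs)) x = 0.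
Proof. by rewrite -grad_fobj grad_xstar dot0l. Qed.

Lemma fw_cocoercive x :
  (n E)%:R^-1 * \sum_t dot (grad (fw t) x - grad (fw t) xs) (grad (fw t) x - grad (fw t) xs)
  <= 2 * Lbar E * gap x.
Proof.
apply: le_trans (mean_cocoercive _ _ Lbar0 (fw_smooth HE) fw_gradient_convex) _.
by rewrite dot_vmean_grad_xstar subr0.
Qed.

Lemma fi_cocoercive x :
  (n E)%:R^-1 * \sum_t ((m E)%:R^-1 * \sum_a
     dot (grad (fi E t a) x - grad (fi E t a) xs) (grad (fi E t a) x - grad (fi E t a) xs))
  <= 2 * L E * gap x.
Proof.
apply: (@le_trans _ _ ((n E)%:R^-1 * \sum_t (2 * L E *
   (fw t x - fw t xs - dot (grad (fw t) xs) (x - xs))))).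
  rewrite ler_wpM2l ?invr_ge0//; apply: ler_sum => t _.
  apply: le_trans (mean_cocoercive _ _ L0 (fi_smooth HE t) (fi_gradient_convex t)) _.
  by rewrite -grad_fw.
rewrite -mulr_sumr mulrCA !sumrB -dot_suml !mulrBr -dotZl.
by have := dot_vmean_grad_xstar (x - xs); rewrite /vmean => ->; rewrite mulr0 subr0.
Qed.

Lemma fobj_gap_diff x w :
  dot (grad (@fobj _ E) x - grad (@fobj _ E) w) (grad (@fobj _ E) x - grad (@fobj _ E) w)
  <= 4 * Lf E * (gap x + gap w).
Proof.
have := dot_sub_le (grad (@fobj _ E) x) (grad (@fobj _ E) w) 0.
rewrite !subr0; have := grad_sq_le x; have := grad_sq_le w; lra.
Qed.

(** Both gradients are compared with those at the minimiser, where cocoercivity bounds them by the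
    gap. Against the variance weight [n^-2], the sum over workers leaves [Lbar / n]. *)
Lemma fw_gap_diff x w :
  (n E)%:R^-1 ^+ 2 * \sum_t dot (grad (fw t) x - grad (fw t) w) (grad (fw t) x - grad (fw t) w)
  <= 4 * (Lbar E / (n E)%:R) * (gap x + gap w).
Proof.
rewrite expr2 -mulrA mulrC ler_pdivrMr ?ltr0n ?(n_gt0 HE)//.
apply: (@le_trans _ _ ((n E)%:R^-1 * \sum_t (2 * dot (grad (fw t) x - grad (fw t) xs) (grad (fw t) x - grad (fw t) xs)
   + 2 * dot (grad (fw t) w - grad (fw t) xs) (grad (fw t) w - grad (fw t) xs)))).
  by rewrite ler_wpM2l ?invr_ge0//; apply: ler_sum => t _; exact: dot_sub_le.
rewrite big_split /= -!mulr_sumr mulrDr !(mulrCA _ 2).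
have nN : (n E)%:R != 0 :> R by rewrite pnatr_eq0 -lt0n (n_gt0 HE).
have -> : 4 * (Lbar E / (n E)%:R) * (gap x + gap w) * (n E)%:R =
  4 * Lbar E * (gap x + gap w) by field.
have := fw_cocoercive x; have := fw_cocoercive w; lra.
Qed.

Lemma fi_gap_diff x w :
  (n E)%:R^-1 ^+ 2 * \sum_t ((m E)%:R^-1 * \sum_a
     dot (grad (fi E t a) x - grad (fi E t a) w) (grad (fi E t a) x - grad (fi E t a) w))
  <= 4 * (L E / (n E)%:R) * (gap x + gap w).
Proof.
rewrite expr2 -mulrA mulrC ler_pdivrMr ?ltr0n ?(n_gt0 HE)//.
pose q y t := (m E)%:R^-1 * \sum_a
     dot (grad (fi E t a) y - grad (fi E t a) xs) (grad (fi E t a) y - grad (fi E t a) xs).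
apply: (@le_trans _ _ ((n E)%:R^-1 * \sum_t (2 * q x t + 2 * q w t))).
  rewrite ler_wpM2l ?invr_ge0//; apply: ler_sum => t _.
  rewrite !(mulrCA 2) -mulrDr ler_wpM2l ?invr_ge0// !mulr_sumr -big_split.
  by apply: ler_sum => a _; exact: dot_sub_le.
have hx : (n E)%:R^-1 * \sum_t q x t <= 2 * L E * gap x := fi_cocoercive x.
have hw : (n E)%:R^-1 * \sum_t q w t <= 2 * L E * gap w := fi_cocoercive w.
move: hx hw; move: (q x) (q w) => qx qw hx hw.
rewrite big_split /= -!mulr_sumr mulrDr !(mulrCA _ 2).
have nN : (n E)%:R != 0 :> R by rewrite pnatr_eq0 -lt0n (n_gt0 HE).
have -> : 4 * (L E / (n E)%:R) * (gap x + gap w) * (n E)%:R =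
  4 * L E * (gap x + gap w) by field.
lra.
Qed.

(** The quadratic lower and upper bounds of [fobj] around its minimiser are compared. The factor
    [dot v v] stays because in dimension 0 nothing relates [mu] to [Lf]. *)
Lemma mu_le_Lf (v : V) : mu E * dot v v <= Lf E * dot v v.
Proof.
have df := (fobj_smooth HE).1.
have := strongly_convex_grad xs (xs + v) (fobj_strongly_convex HE) df.
have := smooth_descent xs (xs + v) (fobj_smooth HE).
rewrite grad_xstar dot0l [xs + v - xs]addrAC subrr add0r; lra.
Qed.

(** Here the gradient is exact but taken at [x] instead of at [x - e]. Expanding the square, the
    cross term with [e] costs half a gap and 4 [eta Lf] |e|^2, and replacing |x - xs|^2 by |y|^2 in
    the strong convexity term costs [eta mu] |e|^2, at most one more [eta Lf] |e|^2: hence the 5,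
    and the 3/2 = 2 - 1/2. *)
Lemma virtual_descent (x e y g : V) :
  y = x - e - xs -> g = grad (@fobj _ E) x ->
  dot (y - eta E *: g) (y - eta E *: g) <=
  (1 - mu E * eta E / 2) * dot y y
  - eta E * (3 / 2 - 2 * (eta E * Lf E)) * gap x + 5 * (eta E * Lf E) * dot e e.
Proof.
move=> ydef gdef; have eta0 := eta_gt0 HE; have Lf0 := Lf_gt0 HE; have mu0 := mu_ge0 HE.
have [z zdef] : exists z, z = x - xs by exists (x - xs).
have h1 : gap x + mu E / 2 * dot z z <= dot g z.
  have := strongly_convex_grad x xs (fobj_strongly_convex HE) (fobj_smooth HE).1.
  rewrite -gdef /gap (_ : xs - x = - z); last by rewrite zdef opprB.
  rewrite !dotE; lra.
have h2 := grad_sq_le x; rewrite -gdef in h2.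
(* Young's inequality with parameter [4 Lf], chosen so that |g|^2 <= 2 Lf gap leaves exactly half a
   gap. *)
have h3 : 2 * dot g e <= gap x / 2 + 4 * Lf E * dot e e.
  have := dot_ge0 (g - (4 * Lf E) *: e); rewrite !dotE (dotC e g) => h.
  have {h} : (4 * Lf E) * (2 * dot g e) <= (4 * Lf E) * (gap x / 2 + 4 * Lf E * dot e e).
    by move: h h2; lra.
  by rewrite ler_pM2l// mulr_gt0.
have h4 : dot y y <= 2 * dot z z + 2 * dot e e.
  have -> : y = z + - e by rewrite ydef zdef addrAC.
  by apply: le_trans (dot_add_le _ _) _; rewrite dotNl dotNr opprK.
have h5 := mu_le_Lf e.
have yE : y = z - e by rewrite ydef zdef addrAC.
have -> : dot (y - eta E *: g) (y - eta E *: g) =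
  dot y y - 2 * eta E * dot g z + eta E * (2 * dot g e) + eta E ^+ 2 * dot g g.
  have eyg : dot y g = dot g z - dot g e by rewrite dotC yE dotDr dotNr.
  rewrite dotDl dotNl !dotDr !dotNr !dotZl !dotZr (dotC g y) eyg; ring.
have k1 := ler_wpM2l (ltW eta0) h1.
have k3 := ler_wpM2l (ltW eta0) h3.
have k2 := ler_wpM2l (sqr_ge0 (eta E)) h2.
have k4 := ler_wpM2l (mulr_ge0 (ltW eta0) mu0) h4.
have k5 := ler_wpM2l (ltW eta0) h5.
move: k1 k2 k3 k4 k5; lra.
Qed.

End problem.

Section shrink.
Context (R : realType) (d : nat) (delta : R).
Hypothesis delta01 : 0 < delta <= 1.
Implicit Types (g e : 'rV[R]_d).

(** After multiplication by [delta], the difference of the two sides is the square of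
    [delta *: e - (1 - delta) *: g]. One factor [1 - delta] is spent entirely on separating [g] from
    [e]; for averages, unbiasedness supplies a second one that gives the contraction. *)
Lemma shrink_average g e :
  (1 - delta) * dot (g + e) (g + e) <= dot e e + (1 - delta) / delta * dot g g.
Proof.
have /andP[d0 d1] := delta01.
have := dot_ge0 (delta *: e - (1 - delta) *: g); rewrite !dotE (dotC e g) => h.
rewrite -(ler_pM2l d0).
have -> : delta * (dot e e + (1 - delta) / delta * dot g g) =
  delta * dot e e + (1 - delta) * dot g g by field; rewrite gt_eqF.
move: h; lra.
Qed.

(** For a single worker only one factor [1 - delta] is at hand. Young's inequality with parameter
    [delta / 2] uses half of it and keeps the other half as contraction. *)
Lemma shrink_one g e :
  (1 - delta) * dot (g + e) (g + e)
    <= (1 - delta / 2) * dot e e + 3 * ((1 - delta) / delta) * dot g g.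
Proof.
have /andP[d0 d1] := delta01.
have d2 : 0 < delta / 2 by rewrite divr_gt0.
have h := dot_young e g d2.
have e1 : (delta / 2)^-1 = 2 / delta by field; rewrite gt_eqF.
rewrite e1 [e + g]addrC in h.
have h2 := ler_wpM2l (_ : 0 <= 1 - delta) h.
apply: le_trans (h2 _) _; first by rewrite subr_ge0.
rewrite mulrDr; apply: lerD.
  by rewrite mulrA ler_wpM2r ?dot_ge0//; nra.
rewrite [leLHS]mulrA ler_wpM2r ?dot_ge0//.
have -> : 3 * ((1 - delta) / delta) = (1 - delta) * (3 / delta) by field; rewrite gt_eqF.
rewrite ler_wpM2l ?subr_ge0// -(ler_pM2l d0).
have -> : delta * (1 + 2 / delta) = delta + 2 by field; rewrite gt_eqF.
have -> : delta * (3 / delta) = 3 by field; rewrite gt_eqF.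
lra.
Qed.

End shrink.

Section one_step.
Context (R : realType) (E : ec_lsvrg R).
Hypothesis HE : assumptions E.
Hypothesis L0 : 0 <= L E.
Hypothesis Lbar0 : 0 <= Lbar E.
Local Notation V := 'rV[R]_(dim E).
Local Notation xs := (xstar E).
Local Notation TK K := (known (@draw_events R E) K).
Local Notation nR := ((n E)%:R : R).
Local Notation mean_le := (mean_le (P E)).
Variable (k : nat).

Let GI := @setI_closed_draw_events R E.
Let GT := @draw_eventsT R E.
Let Gm := @draw_events_measurable R E HE.
Let ind := draws_independent (draws_assumption HE).

Let Ki (t : 'I_(n E)) : set (draw_index E) := [set inl (inl (inl (k, t)))].
Let KQ (t : 'I_(n E)) : set (draw_index E) := [set inl (inl (inr (k, t)))].
Let KQ1 (t : 'I_(n E)) : set (draw_index E) := [set inl (inr (k, t))].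

Let mi t a : @measurable _ (TK (Ki t)) (draw_i E k t @^-1` [set a]).
Proof. exact: known_draw_i. Qed.

Let ui t a : P E (draw_i E k t @^-1` [set a]) = ((m E)%:R^-1)%:E.
Proof. exact: (draw_i_uniform (draws_assumption HE) k t a).2. Qed.

Section compressed.
Variables (u : 'I_(n E) -> 'I_(m E) -> V) (tau : 'I_(n E) -> R).
Hypothesis utau : forall t, (m E)%:R^-1 * \sum_a dot (u t a) (u t a)
  <= dot (vmean (u t)) (vmean (u t)) + tau t.

Let uh t := vmean (u t).

(* The compressor [Q = 0] with [delta = 0] turns [mean_compressed_average] into a
   statement on plain sampling. *)
Lemma mean_sampled :
  mean_le (fun w => dot (vmean (fun t => u t (draw_i E k t w)))
                        (vmean (fun t => u t (draw_i E k t w))))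
    (dot (vmean uh) (vmean uh) + nR^-1 ^+ 2 * \sum_t tau t).
Proof.
have Kiq t : Ki t `&` KQ t = set0 by apply/seteqP; split => // j [-> ].
have Kdis t v : t != v -> (Ki t `|` KQ t) `&` (Ki v `|` KQ v) = set0.
  move=> tv; apply/seteqP; split => // j [[->|->] [|]] => // -[] /eqP; rewrite (negbTE tv)//.
have mq t : measurable_fun [set: TK (KQ t)] (draw_Q E k t : TK (KQ t) -> seedQ E).
  exact: known_draw_Q.
have m0 : random_map (fun (_ : seedQ E) (_ : V) => 0 : V).
  by move=> j; under eq_fun do rewrite mxE; exact: measurable_cst.
have c0 (x : V) : ('E_(lawQ E)[fun s => (enorm (x - 0) ^+ 2)%R] <= ((1 - 0) * enorm x ^+ 2)%:E)%E.
  by rewrite !subr0 mul1r [leLHS](expectation_cst (lawQ E)).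
have s0 : mean_scaling (lawQ E) (fun _ _ => 0 : V) 0.
  by move=> x j; under eq_fun do rewrite mxE; rewrite mul0r; exact: expectation_cst.
have := mean_compressed_average GI GT Gm ind Kiq Kdis mi ui mq
  (draw_Q_law (draws_assumption HE) k) m0 c0 s0 u.
rewrite subr0 expr1n !mul1r.
under eq_fun => w do under eq_vmean => t do rewrite subr0.
move/mean_leW; apply; rewrite lerD2l ler_wpM2l ?sqr_ge0//.
by apply: ler_sum => t _; rewrite !mul1r; have := utau t; lra.
Qed.

(** The two ways of measuring the new errors: for the average, the individual terms [uh t] enter
    only through the compression variance, with the small factor [delta * (1 - delta)]; worker by
    worker only the plain contraction is available. *)
Lemma mean_compressed_Q :
  mean_le (fun w => dot (vmean (fun t => u t (draw_i E k t w) - Q E (draw_Q E k t w) (u t (draw_i E k t w))))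
                        (vmean (fun t => u t (draw_i E k t w) - Q E (draw_Q E k t w) (u t (draw_i E k t w)))))
    ((1 - delta E) ^+ 2 * dot (vmean uh) (vmean uh)
     + nR^-1 ^+ 2 * \sum_t ((1 - delta E) * tau t + delta E * (1 - delta E) * dot (uh t) (uh t)))
  /\ forall t, mean_le (fun w =>
       dot (u t (draw_i E k t w) - Q E (draw_Q E k t w) (u t (draw_i E k t w)))
           (u t (draw_i E k t w) - Q E (draw_Q E k t w) (u t (draw_i E k t w))))
    ((1 - delta E) * (dot (uh t) (uh t) + tau t)).
Proof.
have [/andP[d0 d1] mQ cQ] := Q_compressor HE.
have sQ := Q_mean HE.
have Kiq t : Ki t `&` KQ t = set0 by apply/seteqP; split => // j [-> ].
have Kdis t v : t != v -> (Ki t `|` KQ t) `&` (Ki v `|` KQ v) = set0.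
  move=> tv; apply/seteqP; split => // j [[->|->] [|]] => // -[] /eqP; rewrite (negbTE tv)//.
have mq t : measurable_fun [set: TK (KQ t)] (draw_Q E k t : TK (KQ t) -> seedQ E).
  exact: known_draw_Q.
split.
  have := mean_compressed_average GI GT Gm ind Kiq Kdis mi ui mq
    (draw_Q_law (draws_assumption HE) k) mQ cQ sQ u.
  move/mean_leW; apply; rewrite lerD2l ler_wpM2l ?sqr_ge0//.
  apply: ler_sum => t _; have := utau t; rewrite -/(uh t) => h.
  have := ler_wpM2l (_ : 0 <= 1 - delta E) h; rewrite subr_ge0 => /(_ d1); lra.
move=> t.
have := mean_compressed_sq GI GT Gm ind Kiq mi ui mq
    (draw_Q_law (draws_assumption HE) k) mQ cQ u t.
by move/mean_leW; apply; rewrite ler_wpM2l ?subr_ge0//; exact: utau.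
Qed.

End compressed.

Lemma mean_compressed_Q1 (v : 'I_(n E) -> V) :
  mean_le (fun w => dot (vmean (fun t => v t - Q1 E (draw_Q1 E k t w) (v t)))
                        (vmean (fun t => v t - Q1 E (draw_Q1 E k t w) (v t))))
    ((1 - delta1 E) ^+ 2 * dot (vmean v) (vmean v)
     + delta1 E * (1 - delta1 E) * (nR^-1 ^+ 2 * \sum_t dot (v t) (v t)))
  /\ forall t, mean_le (fun w => dot (v t - Q1 E (draw_Q1 E k t w) (v t))
                                     (v t - Q1 E (draw_Q1 E k t w) (v t)))
    ((1 - delta1 E) * dot (v t) (v t)).
Proof.
have [/andP[d0 d1] mQ cQ] := Q1_compressor HE.
have sQ := Q1_mean HE.
have Kiq t : Ki t `&` KQ1 t = set0 by apply/seteqP; split => // j [-> ].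
have Kdis t u : t != u -> (Ki t `|` KQ1 t) `&` (Ki u `|` KQ1 u) = set0.
  move=> tv; apply/seteqP; split => // j [[->|->] [|]] => // -[] /eqP; rewrite (negbTE tv)//.
have mq t : measurable_fun [set: TK (KQ1 t)] (draw_Q1 E k t : TK (KQ1 t) -> seedQ1 E).
  exact: known_draw_Q1.
have m0 := m_gt0 HE.
split.
  have := mean_compressed_average GI GT Gm ind Kiq Kdis mi ui mq
    (draw_Q1_law (draws_assumption HE) k) mQ cQ sQ (fun t _ => v t).
  move/mean_leW; apply.
  have -> : vmean (fun t => vmean (fun _ : 'I_(m E) => v t)) = vmean v.
    by apply: eq_vmean => t; rewrite vmean_cst.
  rewrite lerD2l mulrCA ler_wpM2l ?sqr_ge0// mulr_sumr; apply: ler_sum => t _.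
  rewrite vmean_cst// mean_const//; lra.
move=> t.
have := mean_compressed_sq GI GT Gm ind Kiq mi ui mq
    (draw_Q1_law (draws_assumption HE) k) mQ cQ (fun t _ => v t) t.
by move/mean_leW; apply; rewrite mean_const.
Qed.

Let coin w : R := (draw_w E k w)%:R.

Lemma measurable_coin : measurable_fun [set: TK [set inr k]] (coin : TK [set inr k] -> R).
Proof.
apply: (measurable_fun_countable (Z := draw_w E k : TK [set inr k] -> bool) (fun b => b%:R)) => b.
have : measurable_fun [set: TK [set inr k]] (draw_w E k : TK [set inr k] -> bool).
  exact: known_draw_w.
by move=> /(_ measurableT [set b] I); rewrite setTI.
Qed.

Lemma rintegrable_coin : rintegrable (P E) coin /\ \int[P E]_w coin w = p E.
Proof.
have mc : measurable_fun setT (coin : Omega E -> R).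
  exact: (known_measurable Gm measurable_coin).
have ic : rintegrable (P E) coin.
  apply: (rintegrable_dom mc (rintegrable_cst (P E) 1)) => w.
  by rewrite /coin; case: (draw_w E k w); rewrite ?normr1 ?normr0.
split => //; apply: EFin_inj; rewrite -rintegrable_fin//.
rewrite -(draw_w_law (draws_assumption HE) k) -[in RHS](setIT (_ @^-1` _)).
rewrite -integral_indic//; last first.
  by rewrite -[X in measurable X]setTI; exact: measurable_funP.
apply: eq_integral => w _; congr EFin; rewrite /coin indicE.
by congr (_%:R); congr nat_of_bool; apply/idP/idP; rewrite inE.
Qed.

(** The condition on [K] keeps the coin of step [k] out of [U], so the two are independent. *)
Lemma mean_le_coin (K : set (draw_index E)) (U : Omega E -> R) b : ~ K (inr k) ->
  measurable_fun [set: TK K] (U : TK K -> R) -> mean_le U b ->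
  mean_le (fun w => coin w * U w) (p E * b).
Proof.
move=> nK mU [iU Ub]; have [ic ec] := rintegrable_coin.
have K0 : [set inr k] `&` K = set0 by apply/seteqP; split => // j [-> ].
have [h1 h2] := indep_mul GI GT Gm ind K0 measurable_coin mU ic iU.
split => //; rewrite h2 ec ler_wpM2l//.
by have /andP[/ltW] := p_range HE.
Qed.

Let kappa := 1 + 2 * p E / delta1 E.

(** The reference point moves only when the coin shows true, so Young's inequality is paid only on
    that event, and both its cost on [U] and the jump [D] are weighted by [p]. *)
Lemma mean_le_jump (K : set (draw_index E)) (U : Omega E -> V) (D : V) b :
  ~ K (inr k) -> @vmeas _ (TK K) _ _ U -> mean_le (fun w => dot (U w) (U w)) b ->
  mean_le (fun w => dot (U w + coin w *: D) (U w + coin w *: D))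
    ((1 + delta1 E / 2) * b + p E * kappa * dot D D).
Proof.
move=> nK vU hU.
have /andP[p0 p1] := p_range HE.
have [/andP[d0 d1] _ _] := Q1_compressor HE.
(* With this parameter [p * s = delta1 / 2], half of the contraction of [Q1], and [1 + 1 / s] is
   [kappa], the factor occurring in [eta_max]. *)
pose s := delta1 E / (2 * p E).
have s0 : 0 < s by rewrite divr_gt0// mulr_gt0.
have mUU := vmeas_dot vU vU.
have hc := mean_le_coin nK mUU hU.
have [ic ec] := rintegrable_coin.
have hc1 : mean_le coin (p E) by split => //; rewrite ec.
have kD0 : 0 <= kappa * dot D D.
  by rewrite mulr_ge0 ?dot_ge0// addr_ge0// divr_ge0 ?mulr_ge0 ?ltW.
have := mean_leD (mean_leD hU (mean_leZ (ltW s0) hc)) (mean_leZ kD0 hc1).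
rewrite (_ : b + s * (p E * b) + kappa * dot D D * p E =
  (1 + delta1 E / 2) * b + p E * kappa * dot D D); last first.
  by rewrite /s; field; rewrite gt_eqF.
apply: mean_le_dom.
  have vD : @vmeas _ (Omega E) _ _ (fun w => U w + coin w *: D).
    apply: vmeasD; first by move=> j; exact: (known_measurable Gm (vU j)).
    move=> j; under eq_fun do rewrite mxE.
    apply: measurable_funM; last exact: measurable_cst.
    exact: (known_measurable Gm measurable_coin).
  exact: vmeas_dot.
move=> w; rewrite dot_ge0 /= /coin; case: (draw_w E k w) => /=.
  rewrite scale1r !mul1r mulr1.
  have -> : kappa = 1 + s^-1 by rewrite /kappa /s invf_div mulrC mulrA.
  have := dot_young (U w) D s0; lra.
by rewrite scale0r addr0 !mul0r !mulr0 !addr0.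
Qed.

Variable s : state E.
Hypothesis hs : st_h s = vmean (st_ht s).
Local Notation x := (st_x s).
Local Notation y := (st_w s).

Let gapsum := gap x + gap y.

Definition virtual (s : state E) : V := st_x s - vmean (st_e s) - xs.
Definition dist_part (s : state E) : R := dot (virtual s) (virtual s).
Definition err_part (s : state E) : R := dot (vmean (st_e s)) (vmean (st_e s)).
(** Normalised by [n^-2], the scale of the variance of an average of independent terms, not by the
    [n^-1] of a mean. *)
Definition errs_part (s : state E) : R :=
  nR^-1 ^+ 2 * \sum_t dot (st_e s t) (st_e s t).
Definition res_part (s : state E) : R := dot (vmean (residual s)) (vmean (residual s)).
Definition ress_part (s : state E) : R :=
  nR^-1 ^+ 2 * \sum_t dot (residual s t) (residual s t).

Let gh t := grad (fw t) x - st_ht s t.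

Lemma vmean_gradient_estimate t : vmean (gradient_estimate s t) = gh t.
Proof.
have m0 := m_gt0 HE.
rewrite /gradient_estimate vmeanB vmeanD vmeanB -!grad_fw// !vmean_cst//.
by rewrite subrK.
Qed.

Lemma vmean_gh : vmean gh = grad (@fobj _ E) x - st_h s.
Proof. by rewrite vmeanB -grad_fobj// hs. Qed.

(** An upper bound for the sampling variance at one worker, small when both [x] and the reference
    point are nearly optimal ([sum_tau_le]). *)
Let tau t := eta E ^+ 2 * ((m E)%:R^-1 * \sum_a
     dot (grad (fi E t a) x - grad (fi E t a) y) (grad (fi E t a) x - grad (fi E t a) y)).

Lemma sum_tau_le : nR^-1 ^+ 2 * \sum_t tau t <= eta E ^+ 2 * (4 * (L E / nR) * gapsum).
Proof. by rewrite -mulr_sumr mulrCA ler_wpM2l ?sqr_ge0//; exact: fi_gap_diff. Qed.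

(** The centre [c] is what remains of [u a] once the sampled gradient difference is dropped. The
    sign is left open because the same noise enters the virtual iterate and the compressor input
    with opposite signs. *)
Lemma variance_tau t (u : 'I_(m E) -> V) c :
  (forall a, u a - c = eta E *: (grad (fi E t a) x - grad (fi E t a) y) \/
             u a - c = - (eta E *: (grad (fi E t a) x - grad (fi E t a) y))) ->
  (m E)%:R^-1 * \sum_a dot (u a) (u a) <= dot (vmean u) (vmean u) + tau t.
Proof.
move=> h; apply: le_trans (variance_le u c (m_gt0 HE)) _.
rewrite lerD2l /tau mulrCA ler_wpM2l ?invr_ge0// mulr_sumr; apply: ler_sum => a _.
by case: (h a) => ->; rewrite ?dotNl ?dotNr ?opprK dotZl dotZr mulrA -expr2.
Qed.

(** The mean of the stochastic step is the exact gradient step of [virtual_descent], thanks to the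
    invariant [hs]; sampling adds only its variance. *)
Lemma mean_dist_part :
  mean_le (fun w => dist_part (step k w s))
   ((1 - mu E * eta E / 2) * dist_part s
    - eta E * (3 / 2 - 2 * (eta E * Lf E)) * gap x
    + 5 * (eta E * Lf E) * err_part s + eta E ^+ 2 * (4 * (L E / nR) * gapsum)).
Proof.
have n0 := n_gt0 HE; have m0 := m_gt0 HE.
pose u t a := virtual s - eta E *: (gradient_estimate s t a + st_h s).
have ut t : (m E)%:R^-1 * \sum_a dot (u t a) (u t a) <= dot (vmean (u t)) (vmean (u t)) + tau t.
  apply: (@variance_tau _ _ (virtual s - eta E *: (residual s t + st_h s))) => a; right.
  rewrite /u opprB addrC subrKA -scalerBr -scalerN; congr (_ *: _).
  rewrite addrAC opprD !addrA; apply/rowP => j; rewrite /residual /gradient_estimate !mxE; ring.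
have := mean_sampled ut.
have -> : vmean (fun t => vmean (u t)) = virtual s - eta E *: grad (@fobj _ E) x.
  rewrite (eq_vmean (w := fun t => virtual s - eta E *: (gh t + st_h s))).
    by rewrite vmeanB vmeanZ vmeanD !vmean_cst// vmean_gh subrK.
  by move=> t; rewrite vmeanB vmeanZ vmeanD !vmean_cst// vmean_gradient_estimate.
have e w : virtual (step k w s) = vmean (fun t => u t (draw_i E k t w)).
  rewrite /virtual step_x.
  rewrite (eq_vmean (v := st_e (step k w s)) (step_e k w s)).
  have -> : vmean (fun t => u t (draw_i E k t w)) = virtual s - eta E *:
      (vmean (fun t => gradient_estimate s t (draw_i E k t w)) + st_h s).
    by rewrite /u vmeanB vmeanZ vmeanD !vmean_cst.
  rewrite vmeanB /compressor_input vmeanD vmeanZ /virtual scalerDr.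
  apply/rowP => j; rewrite !mxE; ring.
under eq_fun do rewrite -e.
move/mean_leW; apply; apply: lerD; last exact: sum_tau_le.
exact: virtual_descent.
Qed.

Let q := (1 - delta E) / delta E.

(** The average and the individual errors are treated together because the compression variance of
    the former feeds on the latter. *)
Lemma mean_err_parts :
  mean_le (fun w => err_part (step k w s) + 4 * errs_part (step k w s))
   ((1 - delta E) * err_part s + 4 * (1 - delta E / 4) * errs_part s
    + q * eta E ^+ 2 * ((8 * Lf E + 120 * (Lbar E / nR)) * gapsum
        + 2 * res_part s + 30 * ress_part s)
    + 5 * (1 - delta E) * (eta E ^+ 2 * (4 * (L E / nR) * gapsum))).
Proof.
have [d01 _ _] := Q_compressor HE; have /andP[d0 d1] := d01.
have d1' : 0 <= 1 - delta E by rewrite subr_ge0.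
have n0 := n_gt0 HE; have m0 := m_gt0 HE.
pose u t a := compressor_input s t a.
have ut t : (m E)%:R^-1 * \sum_a dot (u t a) (u t a) <= dot (vmean (u t)) (vmean (u t)) + tau t.
  apply: (@variance_tau _ _ (eta E *: residual s t + st_e s t)) => a; left.
  rewrite /u /compressor_input opprD addrACA subrr addr0 -scalerBr; congr (_ *: _).
  apply/rowP => j; rewrite /residual /gradient_estimate !mxE; ring.
have uE t : vmean (u t) = eta E *: gh t + st_e s t.
  by rewrite vmeanD vmeanZ vmean_cst// vmean_gradient_estimate.
have [hA hB] := mean_compressed_Q ut.
have hBs := mean_leZ (sqr_ge0 nR^-1) (mean_le_sum (index_enum _) hB).
have := mean_leD hA (mean_leZ (ler0n R 4) hBs).
have eA w : vmean (fun t => u t (draw_i E k t w) - Q E (draw_Q E k t w) (u t (draw_i E k t w)))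
   = vmean (st_e (step k w s)) by apply: eq_vmean => t; rewrite step_e.
have eB w t : u t (draw_i E k t w) - Q E (draw_Q E k t w) (u t (draw_i E k t w))
   = st_e (step k w s) t by rewrite step_e.
under eq_fun => w.
  rewrite eA.
  under eq_bigr do rewrite eB.
over.
move/mean_leW; apply.
rewrite (eq_vmean uE) vmeanD vmeanZ.
set g := vmean gh; set e := vmean (st_e s).
pose Uh := nR^-1 ^+ 2 * \sum_t dot (vmean (u t)) (vmean (u t)).
have eS1 : nR^-1 ^+ 2 * \sum_t ((1 - delta E) * tau t + delta E * (1 - delta E) * dot (vmean (u t)) (vmean (u t)))
   = (1 - delta E) * (nR^-1 ^+ 2 * \sum_t tau t) + delta E * (1 - delta E) * Uh.
  by rewrite big_split /= -!mulr_sumr mulrDr !(mulrCA (nR^-1 ^+ 2)).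
have eS2 : nR^-1 ^+ 2 * \sum_t (1 - delta E) * (dot (vmean (u t)) (vmean (u t)) + tau t)
   = (1 - delta E) * (Uh + nR^-1 ^+ 2 * \sum_t tau t).
  by rewrite -mulr_sumr big_split /= mulrCA mulrDr.
rewrite eS1 eS2.
have hG1 : dot g g <= 8 * Lf E * gapsum + 2 * res_part s.
  have -> : g = (grad (@fobj _ E) x - grad (@fobj _ E) y) + vmean (residual s).
    rewrite /g vmean_gh /residual vmeanB -grad_fobj// hs.
    by rewrite addrA subrK.
  apply: le_trans (dot_add_le _ _) _; rewrite -/(res_part s).
  have := fobj_gap_diff HE x y; rewrite -/gapsum; lra.
pose G2 := nR^-1 ^+ 2 * \sum_t dot (gh t) (gh t).
have hG2 : G2 <= 8 * (Lbar E / nR) * gapsum + 2 * ress_part s.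
  apply: (@le_trans _ _ (nR^-1 ^+ 2 * \sum_t
     (2 * dot (grad (fw t) x - grad (fw t) y) (grad (fw t) x - grad (fw t) y)
      + 2 * dot (residual s t) (residual s t)))).
    rewrite ler_wpM2l ?sqr_ge0//; apply: ler_sum => t _.
    have -> : gh t = (grad (fw t) x - grad (fw t) y) + residual s t.
      by rewrite /gh /residual addrA subrK.
    exact: dot_add_le.
  rewrite big_split /= -!mulr_sumr mulrDr !(mulrCA _ 2) -/(ress_part s).
  have := fw_gap_diff HE Lbar0 x y; rewrite -/gapsum; lra.
(* Individual errors: [shrink_one] at each worker. *)
have hX : (1 - delta E) * Uh <= (1 - delta E / 2) * errs_part s + 3 * q * eta E ^+ 2 * G2.
  apply: (@le_trans _ _ (nR^-1 ^+ 2 * \sum_t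
     ((1 - delta E / 2) * dot (st_e s t) (st_e s t) + 3 * q * (eta E ^+ 2 * dot (gh t) (gh t))))).
    rewrite /Uh mulrCA ler_wpM2l ?sqr_ge0// mulr_sumr; apply: ler_sum => t _.
    rewrite uE; apply: le_trans (shrink_one d01 _ _) _.
    by rewrite dotZl dotZr [eta E * (eta E * _)]mulrA -expr2.
  rewrite big_split /= -!mulr_sumr mulrDr /errs_part /G2; lra.
have q0 : 0 <= q by rewrite /q divr_ge0// ltW.
(* Averaged error: one factor [1 - delta] goes into [shrink_average], the other remains as
   contraction. *)
have hY : (1 - delta E) ^+ 2 * dot (eta E *: g + e) (eta E *: g + e)
   <= (1 - delta E) * err_part s + q * eta E ^+ 2 * dot g g.
  rewrite expr2 -mulrA.
  have := ler_wpM2l d1' (shrink_average d01 (eta E *: g) e).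
  rewrite -/q dotZl dotZr -/(err_part s) => h; apply: le_trans h _.
  have gg0 : 0 <= delta E * (q * eta E ^+ 2 * dot g g).
    by rewrite mulr_ge0 ?(ltW d0)// mulr_ge0 ?dot_ge0// mulr_ge0 ?sqr_ge0.
  move: gg0; move: q => q'; lra.
have qe0 : 0 <= q * eta E ^+ 2 by rewrite mulr_ge0// sqr_ge0.
have G20 : 0 <= G2.
  by rewrite /G2 mulr_ge0 ?sqr_ge0//; apply: sumr_ge0 => t _; exact: dot_ge0.
have B0 : 0 <= errs_part s.
  by rewrite mulr_ge0 ?sqr_ge0//; apply: sumr_ge0 => t _; exact: dot_ge0.
have d4 : 0 <= 4 + delta E by rewrite addr_ge0// ltW.
have d5 : 0 <= 5 * (1 - delta E) by rewrite mulr_ge0.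
have k1 := ler_wpM2l qe0 hG1.
have k2 := ler_wpM2l d4 hX.
(* This fixes the weight 4: with weight [c], the inequality [(c + delta) * (1 - delta / 2) <= c * (1
   - delta / 4)] amounts to [c >= 4 - 2 * delta]. The summand [delta] is the compression variance of
   the average. *)
have k3 : (4 + delta E) * (1 - delta E / 2) * errs_part s <= 4 * (1 - delta E / 4) * errs_part s.
  by rewrite ler_wpM2r//; nra.
(* It replaces [3 * (4 + delta)] by 15; with the two constants of [hG2] this gives the 120 and the
   30. *)
have k4 : 0 <= (1 - delta E) * (q * eta E ^+ 2 * G2) by rewrite mulr_ge0// mulr_ge0.
have k5 := ler_wpM2l qe0 hG2.
have k6 := ler_wpM2l d5 sum_tau_le.
move: hY k1 k2 k3 k4 k5 k6; move: q (nR^-1 ^+ 2 * \sum_t tau t) => q' T.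
lra.
Qed.

Let KQ1s : set (draw_index E) := [set j | exists t, j = inl (inr (k, t))].

Let vmeas_resid t : @vmeas _ (TK KQ1s) _ _
  (fun w => residual s t - Q1 E (draw_Q1 E k t w) (residual s t)).
Proof.
have [_ mQ _] := Q1_compressor HE.
apply: vmeasB; first exact: vmeas_cst.
apply: (vmeas_random_map mQ); last exact: vmeas_cst.
by apply: known_draw_Q1; exists t.
Qed.

Let KQ1s_w : ~ KQ1s (inr k).
Proof. by case. Qed.

Lemma step_residual w t : residual (step k w s) t =
  (residual s t - Q1 E (draw_Q1 E k t w) (residual s t))
  + coin w *: (grad (fw t) x - grad (fw t) y).
Proof.
rewrite /residual step_w step_ht /coin; case: (draw_w E k w) => /=.
  by rewrite scale1r; apply/rowP => j; rewrite !mxE; ring.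
by rewrite scale0r addr0 opprD addrA.
Qed.

(** [mean_le_jump] applied to the averaged residual, so the jump is a difference of gradients of
    [fobj] and costs [Lf], with no [Lbar]. *)
Lemma mean_res_part :
  mean_le (fun w => res_part (step k w s))
    ((1 + delta1 E / 2) * ((1 - delta1 E) ^+ 2 * res_part s
       + delta1 E * (1 - delta1 E) * ress_part s)
     + p E * kappa * (4 * Lf E * gapsum)).
Proof.
have [hA _] := mean_compressed_Q1 (residual s).
have := mean_le_jump (grad (@fobj _ E) x - grad (@fobj _ E) y) KQ1s_w (vmeas_mean vmeas_resid) hA.
have e w : vmean (residual (step k w s)) =
  vmean (fun t => residual s t - Q1 E (draw_Q1 E k t w) (residual s t))
  + coin w *: (grad (@fobj _ E) x - grad (@fobj _ E) y).
  rewrite !(grad_fobj HE) -vmeanB -vmeanZ -vmeanD.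
  by apply: eq_vmean => t; exact: step_residual.
under eq_fun do rewrite -e.
move/mean_leW; apply; rewrite lerD2l ler_wpM2l//; last exact: fobj_gap_diff.
have /andP[p0 p1] := p_range HE; have [/andP[d0 d1] _ _] := Q1_compressor HE.
by rewrite mulr_ge0 ?(ltW p0)// addr_ge0// divr_ge0 ?mulr_ge0 ?ltW.
Qed.

Lemma mean_ress_part :
  mean_le (fun w => ress_part (step k w s))
    ((1 + delta1 E / 2) * ((1 - delta1 E) * ress_part s)
     + p E * kappa * (4 * (Lbar E / nR) * gapsum)).
Proof.
have [_ hA] := mean_compressed_Q1 (residual s).
have h t := mean_le_jump (grad (fw t) x - grad (fw t) y) KQ1s_w (vmeas_resid t) (hA t).
have := mean_leZ (sqr_ge0 nR^-1) (mean_le_sum (index_enum _) h).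
under eq_fun do under eq_bigr do rewrite -step_residual.
move/mean_leW; apply.
have /andP[p0 p1] := p_range HE; have [/andP[d0 d1] _ _] := Q1_compressor HE.
rewrite big_split /= -!mulr_sumr mulrDr; apply: lerD.
  rewrite /ress_part; lra.
rewrite mulrCA ler_wpM2l//; last exact: fw_gap_diff.
by rewrite mulr_ge0 ?(ltW p0)// addr_ge0// divr_ge0 ?mulr_ge0 ?ltW.
Qed.

Lemma mean_gap_w :
  mean_le (fun w => gap (st_w (step k w s))) (p E * gap x + (1 - p E) * gap y).
Proof.
have [ic ec] := rintegrable_coin.
have iY := rintegrableD (rintegrable_cst (P E) (gap y)) (rintegrableZ (gap x - gap y) ic).
have e w : gap (st_w (step k w s)) = gap y + (gap x - gap y) * coin w.
  rewrite step_w /coin; case: (draw_w E k w) => /=; lra.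
under eq_fun do rewrite e.
split => //; rewrite meanD//; [|exact: rintegrable_cst|exact: rintegrableZ].
rewrite mean_cst meanZ// ec; lra.
Qed.

End one_step.

(** * The Lyapunov function *)

Section lyapunov_arith.
Variable R : realFieldType.

(** Here [l] and [lb] stand for [L / n] and [Lbar / n], and [D], [A], [B], [H], [J], [Fx], [Fy] for
    the parts of the function and the two gaps. The coefficients are compared part by part; [M]
    collects every multiple of the sum of the two gaps. *)
Lemma lyapunov_arith (eta Lf l lb mu delta delta1 p rho D A B H J Fx Fy : R) :
  0 < eta -> 0 < Lf -> 0 <= l -> 0 <= lb ->
  0 < delta <= 1 -> 0 < delta1 <= 1 -> 0 < p <= 1 ->
  0 <= D -> 0 <= A -> 0 <= B -> 0 <= H -> 0 <= J -> 0 <= Fx -> 0 <= Fy ->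
  rho <= mu * eta / 2 -> rho <= delta / 4 -> rho <= delta1 / 4 -> rho <= p / 4 ->
  4 * (eta * Lf) + 33 * (eta * l) <= 1 ->
  (1 - delta) * eta ^+ 2 * Lf * Lf / delta ^+ 2 <= 1 / 3600 ->
  (1 - delta) * eta ^+ 2 * Lf * l / delta <= 1 / (229 * 229) ->
  (1 - delta) * eta ^+ 2 * Lf * lb / delta ^+ 2 <= 1 / (360 * 360) ->
  (1 - delta) * eta ^+ 2 * Lf * (p * (1 + 2 * p / delta1) * (Lf + 12 * lb)) / (delta ^+ 2 * delta1)
    <= 1 / (120 * 120) ->
  forall q alpha g1 g2 beta pk : R,
  q = (1 - delta) / delta -> alpha = 8 * (eta * Lf) / delta ->
  g1 = 4 * (alpha * q * eta ^+ 2) / delta1 ->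
  g2 = 136 * (alpha * q * eta ^+ 2) / delta1 ->
  beta = eta / (2 * p) -> pk = p * (1 + 2 * p / delta1) ->
  ((1 - mu * eta / 2) * D - eta * (3 / 2 - 2 * (eta * Lf)) * Fx
    + 5 * (eta * Lf) * A + eta ^+ 2 * (4 * l * (Fx + Fy)))
  + alpha * ((1 - delta) * A + 4 * (1 - delta / 4) * B
    + q * eta ^+ 2 * ((8 * Lf + 120 * lb) * (Fx + Fy) + 2 * H + 30 * J)
    + 5 * (1 - delta) * (eta ^+ 2 * (4 * l * (Fx + Fy))))
  + g1 * ((1 + delta1 / 2) * ((1 - delta1) ^+ 2 * H + delta1 * (1 - delta1) * J)
     + pk * (4 * Lf * (Fx + Fy)))
  + g2 * ((1 + delta1 / 2) * ((1 - delta1) * J) + pk * (4 * lb * (Fx + Fy)))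
  + beta * (p * Fx + (1 - p) * Fy)
  <= (1 - rho) * (D + alpha * (A + 4 * B) + g1 * H + g2 * J + beta * Fy)
     - 2 / 5 * eta * Fx.
Proof.
move=> eta0 Lf0 l0 lb0 /andP[d0 d1] /andP[e0 e1] /andP[p0 p1] D0 A0 B0 H0 J0 Fx0 Fy0.
move=> rmu rd rd1 rp C1 C2 C3 C4 C5 q alpha g1 g2 beta pk qE alE g1E g2E beE pkE.
have q0 : 0 <= q by rewrite qE divr_ge0 ?subr_ge0// ltW.
have al0 : 0 <= alpha by rewrite alE divr_ge0 ?(ltW d0)// !mulr_ge0// ltW.
have ald : alpha * delta = 8 * (eta * Lf) by rewrite alE; field; rewrite gt_eqF.
pose S := alpha * q * eta ^+ 2.
have S0 : 0 <= S := mulr_ge0 (mulr_ge0 al0 q0) (sqr_ge0 eta).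
have g1d : g1 * delta1 = 4 * S by rewrite g1E /S; field; rewrite gt_eqF.
have g2d : g2 * delta1 = 136 * S by rewrite g2E /S; field; rewrite gt_eqF.
have g10 : 0 <= g1 by rewrite g1E divr_ge0 ?(ltW e0)// mulr_ge0.
have g20 : 0 <= g2 by rewrite g2E divr_ge0 ?(ltW e0)// mulr_ge0.
have bp : beta * p = eta / 2 by rewrite beE; field; rewrite gt_eqF.
have be0 : 0 <= beta by rewrite beE divr_ge0 ?mulr_ge0// ltW.
have pk0 : 0 <= pk.
  by rewrite pkE mulr_ge0 ?(ltW p0)// addr_ge0// divr_ge0 ?mulr_ge0 ?ltW.
pose M := eta ^+ 2 * (4 * l) + S * (8 * Lf + 120 * lb)
  + alpha * (5 * (1 - delta) * (eta ^+ 2 * (4 * l)))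
  + pk * (4 * (g1 * Lf + g2 * lb)).
(* The four stepsize bounds contribute 64/3600, 160/229^2, 960/360^2 and (1088/3)/120^2, about
   0.0534 together, rounded up to 6/100. The term [4 * (eta * l)] is the sampling variance of the
   main step. *)
have hM : M <= eta * (4 * (eta * l) + 6 / 100).
  have e2 : S * (8 * Lf) = 64 * (eta * ((1 - delta) * eta ^+ 2 * Lf * Lf / delta ^+ 2)).
    by rewrite /S alE qE; field; rewrite gt_eqF.
  have e4 : S * (120 * lb) = 960 * (eta * ((1 - delta) * eta ^+ 2 * Lf * lb / delta ^+ 2)).
    by rewrite /S alE qE; field; rewrite gt_eqF.
  have e3 : alpha * (5 * (1 - delta) * (eta ^+ 2 * (4 * l))) =
      160 * (eta * ((1 - delta) * eta ^+ 2 * Lf * l / delta)).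
    by rewrite alE; field; rewrite gt_eqF.
  have e5 : pk * (4 * (g1 * Lf + g2 * lb)) <= 1088 / 3 *
    (eta * ((1 - delta) * eta ^+ 2 * Lf * (p * (1 + 2 * p / delta1) * (Lf + 12 * lb)) / (delta ^+ 2 * delta1))).
    (* As [g2 = 34 * g1], enlarging [g1 * Lf] to [17/6 * g1 * Lf] makes the combination a multiple
       of [Lf + 12 * lb], since 34 = 12 * 17/6. *)
    have -> : 1088 / 3 *
      (eta * ((1 - delta) * eta ^+ 2 * Lf * (p * (1 + 2 * p / delta1) * (Lf + 12 * lb)) / (delta ^+ 2 * delta1)))
      = pk * (4 * (17 / 6 * g1 * Lf + g2 * lb)).
      by rewrite g1E g2E alE qE pkE; field; rewrite !gt_eqF.
    have hg := mulr_ge0 g10 (ltW Lf0).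
    by apply: (ler_wpM2l pk0); rewrite -(mulrA (17 / 6)); clear - hg; lra.
  have k2 := ler_wpM2l (ltW eta0) C2.
  have k3 := ler_wpM2l (ltW eta0) C3.
  have k4 := ler_wpM2l (ltW eta0) C4.
  have k5 := ler_wpM2l (ltW eta0) C5.
  rewrite /M mulrDr e2 e4 e3.
  move: e5 k2 k3 k4 k5.
  set r5 := eta * (_ / (delta ^+ 2 * delta1)).
  set r2 := eta * (_ * Lf * Lf / _). set r3 := eta * (_ * l / _). set r4 := eta * (_ * lb / _).
  move: (ltW eta0); move: r2 r3 r4 r5; clear => r2 r3 r4 r5; lra.
clear C2 C3 C4 C5 qE alE g1E g2E beE pkE.
have fD : (1 - mu * eta / 2) * D <= (1 - rho) * D by rewrite ler_wpM2r//; lra.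
(* Three quarters of [alpha * delta = 8 * (eta * Lf)] is 6, enough for the 5 of the perturbation. *)
have fA : 5 * (eta * Lf) * A + alpha * ((1 - delta) * A) <= (1 - rho) * (alpha * A).
  have : 0 <= alpha * A * (delta / 4 - rho) by rewrite !mulr_ge0// subr_ge0.
  have : alpha * delta * A = 8 * (eta * Lf) * A by rewrite ald.
  have : 0 <= eta * Lf * A by rewrite !mulr_ge0// ltW.
  lra.
have fB : alpha * (4 * (1 - delta / 4) * B) <= (1 - rho) * (alpha * (4 * B)).
  have : 0 <= alpha * B * (delta / 4 - rho) by rewrite !mulr_ge0// subr_ge0.
  lra.
(* The squared factor leaves a full [delta1] of contraction; three quarters of [g1 * delta1 = 4 * S]
   covers [2 * S]. *)
have fH : g1 * ((1 + delta1 / 2) * ((1 - delta1) ^+ 2 * H)) + 2 * S * H <= (1 - rho) * (g1 * H).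
  have h1 : (1 + delta1 / 2) * (1 - delta1) ^+ 2 <= 1 - delta1 by nra.
  have gH0 : 0 <= g1 * H by rewrite mulr_ge0.
  have h2 := ler_wpM2l gH0 h1.
  have h3 : 0 <= g1 * H * (delta1 / 4 - rho) by rewrite mulr_ge0// subr_ge0.
  have h4 : g1 * delta1 * H = 4 * S * H by rewrite g1d.
  have h5 : 0 <= S * H by rewrite mulr_ge0.
  move: h2 h3 h4 h5; lra.
(* Only [delta1 / 2] of contraction here, of which [rho] takes half. The remaining
   [g2 * delta1 / 4 = 34 * S] is exactly 30 [S] from the errors plus 4 [S] from the averaged
   residual: the origin of 136. *)
have fJ : g1 * ((1 + delta1 / 2) * (delta1 * (1 - delta1) * J))
    + g2 * ((1 + delta1 / 2) * ((1 - delta1) * J)) + 30 * S * J <= (1 - rho) * (g2 * J).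
  have h1 : (1 + delta1 / 2) * (1 - delta1) <= 1 - delta1 / 2 by nra.
  have h2 := ler_wpM2l (mulr_ge0 g20 J0) h1.
  have h3 : 0 <= g2 * J * (delta1 / 4 - rho) by rewrite mulr_ge0 ?subr_ge0// mulr_ge0.
  have h4 : g2 * delta1 * J = 136 * S * J by rewrite g2d.
  have h5 : 0 <= S * J by rewrite mulr_ge0.
  have h6 : (1 + delta1 / 2) * (1 - delta1) <= 1 by lra.
  have h7 : 0 <= g1 * delta1 * J by rewrite g1d -mulrA mulr_ge0.
  have h8 := ler_wpM2l h7 h6.
  have h9 : g1 * delta1 * J = 4 * S * J by rewrite g1d.
  move: h2 h3 h4 h5 h8 h9; lra.
(* After [rho], three quarters of [beta * p = eta / 2] remain, hence the threshold 3/8 for [M]. *)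
have fFy : M * Fy + beta * ((1 - p) * Fy) <= (1 - rho) * (beta * Fy).
  have h1 : 0 <= beta * Fy * (p / 4 - rho) by rewrite mulr_ge0 ?subr_ge0// mulr_ge0.
  have h2 : beta * p * Fy = eta / 2 * Fy by rewrite bp.
  have h3 : M <= eta * (3 / 8).
    apply: le_trans hM _; rewrite ler_pM2l//.
    have := mulr_gt0 eta0 Lf0; lra.
  have h4 := ler_wpM2r Fy0 h3.
  move: h1 h2 h4; lra.
(* The budget is 3/2 - 1/2 - 2/5 = 3/5, less [2 * (eta * Lf)]. *)
have fFx : - (eta * (3 / 2 - 2 * (eta * Lf)) * Fx) + M * Fx + beta * (p * Fx)
    <= - (2 / 5 * eta * Fx).
  have h2 : beta * p * Fx = eta / 2 * Fx by rewrite bp.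
  have h3 : M <= eta * (3 / 5 - 2 * (eta * Lf)).
    apply: le_trans hM _; rewrite ler_pM2l//.
    have := mulr_ge0 (ltW eta0) l0; lra.
  have h4 := ler_wpM2r Fx0 h3.
  move: h2 h4; lra.
move: fD fA fB fH fJ fFy fFx.
rewrite /M /S; lra.
Qed.

End lyapunov_arith.

Section lyapunov.
Context (R : realType) (E : ec_lsvrg R).
Hypothesis HE : assumptions E.
Hypothesis L0 : 0 <= L E.
Hypothesis Lbar0 : 0 <= Lbar E.
Local Notation V := 'rV[R]_(dim E).
Local Notation xs := (xstar E).
Local Notation nR := ((n E)%:R : R).
Local Notation q := ((1 - delta E) / delta E).
Local Notation r5 := ((1 - delta E) * eta E ^+ 2 * Lf E * (p E * (1 + 2 * p E / delta1 E)
   * (Lf E + 12 * (Lbar E / nR))) / (delta E ^+ 2 * delta1 E)).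

Hypothesis C1 : 4 * (eta E * Lf E) + 33 * (eta E * (L E / nR)) <= 1.
Hypothesis C2 : (1 - delta E) * eta E ^+ 2 * Lf E * Lf E / delta E ^+ 2 <= 1 / 3600.
Hypothesis C3 : (1 - delta E) * eta E ^+ 2 * Lf E * (L E / nR) / delta E <= 1 / (229 * 229).
Hypothesis C4 : (1 - delta E) * eta E ^+ 2 * Lf E * (Lbar E / nR) / delta E ^+ 2 <= 1 / (360 * 360).
Hypothesis C5 : r5 <= 1 / (120 * 120).

Definition err_weight : R := 8 * (eta E * Lf E) / delta E.
Definition res_weight : R := 4 * (err_weight * q * eta E ^+ 2) / delta1 E.
Definition ress_weight : R := 136 * (err_weight * q * eta E ^+ 2) / delta1 E.

Definition lyapunov (s : state E) : R :=
  dist_part s + err_weight * (err_part s + 4 * errs_part s)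
  + res_weight * res_part s + ress_weight * ress_part s
  + eta E / (2 * p E) * gap (st_w s).

Let deltaP : 0 < delta E <= 1. Proof. by case: (Q_compressor HE). Qed.
Let delta1P : 0 < delta1 E <= 1. Proof. by case: (Q1_compressor HE). Qed.
Let pP : 0 < p E <= 1. Proof. exact: p_range HE. Qed.

Lemma err_weight_ge0 : 0 <= err_weight.
Proof.
have /andP[d0 d1] := deltaP.
by rewrite divr_ge0 ?(ltW d0)// !mulr_ge0 ?(ltW (eta_gt0 HE)) ?(ltW (Lf_gt0 HE)).
Qed.

Lemma ress_source_ge0 : 0 <= err_weight * q * eta E ^+ 2 / delta1 E.
Proof.
have /andP[d0 d1] := deltaP; have /andP[e0 e1] := delta1P.
rewrite divr_ge0 ?(ltW e0)// mulr_ge0 ?sqr_ge0// mulr_ge0 ?err_weight_ge0//.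
by rewrite divr_ge0 ?subr_ge0// ltW.
Qed.

Lemma res_weight_ge0 : 0 <= res_weight.
Proof. by rewrite /res_weight -mulrA mulr_ge0// ress_source_ge0. Qed.

Lemma ress_weight_ge0 : 0 <= ress_weight.
Proof. by rewrite /ress_weight -mulrA mulr_ge0// ress_source_ge0. Qed.

Lemma gap_weight_ge0 : 0 <= eta E / (2 * p E).
Proof.
have /andP[p0 p1] := pP.
by rewrite divr_ge0 ?mulr_ge0 ?(ltW (eta_gt0 HE)) ?(ltW p0).
Qed.

Lemma errs_part_ge0 (s : state E) : 0 <= errs_part s.
Proof. by rewrite mulr_ge0 ?sqr_ge0//; apply: sumr_ge0 => t _; exact: dot_ge0. Qed.

Lemma ress_part_ge0 (s : state E) : 0 <= ress_part s.
Proof. by rewrite mulr_ge0 ?sqr_ge0//; apply: sumr_ge0 => t _; exact: dot_ge0. Qed.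

Lemma lyapunov_ge0 s : 0 <= lyapunov s.
Proof.
have A0 : 0 <= err_part s := dot_ge0 _.
have H0 : 0 <= res_part s := dot_ge0 _.
have B0 := errs_part_ge0 s; have J0 := ress_part_ge0 s.
have F0 := gap_ge0 HE (st_w s).
have h1 := mulr_ge0 err_weight_ge0 (addr_ge0 A0 (mulr_ge0 (ler0n R 4) B0)).
have h2 := mulr_ge0 res_weight_ge0 H0; have h3 := mulr_ge0 ress_weight_ge0 J0.
have h4 := mulr_ge0 gap_weight_ge0 F0.
by rewrite /lyapunov !addr_ge0//; exact: dot_ge0.
Qed.

Lemma rhoP : [/\ rho E <= mu E * eta E / 2, rho E <= delta E / 4,
  rho E <= delta1 E / 4 & rho E <= p E / 4].
Proof.
rewrite /rho; set a := mu E * _ / 2; set b := delta E / 4; set c := delta1 E / 4.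
set d := p E / 4; by rewrite !ge_min !lexx !orbT.
Qed.

Lemma rho_ge0 : 0 <= rho E.
Proof.
have /andP[d0 d1] := deltaP; have /andP[e0 e1] := delta1P; have /andP[p0 p1] := pP.
rewrite /rho !le_min !divr_ge0 ?mulr_ge0 ?(mu_ge0 HE) ?(ltW (eta_gt0 HE))//; exact: ltW.
Qed.

Lemma one_sub_rho_gt0 : 0 < 1 - rho E.
Proof. have [_ _ _ h] := rhoP; have /andP[p0 p1] := pP; lra. Qed.

Lemma lyapunov_step k (s : state E) : st_h s = vmean (st_ht s) ->
  mean_le (P E) (fun w => lyapunov (step k w s))
    ((1 - rho E) * lyapunov s - 2 / 5 * eta E * gap (st_x s)).
Proof.
move=> hs.
have h1 := mean_dist_part HE L0 k hs.
have h2 := mean_leZ err_weight_ge0 (mean_err_parts HE L0 Lbar0 k hs).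
have h3 := mean_leZ res_weight_ge0 (mean_res_part HE k s).
have h4 := mean_leZ ress_weight_ge0 (mean_ress_part HE Lbar0 k s).
have h5 := mean_leZ gap_weight_ge0 (mean_gap_w HE k s).
have := mean_leD (mean_leD (mean_leD (mean_leD h1 h2) h3) h4) h5.
move/mean_leW; apply.
have [r1 r2 r3 r4] := rhoP.
have n0 : 0 <= nR by [].
by apply: lyapunov_arith => //; rewrite ?dot_ge0 ?errs_part_ge0 ?ress_part_ge0
  ?gap_ge0 ?divr_ge0// ?eta_gt0 ?Lf_gt0.
Qed.

Lemma measurable_lyapunov d0 (T : measurableType d0) (r : T -> state E) :
  state_measurable r -> measurable_fun setT (fun w => lyapunov (r w)).
Proof.
move=> [mx mw me mht mh].
have vme : vmeas (fun w => vmean (st_e (r w))) := vmeas_mean me.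
have vres t : vmeas (fun w => residual (r w) t).
  by apply: vmeasB => //; exact: vmeas_grad (fw_smooth HE t) mw.
have mZ (c : R) (f : T -> R) : measurable_fun setT f -> measurable_fun setT (fun w => c * f w).
  by move=> mf; apply: measurable_funM => //; exact: measurable_cst.
have mD (f g : T -> R) : measurable_fun setT f -> measurable_fun setT g ->
    measurable_fun setT (fun w => f w + g w).
  by move=> mf mg; exact: measurable_funD.
have vv : vmeas (fun w => virtual (r w)).
  by apply: vmeasB; [apply: vmeasB|exact: vmeas_cst].
apply: (mD); last first.
  apply: (mZ); apply: (mD); last exact: measurable_cst.
  exact: vmeas_continuous (smooth_continuous (fobj_smooth HE)) mw.
apply: (mD); last first.
  by apply: (mZ); apply: (mZ); apply: measurable_sum => t; exact: vmeas_dot.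
apply: (mD); last first.
  by apply: (mZ); apply: vmeas_dot; exact: vmeas_mean.
apply: (mD); first exact: vmeas_dot.
apply: (mZ); apply: (mD); first exact: vmeas_dot.
by apply: (mZ); apply: (mZ); apply: measurable_sum => t; exact: vmeas_dot.
Qed.

Lemma state_measurable_run_id k : state_measurable (run k : Omega E -> state E).
Proof.
by apply: (@state_measurable_run _ _ HE _ _ id) => i _; exact: draws_measurable_id.
Qed.

Lemma measurable_gap_iterate k :
  measurable_fun setT (fun w : Omega E => gap (iterate k w)).
Proof.
apply: measurable_funD; last exact: measurable_cst.
apply: vmeas_continuous (smooth_continuous (fobj_smooth HE)) _.
exact: vmeas_x (state_measurable_run_id k).
Qed.

(** The mean of the next value is nonnegative, so the one-step bound is too. This pointwise
    domination makes the gap integrable as soon as the Lyapunov function is. *)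
Lemma gap_le_lyapunov k (w : Omega E) :
  2 / 5 * eta E * gap (iterate k w) <= (1 - rho E) * lyapunov (run k w).
Proof.
have [ih hl] := lyapunov_step k (run_h k w).
rewrite -subr_ge0; apply: le_trans hl; apply: Rintegral_ge0 => w' _.
exact: lyapunov_ge0.
Qed.

Lemma rintegrable_gap k :
  rintegrable (P E) (fun w => lyapunov (run k w)) ->
  rintegrable (P E) (fun w => gap (iterate k w)).
Proof.
move=> il.
have c0 : 0 < 2 / 5 * eta E by rewrite mulr_gt0 ?(eta_gt0 HE).
apply: (rintegrable_dom (measurable_gap_iterate k)
  (rintegrableZ (2 / 5 * eta E)^-1 (rintegrableZ (1 - rho E) il))) => w.
rewrite ger0_norm ?gap_ge0// ler_pdivlMl//; exact: gap_le_lyapunov.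
Qed.

(** The bound is first proved for the extended integral, where nothing about step [k+1] is
    presupposed; its finiteness then provides integrability. *)
Lemma lyapunov_run_step k : rintegrable (P E) (fun w => lyapunov (run k w)) ->
  mean_le (P E) (fun w => lyapunov (run k.+1 w))
   ((1 - rho E) * \int[P E]_w lyapunov (run k w)
    - 2 / 5 * eta E * \int[P E]_w gap (iterate k w)).
Proof.
move=> il; have ig := rintegrable_gap il.
have iD := rintegrableD (rintegrableZ (1 - rho E) il) (rintegrableZ (- (2 / 5 * eta E)) ig).
have ml := measurable_lyapunov (state_measurable_run_id k.+1).
have h : (\int[P E]_w (lyapunov (run k.+1 w))%:E <=
   ((1 - rho E) * \int[P E]_w lyapunov (run k w)
    - 2 / 5 * eta E * \int[P E]_w gap (iterate k w))%:E)%E.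
  rewrite (run_mean_rec HE k lyapunov_ge0 measurable_lyapunov) -mulNr.
  rewrite -!meanZ// -meanD//; [|exact: rintegrableZ|exact: rintegrableZ].
  rewrite -rintegrable_fin//; apply: ge0_le_integral => //.
  - by move=> w _; apply: integral_ge0 => w' _; rewrite lee_fin lyapunov_ge0.
  - exact: (measurable_step_mean HE k lyapunov_ge0 measurable_lyapunov).
  - by case/integrableP: iD.
  - move=> w _; have [i1 h1] := lyapunov_step k (run_h k w).
    by rewrite rintegrable_fin// lee_fin mulNr.
have i1 : rintegrable (P E) (fun w => lyapunov (run k.+1 w)).
  apply/integrableP; split; first exact/measurable_EFinP.
  under eq_integral do rewrite /= ger0_norm ?lyapunov_ge0//.
  by apply: le_lt_trans h _; rewrite ltry.
by split => //; rewrite -lee_fin -rintegrable_fin.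
Qed.

Lemma lyapunov_run k : rintegrable (P E) (fun w => lyapunov (run k w)).
Proof.
elim: k => [|k IH]; first exact: (rintegrable_cst _ (lyapunov (init E))).
by case: (lyapunov_run_step IH).
Qed.

Lemma weight_gt0 k : 0 < weight E k.
Proof. by rewrite invr_gt0 exprn_gt0// one_sub_rho_gt0. Qed.

Lemma weightS k : (1 - rho E) * weight E k.+1 = weight E k.
Proof.
by rewrite /weight exprS invfM mulrA divff ?mul1r// gt_eqF// one_sub_rho_gt0.
Qed.

(** The one-step bounds, multiplied by [weight E k], telescope because
    [(1 - rho E) * weight E k.+1 = weight E k]. *)
Lemma weighted_gap_sum k :
  2 / 5 * eta E * (\sum_(i < k) weight E i * \int[P E]_w gap (iterate i w))
  + (1 - rho E) * weight E k * \int[P E]_w lyapunov (run k w)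
  <= (1 - rho E) * lyapunov (init E).
Proof.
elim: k => [|k IH].
  rewrite big_ord0 mulr0 add0r /weight expr0 invr1 mulr1.
  by rewrite (mean_cst (P E) (lyapunov (init E)) : \int[P E]_w lyapunov (run 0 w) = _).
apply: le_trans IH; rewrite big_ord_recr /= weightS mulrDr -addrA lerD2l.
have [_ h] := lyapunov_run_step (lyapunov_run k).
have := ler_wpM2l (ltW (weight_gt0 k)) h; lra.
Qed.

Lemma Weight_gt0 k : 0 < Weight E k.
Proof.
rewrite /Weight big_ord_recr /= ltr_wpDl ?weight_gt0//.
by apply: sumr_ge0 => i _; exact/ltW/weight_gt0.
Qed.

Lemma expected_gap_le_lyapunov k :
  (expected_gap E k <=
    ((Weight E k)^-1 * ((2 / 5 * eta E)^-1 * lyapunov (init E)))%:E)%E.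
Proof.
have c0 : 0 < 2 / 5 * eta E by rewrite mulr_gt0 ?(eta_gt0 HE).
have W0 := Weight_gt0 k.
rewrite /expected_gap unlock.
have ig i : rintegrable (P E) (fun w => gap (iterate i w)) := rintegrable_gap (lyapunov_run i).
have hsum : mean_le (P E) (fun w => (Weight E k)^-1 * \sum_(i < k.+1) weight E i * gap (iterate i w))
    ((Weight E k)^-1 * \sum_(i < k.+1) weight E i * \int[P E]_w gap (iterate i w)).
  apply: mean_leZ; first by rewrite invr_ge0 ltW.
  by apply: mean_le_sum => i; apply: mean_leZ; [exact/ltW/weight_gt0|split].
have vxbar : vmeas (xbar (E := E) k).
  apply: vmeasZ; apply: vmeas_sum => i; apply: vmeasZ.
  exact: vmeas_x (state_measurable_run_id i).
have mxbar : measurable_fun setT (fun w => gap (xbar (E := E) k w)).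
  apply: measurable_funD; last exact: measurable_cst.
  exact: vmeas_continuous (smooth_continuous (fobj_smooth HE)) vxbar.
have jensen (w : Omega E) : 0 <= gap (xbar k w) <=
    (Weight E k)^-1 * \sum_(i < k.+1) weight E i * gap (iterate i w).
  rewrite gap_ge0//=.
  have a0 (i : 'I_k.+1) : 0 <= (Weight E k)^-1 * weight E i.
    by apply: mulr_ge0; [rewrite invr_ge0; exact: ltW|exact/ltW/weight_gt0].
  have a1 : \sum_(i < k.+1) (Weight E k)^-1 * weight E i = 1.
    by rewrite -mulr_sumr mulVf// gt_eqF.
  have := jensen_gradient_convex (fun i : 'I_k.+1 => iterate i w)
    (fobj_gradient_convex HE) a0 a1.
  have -> : \sum_(i < k.+1) ((Weight E k)^-1 * weight E i) *: iterate i w = xbar k w.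
    by rewrite /xbar scaler_sumr; apply: eq_bigr => i _; rewrite scalerA.
  move=> h; rewrite /gap lerBlDr; apply: le_trans h _.
  rewrite mulr_sumr -[X in _ + X]mul1r -a1 mulr_suml -big_split /=.
  by apply: ler_sum => i _; lra.
have [ix hx] := mean_le_dom mxbar jensen hsum.
rewrite [leLHS](rintegrable_fin ix) lee_fin; apply: le_trans hx _.
rewrite ler_wpM2l ?invr_ge0 ?(ltW W0)// ler_pdivlMl//.
have := weighted_gap_sum k.+1.
have h1 : 0 <= (1 - rho E) * weight E k.+1 * \int[P E]_w lyapunov (run k.+1 w).
  rewrite !mulr_ge0 ?(ltW one_sub_rho_gt0) ?(ltW (weight_gt0 _))//.
  by apply: Rintegral_ge0 => w _; exact: lyapunov_ge0.
have h2 : (1 - rho E) * lyapunov (init E) <= lyapunov (init E).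
  by rewrite ler_piMl ?lyapunov_ge0// gerBl rho_ge0.
lra.
Qed.

Lemma lyapunov_init :
  (2 / 5 * eta E)^-1 * lyapunov (init E) <=
    5 / (2 * eta E) * dist0 E + 1 / (5 * Lf E * p E * nR) * gradgap0 E
    + 5 / (4 * p E) * fgap0 E.
Proof.
have /andP[d0 d1] := deltaP; have /andP[e0 e1] := delta1P; have /andP[p0 p1] := pP.
have eta0 := eta_gt0 HE; have Lf0 := Lf_gt0 HE.
have n1 := n_gt0 HE; have n0 : 0 < nR by rewrite ltr0n.
have z0 : vmean (st_e (init E)) = 0 by rewrite /vmean /= big1 ?scaler0.
have eD : dist_part (init E) = dist0 E.
  by rewrite /dist_part /virtual z0 subr0 /dist0 enorm_sq.
have eA : err_part (init E) = 0 by rewrite /err_part z0 dot0l.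
have eB : errs_part (init E) = 0.
  by rewrite /errs_part /= big1 ?mulr0// => t _; rewrite dot0l.
have gE : gradgap0 E = \sum_t dot (residual (init E) t) (residual (init E) t).
  by apply: eq_bigr => t _; rewrite enorm_sq.
have eH : res_part (init E) <= nR^-1 * gradgap0 E by rewrite gE; exact: dot_vmean_le.
have eJ : ress_part (init E) <= nR^-1 * gradgap0 E.
  rewrite /ress_part -gE ler_wpM2r//.
    by rewrite gE; apply: sumr_ge0 => t _; exact: dot_ge0.
  by rewrite expr2 ler_piMl ?invr_ge0 ?(ltW n0)// invf_le1 ?ler1n.
have G0 : 0 <= nR^-1 * gradgap0 E.
  by rewrite mulr_ge0 ?invr_ge0// gE; apply: sumr_ge0 => t _; exact: dot_ge0.
rewrite /lyapunov eD eA eB mulr0 addr0 mulr0 addr0 /=.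
have -> : (2 / 5 * eta E)^-1 * (dist0 E + res_weight * res_part (init E)
    + ress_weight * ress_part (init E) + eta E / (2 * p E) * gap (x0 E)) =
   5 / (2 * eta E) * dist0 E + 5 / (2 * eta E) * (res_weight * res_part (init E)
    + ress_weight * ress_part (init E)) + 5 / (4 * p E) * fgap0 E.
  by rewrite /fgap0 -/(gap (x0 E)); field; rewrite !gt_eqF.
rewrite lerD2r lerD2l.
(* The two weights add up to 140 times a common term; with the other factors, 140 * 8 * 5/2 * 5 =
   14000, below the 120 * 120 of [C5]. *)
have hw : 5 / (2 * eta E) * (res_weight + ress_weight) <= 1 / (5 * Lf E * p E).
  rewrite ler_pdivlMr ?mulr_gt0//.
  pose b := (1 - delta E) * eta E ^+ 2 * Lf E / (delta E ^+ 2 * delta1 E).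
  have b0 : 0 <= b.
    apply: divr_ge0; last by rewrite mulr_ge0 ?sqr_ge0// ltW.
    by apply: mulr_ge0 (ltW Lf0); rewrite mulr_ge0 ?sqr_ge0// subr_ge0.
  have c5 : b * (p E * Lf E) <= 1 / (120 * 120).
    apply: le_trans C5; rewrite [leRHS](_ : _ = b * (p E * (1 + 2 * p E / delta1 E)
       * (Lf E + 12 * (Lbar E / nR)))); last by rewrite /b; ring.
    apply: (ler_wpM2l b0); apply: ler_pM; [exact: ltW|exact: ltW| |].
      by rewrite ler_peMr ?(ltW p0)// lerDl divr_ge0 ?mulr_ge0 ?ltW.
    by rewrite lerDl mulr_ge0// divr_ge0// ltW.
  have -> : 5 / (2 * eta E) * (res_weight + ress_weight) * (5 * Lf E * p E)
    = 14000 * (b * (p E * Lf E)).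
    by rewrite /res_weight /ress_weight /err_weight /b; field; rewrite !gt_eqF.
  lra.
have -> : 1 / (5 * Lf E * p E * nR) * gradgap0 E = 1 / (5 * Lf E * p E) * (nR^-1 * gradgap0 E).
  by field; rewrite !gt_eqF.
apply: le_trans (ler_wpM2r G0 hw); rewrite -[leRHS]mulrA.
apply: ler_wpM2l; first by rewrite divr_ge0 ?mulr_ge0 ?ltW.
rewrite mulrDl lerD// ler_wpM2l//; [exact: res_weight_ge0|exact: ress_weight_ge0].
Qed.

End lyapunov.

(** * Stepsize and rates *)

Section ereal_division.
Variable R : realType.

(** For [b = 0] the quotient carries no constraint and the conclusion reads [0 <= a]; the product
    form covers both cases. *)
Lemma le_ereal_div (e a b : R) : 0 <= a -> 0 <= b ->
  (e%:E <= a%:E / b%:E)%E -> e * b <= a.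
Proof.
move=> a0 b0; have [->|bn0] := eqVneq b 0; first by rewrite mulr0.
by rewrite inver (negbTE bn0) -EFinM lee_fin ler_pdivlMr// lt_def bn0.
Qed.

(** A finite [e] excludes [b = 0], where the quotient would be infinite. *)
Lemma eq_ereal_div (e a b : R) : 0 < a ->
  e%:E = (a%:E / b%:E)%E -> e * b = a.
Proof.
move=> a0; have [->|bn0] := eqVneq b 0.
  by rewrite inver eqxx gt0_muley// lte_fin.
by rewrite inver (negbTE bn0) -EFinM => -[->]; rewrite mulfVK.
Qed.

End ereal_division.

Section stepsize.
Context (R : realType) (E : ec_lsvrg R).
Hypothesis HE : assumptions E.
Hypothesis L0 : 0 <= L E.
Hypothesis Lbar0 : 0 <= Lbar E.
Local Notation nR := ((n E)%:R : R).
Local Notation d := (delta E).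
Local Notation d1 := (delta1 E).

Let n0 : 0 < nR. Proof. by rewrite ltr0n; exact: n_gt0. Qed.
Let d01 : 0 < d <= 1. Proof. by case: (Q_compressor HE). Qed.
Let d11 : 0 < d1 <= 1. Proof. by case: (Q1_compressor HE). Qed.
Let p01 : 0 < p E <= 1. Proof. exact: p_range HE. Qed.
Let eta0 : 0 < eta E. Proof. exact: eta_gt0 HE. Qed.
Let Lf0 : 0 < Lf E. Proof. exact: Lf_gt0 HE. Qed.

Let X5 := (1 - d) * p E * Lf E * (Lf E + 12 * Lbar E / nR) * (1 + 2 * p E / d1).

Let d1' : 0 <= 1 - d. Proof. by have /andP[_ ?] := d01; rewrite subr_ge0. Qed.

Let X5_ge0 : 0 <= X5.
Proof.
have /andP[p0 _] := p01; have /andP[e0 _] := d11.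
have h : 0 <= 12 * Lbar E / nR by rewrite divr_ge0 ?mulr_ge0// ltW.
have h2 : 0 <= 2 * p E / d1 by rewrite divr_ge0 ?mulr_ge0// ltW.
rewrite /X5; apply: mulr_ge0; last by rewrite addr_ge0.
apply: mulr_ge0; last by rewrite addr_ge0// ltW.
by apply: mulr_ge0 (ltW Lf0); apply: mulr_ge0 (ltW p0).
Qed.

(** The last four entries of the minimum are squared, which removes the square roots and leaves
    bounds polynomial in [eta]. *)
Lemma stepsize_bounds : ((eta E)%:E <= eta_max E)%E ->
  [/\ 4 * (eta E * Lf E) + 33 * (eta E * (L E / nR)) <= 1,
   (1 - d) * eta E ^+ 2 * Lf E * Lf E / d ^+ 2 <= 1 / 3600,
   (1 - d) * eta E ^+ 2 * Lf E * (L E / nR) / d <= 1 / (229 * 229),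
   (1 - d) * eta E ^+ 2 * Lf E * (Lbar E / nR) / d ^+ 2 <= 1 / (360 * 360) &
   (1 - d) * eta E ^+ 2 * Lf E * (p E * (1 + 2 * p E / d1)
     * (Lf E + 12 * (Lbar E / nR))) / (d ^+ 2 * d1) <= 1 / (120 * 120)].
Proof.
have /andP[dp dl] := d01; have /andP[e0 e1] := d11; have /andP[p0 p1] := p01.
have sq (x y : R) : 0 <= x -> x <= y -> x ^+ 2 <= y ^+ 2.
  by move=> x0 xy; rewrite ler_pXn2r// nnegrE// (le_trans x0).
have LfL0 : 0 <= (1 - d) * Lf E * L E by rewrite !mulr_ge0// ltW.
have LfLbar0 : 0 <= (1 - d) * Lf E * Lbar E by rewrite !mulr_ge0// ltW.
rewrite /eta_max !le_min => /and5P[h1 h2 h3 h4 h5].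
have {}h1 : eta E * (4 * Lf E + 33 * L E / nR) <= 1.
  apply: le_ereal_div h1 => //.
  by rewrite addr_ge0 ?divr_ge0 ?mulr_ge0 ?(ltW Lf0) ?(ltW n0).
have {}h2 : eta E * (60 * Num.sqrt (1 - d) * Lf E) <= d.
  by apply: le_ereal_div h2; rewrite ?mulr_ge0 ?sqrtr_ge0// ltW.
have {}h3 : eta E * (229 * Num.sqrt ((1 - d) * Lf E * L E)) <= Num.sqrt (nR * d).
  exact: le_ereal_div (sqrtr_ge0 _) (mulr_ge0 (ler0n _ _) (sqrtr_ge0 _)) h3.
have {}h4 : eta E * (360 * Num.sqrt ((1 - d) * Lf E * Lbar E)) <= Num.sqrt nR * d.
  apply: le_ereal_div _ (mulr_ge0 (ler0n _ _) (sqrtr_ge0 _)) h4.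
  exact: mulr_ge0 (sqrtr_ge0 _) (ltW dp).
have {}h5 : eta E * (120 * Num.sqrt X5) <= d * Num.sqrt d1.
  apply: le_ereal_div _ (mulr_ge0 (ler0n _ _) (sqrtr_ge0 _)) h5.
  exact: mulr_ge0 (ltW dp) (sqrtr_ge0 _).
split.
- by apply: le_trans h1; rewrite [leRHS](_ : _ = 4 * (eta E * Lf E) + 33 * (eta E * (L E / nR)))//; ring.
- have := sq _ _ _ h2; rewrite ?mulr_ge0 ?sqrtr_ge0 ?(ltW eta0) ?(ltW Lf0)// => /(_ isT).
  rewrite !exprMn sqr_sqrtr// => h.
  rewrite ler_pdivrMr ?exprn_gt0//; lra.
- have := sq _ _ (mulr_ge0 (ltW eta0) (mulr_ge0 (ler0n _ _) (sqrtr_ge0 _))) h3.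
  rewrite !exprMn !sqr_sqrtr// ?mulr_ge0 ?(ltW n0) ?(ltW dp)// => h.
  rewrite ler_pdivrMr// -(ler_pM2r n0).
  rewrite [leLHS](_ : _ = (1 - d) * eta E ^+ 2 * Lf E * L E); last by field; rewrite gt_eqF.
  lra.
- have := sq _ _ (mulr_ge0 (ltW eta0) (mulr_ge0 (ler0n _ _) (sqrtr_ge0 _))) h4.
  rewrite !exprMn !sqr_sqrtr// ?(ltW n0)// => h.
  rewrite ler_pdivrMr ?exprn_gt0// -(ler_pM2r n0).
  rewrite [leLHS](_ : _ = (1 - d) * eta E ^+ 2 * Lf E * Lbar E); last by field; rewrite gt_eqF.
  lra.
- have := sq _ _ (mulr_ge0 (ltW eta0) (mulr_ge0 (ler0n _ _) (sqrtr_ge0 _))) h5.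
  rewrite !exprMn !sqr_sqrtr// ?(ltW e0)// => h.
  rewrite ler_pdivrMr ?mulr_gt0 ?exprn_gt0//.
  rewrite [leLHS](_ : _ = eta E ^+ 2 * X5); last by rewrite /X5; ring.
  move: h; move: X5 => X; lra.
Qed.

(* [1 / eta_max] up to a constant, once p = O(delta1) and Lbar <= n Lf. *)
Definition inv_stepsize : R := Lf E + L E / nR + Num.sqrt (1 - d) * Lf E / d.

(** [eta] equals one of the five quotients [a / b], and in each case [b] is at most a constant times
    [inv_stepsize * a]; the constant of the statement dominates all five. *)
Lemma stepsize_lower (C : R) : Lbar E <= nR * Lf E -> p E <= C * d1 ->
  (eta E)%:E = eta_max E ->
  1 <= eta E * ((360 + 120 * Num.sqrt (13 * C * (1 + 2 * C))) * inv_stepsize).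
Proof.
move=> hLbar hp.
have /andP[dp dl] := d01; have /andP[e0 e1] := d11; have /andP[p0 p1] := p01.
have C0 : 0 < C by rewrite -(pmulr_lgt0 _ e0) (lt_le_trans p0).
set c5 := Num.sqrt (13 * C * _); set T := inv_stepsize.
have c50 : 0 <= c5 by rewrite sqrtr_ge0.
set sd := Num.sqrt (1 - d); have sd0 : 0 <= sd by rewrite sqrtr_ge0.
have sdsq : sd ^+ 2 = 1 - d by rewrite sqr_sqrtr.
have l0 : 0 <= L E / nR by rewrite divr_ge0// ltW.
have v0 : 0 <= sd * Lf E / d by rewrite divr_ge0 ?mulr_ge0// ltW.
have TE : T = Lf E + L E / nR + sd * Lf E / d by [].
have T0 : 0 <= T by rewrite TE !addr_ge0// ltW.
have Td : sd * Lf E <= T * d.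
  by rewrite -ler_pdivrMr// TE; have := Lf0; lra.
have key (a b c : R) : 0 < a -> 0 <= c -> c <= 360 + 120 * c5 -> b <= c * T * a ->
    (eta E)%:E = (a%:E / b%:E)%E -> 1 <= eta E * ((360 + 120 * c5) * T).
  move=> a0 c0 cM bT /(eq_ereal_div a0) h.
  have h1 := ler_wpM2l (ltW eta0) bT; rewrite h in h1.
  have : 1 <= eta E * (c * T) by rewrite -(ler_pM2r a0) mul1r; lra.
  move/le_trans; apply; rewrite ler_wpM2l ?(ltW eta0)// ler_wpM2r//.
have sqle (x y : R) : 0 <= y -> x <= y ^+ 2 -> Num.sqrt x <= y.
  by move=> y0 xy; rewrite -[leRHS](ger0_norm y0) -sqrtr_sqr; exact: ler_wsqrtr.
have mincases (x y z : \bar R) : z = Order.min x y -> z = x \/ z = y.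
  by rewrite minEle; case: ifP => _; [left|right].
have b1 : 4 * Lf E + 33 * L E / nR <= 33 * T * 1.
  by rewrite TE; have := Lf0; lra.
have b2 : 60 * sd * Lf E <= 60 * T * d by have := Td; lra.
have b3 : 229 * Num.sqrt ((1 - d) * Lf E * L E) <= 120 * T * Num.sqrt (nR * d).
  (* The arithmetic-geometric mean inequality for [u] and [v], whose sum is at most [T] because
     [1 - d <= sqrt (1 - d)]. This absorbs the third entry into the others. *)
  have s3 : Num.sqrt ((1 - d) * Lf E * L E) <= T / 2 * Num.sqrt (nR * d).
    apply: sqle; first by rewrite mulr_ge0 ?divr_ge0 ?sqrtr_ge0.
    rewrite exprMn sqr_sqrtr; last by rewrite mulr_ge0 ?ltW.
    pose u := (1 - d) * Lf E / d; pose v := L E / nR.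
    have uT : u <= sd * Lf E / d.
      rewrite /u -sdsq ler_wpM2r ?invr_ge0 ?(ltW dp)// ler_wpM2r ?(ltW Lf0)//.
      rewrite expr2 ler_piMr// -sqrtr1 ler_wsqrtr// lerBlDr lerDl ltW//.
    have u0 : 0 <= u by rewrite /u divr_ge0 ?mulr_ge0// ltW.
    have -> : (1 - d) * Lf E * L E = u * v * (nR * d).
      by rewrite /u /v; field; rewrite !gt_eqF.
    rewrite ler_wpM2r ?mulr_ge0 ?(ltW n0) ?(ltW dp)//.
    have uvT : u + v <= T by rewrite TE /v; have := Lf0; lra.
    have : (u + v) ^+ 2 <= T ^+ 2 by rewrite ler_pXn2r// nnegrE ?addr_ge0.
    have := sqr_ge0 (u - v); rewrite exprMn; move: u v {uT u0 uvT} => u v; lra.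
  have : 0 <= T * Num.sqrt (nR * d) by rewrite mulr_ge0// sqrtr_ge0.
  lra.
have b4 : 360 * Num.sqrt ((1 - d) * Lf E * Lbar E) <= 360 * T * (Num.sqrt nR * d).
  rewrite -[leRHS]mulrA; apply: (ler_wpM2l (ler0n R 360)); apply: sqle.
    by rewrite !mulr_ge0 ?sqrtr_ge0// ltW.
  rewrite (_ : T * (Num.sqrt nR * d) = Num.sqrt nR * (T * d)); last by ring.
  rewrite exprMn sqr_sqrtr ?(ltW n0)//.
  apply: (@le_trans _ _ (nR * (sd * Lf E) ^+ 2)).
    rewrite exprMn sdsq.
    rewrite (_ : nR * ((1 - d) * Lf E ^+ 2) = (1 - d) * Lf E * (nR * Lf E)); last by ring.
    by rewrite ler_wpM2l// mulr_ge0// ltW.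
  rewrite ler_wpM2l ?(ltW n0)// ler_pXn2r// nnegrE mulr_ge0// ltW//.
(* In [X5], [p <= C * d1] bounds [p] and gives [1 + 2 * C], while [Lbar <= n Lf] gives [13 * Lf]:
   the two sources of [c5]. *)
have b5 : 120 * Num.sqrt X5 <= (120 * c5) * T * (d * Num.sqrt d1).
  rewrite -!(mulrA 120); apply: (ler_wpM2l (ler0n R 120)); apply: sqle.
    by rewrite !mulr_ge0 ?sqrtr_ge0// ltW.
  rewrite (_ : c5 * T * (d * Num.sqrt d1) = c5 * Num.sqrt d1 * (T * d)); last by ring.
  have cc0 : 0 <= 13 * C * (1 + 2 * C) by rewrite !mulr_ge0 ?addr_ge0 ?mulr_ge0 ?ltW.
  rewrite exprMn [X in X * _]exprMn !sqr_sqrtr ?(ltW e0)//.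
  apply: (@le_trans _ _ (13 * C * (1 + 2 * C) * d1 * (sd * Lf E) ^+ 2)); last first.
    apply: (ler_wpM2l (mulr_ge0 cc0 (ltW e0))).
    by rewrite ler_pXn2r// nnegrE mulr_ge0// ltW.
  rewrite exprMn sdsq /X5.
  have k1 : 1 + 2 * p E / d1 <= 1 + 2 * C.
    by rewrite lerD2l ler_pdivrMr// -mulrA ler_wpM2l.
  have k2 : Lf E + 12 * Lbar E / nR <= 13 * Lf E.
    have : 12 * Lbar E / nR <= 12 * Lf E.
      by rewrite ler_pdivrMr// -mulrA ler_wpM2l// mulrC.
    lra.
  have k20 : 0 <= Lf E + 12 * Lbar E / nR.
    by rewrite addr_ge0 ?(ltW Lf0)// divr_ge0 ?mulr_ge0// ltW.
  have k10 : 0 <= 1 + 2 * p E / d1 by rewrite addr_ge0// divr_ge0 ?mulr_ge0 ?ltW.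
  rewrite (_ : 13 * C * (1 + 2 * C) * d1 * ((1 - d) * Lf E ^+ 2) =
     (1 - d) * (C * d1) * Lf E * (13 * Lf E) * (1 + 2 * C)); last by ring.
  have q0 : 0 <= (1 - d) * p E by rewrite mulr_ge0 ?(ltW p0).
  have q1 : (1 - d) * p E <= (1 - d) * (C * d1) by rewrite ler_wpM2l.
  have q2 := mulr_ge0 q0 (ltW Lf0).
  apply: (ler_pM (mulr_ge0 q2 k20) k10 _ k1); apply: (ler_pM q2 k20 _ k2).
  by rewrite ler_wpM2r ?(ltW Lf0).
rewrite /eta_max -/sd -/X5.
case/mincases => [|/mincases [|/mincases [|/mincases [|]]]]; move=> h.
- by apply: key b1 h; rewrite ?ltr01//; lra.
- by apply: key b2 h => //; lra.
- by apply: key b3 h => //; rewrite ?sqrtr_gt0 ?mulr_gt0//; lra.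
- apply: key b4 h; [by rewrite mulr_gt0 ?sqrtr_gt0|exact: ler0n|].
  by rewrite lerDl mulr_ge0.
- by apply: key b5 h; rewrite ?mulr_gt0 ?sqrtr_gt0 ?mulr_ge0//; lra.
Qed.

End stepsize.

(** * Rates in the strongly convex and convex cases *)

Section rates.
Context (R : realType) (E : ec_lsvrg R).
Hypothesis HE : assumptions E.
Local Notation nR := ((n E)%:R : R).

Let n0 : 0 < nR. Proof. by rewrite ltr0n; exact: n_gt0. Qed.
Let d01 : 0 < delta E <= 1. Proof. by case: (Q_compressor HE). Qed.
Let d11 : 0 < delta1 E <= 1. Proof. by case: (Q1_compressor HE). Qed.
Let p01 : 0 < p E <= 1. Proof. exact: p_range HE. Qed.
Let eta0 : 0 < eta E. Proof. exact: eta_gt0 HE. Qed.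
Let Lf0 : 0 < Lf E. Proof. exact: Lf_gt0 HE. Qed.

Lemma dist0_ge0 : 0 <= dist0 E. Proof. exact: sqr_ge0. Qed.

Lemma gradgap0_ge0 : 0 <= gradgap0 E.
Proof. by apply: sumr_ge0 => t _; exact: sqr_ge0. Qed.

Lemma fgap0_ge0 : 0 <= fgap0 E.
Proof. by rewrite subr_ge0; exact: xstar_optimal. Qed.

Definition potential0 : R :=
  5 / (2 * eta E) * dist0 E + 1 / (5 * Lf E * p E * nR) * gradgap0 E
  + 5 / (4 * p E) * fgap0 E.

Lemma potential0_ge0 : 0 <= potential0.
Proof.
have /andP[p0 _] := p01.
rewrite /potential0 !addr_ge0// mulr_ge0 ?dist0_ge0 ?gradgap0_ge0 ?fgap0_ge0//;
  by rewrite divr_ge0// !mulr_ge0// ltW.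
Qed.

(** Separate treatment of the case in which [L] and [Lbar] may be negative. *)
Lemma expected_gap_dim0 k : dim E = 0%N -> expected_gap E k = 0%E.
Proof.
move=> d0; rewrite /expected_gap (_ : (fun om => _) = cst 0).
  exact: (expectation_cst (P E)).
apply/funext => om /=; rewrite (_ : xbar k om = xstar E) ?subrr//.
by apply/rowP => j; have := ltn_ord j; rewrite {2}d0.
Qed.

Lemma expected_gap_le k : ((eta E)%:E <= eta_max E)%E ->
  (expected_gap E k <= ((Weight E k)^-1 * potential0)%:E)%E.
Proof.
move=> h; have W0 := Weight_gt0 HE k.
have [d0|] := eqVneq (dim E) 0%N.
  by rewrite expected_gap_dim0// lee_fin mulr_ge0 ?potential0_ge0// invr_ge0 ltW.
rewrite -lt0n => d0.
have t0 : 'I_(n E) := Ordinal (n_gt0 HE); have i0 : 'I_(m E) := Ordinal (m_gt0 HE).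
have L0 : 0 <= L E := smooth_ge0 d0 (fi_smooth HE t0 i0).
have Lbar0 : 0 <= Lbar E := smooth_ge0 d0 (fw_smooth HE t0).
have [C1 C2 C3 C4 C5] := stepsize_bounds HE L0 Lbar0 h.
apply: le_trans (expected_gap_le_lyapunov HE L0 Lbar0 C1 C2 C3 C4 C5 k) _.
rewrite lee_fin ler_wpM2l ?invr_ge0 ?(ltW W0)//.
exact: lyapunov_init.
Qed.

Lemma Weight_geometric k :
  rho E * Weight E k = (1 - rho E) ^- k * (1 - (1 - rho E) ^+ k.+1).
Proof.
have r0 : 1 - rho E != 0 by rewrite gt_eqF// one_sub_rho_gt0.
elim: k => [|k IH].
  by rewrite /Weight big_ord1 /weight expr0 expr1 invr1; ring.
have -> : Weight E k.+1 = Weight E k + weight E k.+1 by rewrite /Weight big_ord_recr.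
rewrite mulrDr IH /weight !exprS.
have := expf_neq0 k r0; move: (_ ^+ k) => a a0.
by field; rewrite a0 r0.
Qed.

Lemma rho_gt0 : 0 < mu E -> 0 < rho E.
Proof.
move=> mu0; have /andP[? _] := d01; have /andP[? _] := d11; have /andP[? _] := p01.
by rewrite /rho !lt_min !divr_gt0// mulr_gt0.
Qed.

Lemma expected_gap_strongly_convex k : ((eta E)%:E <= eta_max E)%E -> 0 < mu E ->
  (expected_gap E k <=
     ((18 * mu E * dist0 E + 2 / (Lf E * nR) * gradgap0 E + 5 * fgap0 E)
      / (1 - (1 - rho E) ^+ k.+1) * (1 - rho E) ^+ k)%:E)%E.
Proof.
move=> h mu0; apply: le_trans (expected_gap_le k h) _; rewrite lee_fin.
have r0 := rho_gt0 mu0; have r1 := one_sub_rho_gt0 HE.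
have [rmu _ _ rp] := rhoP E; have /andP[p0 _] := p01.
have q0 : 0 < (1 - rho E) ^+ k by rewrite exprn_gt0.
have q1 : (1 - rho E) ^+ k.+1 < 1.
  by rewrite exprn_ilt1// ?(ltW r1)// gtrBl.
have Q0 : 0 < 1 - (1 - rho E) ^+ k.+1 by rewrite subr_gt0.
have WE : (Weight E k)^-1 = rho E / (1 - (1 - rho E) ^+ k.+1) * (1 - rho E) ^+ k.
  have := Weight_geometric k; move=> hW.
  have -> : Weight E k = (1 - rho E) ^- k * (1 - (1 - rho E) ^+ k.+1) / rho E.
    by rewrite -hW mulrC mulKf// gt_eqF.
  rewrite invf_div invfM invrK; move: Q0; set Q := 1 - _ ^+ k.+1 => Q0.
  by field; rewrite gt_eqF.
rewrite WE mulrAC; apply: (ler_wpM2r (ltW q0)).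
rewrite mulrAC; apply: ler_wpM2r; first by rewrite invr_ge0 ltW.
have D0 := dist0_ge0; have G0 := gradgap0_ge0; have F0 := fgap0_ge0.
(* The factor [rho] from the geometric sum cancels [1 / eta] through [rho <= mu * eta / 2] and
   [1 / p] through [rho <= p / 4]. The constants obtained, 5/4, 1/20 and 5/16, lie below 18, 2 and
   5. *)
rewrite /potential0 mulrDr [X in X + _]mulrDr; apply: lerD; first apply: lerD.
- have -> : rho E * (5 / (2 * eta E) * dist0 E) = rho E * (5 / (2 * eta E)) * dist0 E.
    by rewrite mulrA.
  apply: (ler_wpM2r D0); apply: le_trans (ler_wpM2r _ rmu) _.
    by rewrite divr_ge0 ?mulr_ge0 ?ltW.
  have -> : mu E * eta E / 2 * (5 / (2 * eta E)) = 5 / 4 * mu E.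
    by field; rewrite gt_eqF.
  by move: mu0; lra.
- rewrite mulrA; apply: (ler_wpM2r G0); apply: le_trans (ler_wpM2r _ rp) _.
    by rewrite divr_ge0 ?mulr_ge0 ?ltW.
  have -> : p E / 4 * (1 / (5 * Lf E * p E * nR)) = 1 / 20 * (Lf E * nR)^-1.
    by field; rewrite !gt_eqF.
  have : 0 <= (Lf E * nR)^-1 by rewrite invr_ge0 mulr_ge0 ?ltW.
  by move: (_^-1); move=> x; lra.
- rewrite mulrA; apply: (ler_wpM2r F0); apply: le_trans (ler_wpM2r _ rp) _.
    by rewrite divr_ge0 ?mulr_ge0 ?ltW.
  have -> : p E / 4 * (5 / (4 * p E)) = 5 / 16 by field; rewrite gt_eqF.
  by lra.
Qed.

Lemma expected_gap_convex k : ((eta E)%:E <= eta_max E)%E -> mu E = 0 ->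
  (expected_gap E k <=
     (k.+1%:R^-1 * (36 / eta E * dist0 E + 6 / (Lf E * p E * nR) * gradgap0 E
           + 18 / p E * fgap0 E))%:E)%E.
Proof.
move=> h mu0; apply: le_trans (expected_gap_le k h) _; rewrite lee_fin.
have /andP[p0 _] := p01.
(* With [mu = 0] the minimum defining [rho] is 0, all weights are 1 and their sum is [k+1]. *)
have r0 : rho E = 0.
  apply/eqP; rewrite eq_le rho_ge0// andbT.
  by have [+ _ _ _] := rhoP E; rewrite mu0 mul0r mul0r.
have -> : Weight E k = k.+1%:R.
  rewrite /Weight (eq_bigr (fun=> 1)) => [|i _].
    by rewrite sumr_const card_ord.
  by rewrite /weight r0 subr0 expr1n invr1.
apply: ler_wpM2l; first by rewrite invr_ge0.
have D0 := dist0_ge0; have G0 := gradgap0_ge0; have F0 := fgap0_ge0.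
have le_scaled (a b y : R) : 0 < y -> a <= b -> a / y <= b / y.
  by move=> y0 ab; rewrite ler_wpM2r// invr_ge0 ltW.
rewrite /potential0; apply: lerD; first apply: lerD.
- apply: (ler_wpM2r D0); have -> : 5 / (2 * eta E) = 5 / 2 / eta E.
    by field; rewrite gt_eqF.
  by apply: le_scaled => //; lra.
- apply: (ler_wpM2r G0); have -> : 1 / (5 * Lf E * p E * nR) = 1 / 5 / (Lf E * p E * nR).
    by field; rewrite !gt_eqF.
  by apply: le_scaled; [rewrite !mulr_gt0|lra].
- apply: (ler_wpM2r F0); have -> : 5 / (4 * p E) = 5 / 4 / p E.
    by field; rewrite gt_eqF.
  by apply: le_scaled => //; lra.
Qed.

Definition stepsize_const (C : R) : R := 360 + 120 * Num.sqrt (13 * C * (1 + 2 * C)).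

Lemma stepsize_const_ge0 C : 0 <= stepsize_const C.
Proof. exact: addr_ge0 (ler0n _ _) (mulr_ge0 (ler0n _ _) (sqrtr_ge0 _)). Qed.

Hypothesis dim0 : (0 < dim E)%N.

Let L0 : 0 <= L E.
Proof. exact: smooth_ge0 dim0 (fi_smooth HE (Ordinal (n_gt0 HE)) (Ordinal (m_gt0 HE))). Qed.
Let Lbar0 : 0 <= Lbar E.
Proof. exact: smooth_ge0 dim0 (fw_smooth HE (Ordinal (n_gt0 HE))). Qed.

Lemma inv_stepsize_ge0 : 0 <= inv_stepsize E.
Proof.
have /andP[d0 _] := d01.
rewrite /inv_stepsize !addr_ge0 ?(ltW Lf0)//; first by rewrite divr_ge0// ltW.
by rewrite divr_ge0 ?(ltW d0)// mulr_ge0 ?sqrtr_ge0// ltW.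
Qed.

(** Each of the four entries of the minimum [rho] is at least a constant over the complexity factor:
    [stepsize_lower] serves the first, and [p <= C * delta1] replaces the missing [1 / delta1] by a
    multiple of [1 / p]. *)
Lemma rate_lower (C : R) : Lbar E <= nR * Lf E -> p E <= C * delta1 E ->
  (eta E)%:E = eta_max E -> 0 < mu E ->
  1 <= (4 + 4 * `|C| + 2 * stepsize_const C) * (rho E *
    (1 / delta E + 1 / p E + Lf E / mu E + L E / (nR * mu E)
     + Num.sqrt (1 - delta E) * Lf E / (mu E * delta E))).
Proof.
move=> hL hp he mu0; set S := (X in rho E * X).
have /andP[d0 _] := d01; have /andP[e0 _] := d11; have /andP[p0 _] := p01.
have M0 := stepsize_const_ge0 C; have C0 := normr_ge0 C.
have T0 := inv_stepsize_ge0.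
have dV : 0 < 1 / delta E by rewrite divr_gt0.
have pV : 0 < 1 / p E by rewrite divr_gt0.
have SE : S = 1 / delta E + 1 / p E + inv_stepsize E / mu E.
  by rewrite /S /inv_stepsize; field; rewrite !gt_eqF.
have TV : 0 <= inv_stepsize E / mu E by rewrite divr_ge0// ltW.
have S0 : 0 < S by rewrite SE; move: dV pV TV; lra.
set M := 4 + _ + _.
have MM : 4 <= M /\ 4 * `|C| <= M /\ 2 * stepsize_const C <= M.
  by rewrite /M; split; [|split]; move: M0 C0; lra.
have MS0 : 0 < M * S by rewrite mulr_gt0// (lt_le_trans _ MM.1).
rewrite mulrCA -ler_pdivrMr//.
have le_of (y c : R) : 0 < y -> 1 <= c * y -> c <= M * S -> 1 / (M * S) <= y.
  move=> y0 cy cM; rewrite ler_pdivrMr// mulrC; apply: le_trans cy _.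
  by rewrite ler_wpM2r// ltW.
have Sd : 1 / delta E <= S by rewrite SE; move: pV TV; lra.
have Sp : 1 / p E <= S by rewrite SE; move: dV TV; lra.
have ST : inv_stepsize E / mu E <= S by rewrite SE; move: dV pV; lra.
rewrite /rho !le_min; apply/and4P; split.
- apply: (le_of _ (2 * stepsize_const C * (inv_stepsize E / mu E))).
  + by rewrite divr_gt0// mulr_gt0.
  + have := stepsize_lower HE L0 Lbar0 hL hp he; rewrite -/(stepsize_const C).
    suff -> : 2 * stepsize_const C * (inv_stepsize E / mu E) * (mu E * eta E / 2) =
      eta E * (stepsize_const C * inv_stepsize E) by [].
    by field; rewrite gt_eqF.
  + by apply: ler_pM => //; [rewrite mulr_ge0|case: MM => _ []].
- apply: (le_of _ (4 * (1 / delta E))); first by rewrite divr_gt0.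
    by rewrite [leRHS](_ : _ = 1)//; field; rewrite gt_eqF.
  by apply: ler_pM => //; [exact: ltW|case: MM].
- apply: (le_of _ (4 * `|C| * (1 / p E))); first by rewrite divr_gt0.
    rewrite [leRHS](_ : _ = `|C| * delta1 E / p E); last by field; rewrite gt_eqF.
    rewrite ler_pdivlMr// mul1r; apply: le_trans hp _.
    by rewrite ler_wpM2r ?(ltW e0)// ler_norm.
  by apply: ler_pM MM.2.1 Sp; [rewrite mulr_ge0|exact: ltW].
- apply: (le_of _ (4 * (1 / p E))); first by rewrite divr_gt0.
    by rewrite [leRHS](_ : _ = 1)//; field; rewrite gt_eqF.
  by apply: ler_pM => //; [exact: ltW|case: MM].
Qed.

End rates.

(** * Iteration counts *)

Section complexity.
Context (R : realType).

Lemma linear_rate_le (E : ec_lsvrg R) (HE : assumptions E) (B s eps : R) (k : nat) :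
  0 <= s <= B -> 0 < eps < 1 -> 0 < rho E ->
  4 * (`|B| + 1) * expR (- (rho E * k%:R)) <= eps ->
  2 * s / (1 - (1 - rho E) ^+ k.+1) * (1 - rho E) ^+ k <= eps.
Proof.
move=> /andP[s0 sB] /andP[e0 e1] r0 hk.
have r1 := one_sub_rho_gt0 HE.
set q := (1 - rho E) ^+ k; have q0 : 0 < q by rewrite exprn_gt0.
have qe : q <= expR (- (rho E * k%:R)).
  have -> : - (rho E * k%:R) = k%:R * - rho E by rewrite mulrN mulrC.
  rewrite expRM_natl; apply: lerXn2r; rewrite ?nnegrE ?expR_ge0 ?(ltW r1)//.
  exact: expR_ge1Dx.
have B0 := normr_ge0 B; have BB := ler_norm B.
have qB : 4 * (`|B| + 1) * q <= eps.
  by apply: le_trans hk; apply: ler_wpM2l qe; move: B0; lra.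
(* The 1 in [|B| + 1] makes this hold however small [B] is. The denominator is then at least 1/2,
   and the quotient at most [4 * s * q]. *)
have q14 : q <= 1 / 4 by have := mulr_ge0 B0 (ltW q0); nra.
have Q2 : 1 / 2 <= 1 - (1 - rho E) ^+ k.+1.
  rewrite exprS -/q; have : (1 - rho E) * q <= q by nra.
  by move: q14; lra.
rewrite mulrAC ler_pdivrMr; last by move: Q2; lra.
have sq : s * q <= `|B| * q by rewrite ler_wpM2r ?(ltW q0)// (le_trans sB).
by nra.
Qed.

Lemma complexity_strongly_convex (C B eps0 : R) : 0 < eps0 -> eps0 < 1 ->
  exists K : R, 0 < K /\
    forall E : ec_lsvrg R, assumptions E -> (eta E)%:E = eta_max E ->
      Lbar E <= (n E)%:R * Lf E -> p E <= C * delta1 E -> 0 < mu E ->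
      9 * mu E * dist0 E + 1 / (Lf E * (n E)%:R) * gradgap0 E + 3 * fgap0 E <= B ->
    forall eps : R, 0 < eps -> eps <= eps0 -> forall k : nat,
      K * ((1 / delta E + 1 / p E + Lf E / mu E + L E / ((n E)%:R * mu E)
            + Num.sqrt (1 - delta E) * Lf E / (mu E * delta E))
           * ln (1 / eps)) <= k%:R ->
      (expected_gap E k <= eps%:E)%E.
Proof.
move=> e00 e01; have B0 := normr_ge0 B.
have l0 : ln eps0 < 0 by rewrite ln_lt0// e00.
have b1 : 1 < 4 * (`|B| + 1) by move: B0; lra.
(* The additive [ln (4 * (|B| + 1))] has to be absorbed into a multiple of [ln (1 / eps)]; as
   [eps <= eps0 < 1], the multiple [N] suffices uniformly in [eps]. *)
pose N := ln (4 * (`|B| + 1)) / - ln eps0.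
have N0 : 0 < N by rewrite divr_gt0 ?ln_gt0 ?oppr_gt0.
pose M := 4 + 4 * `|C| + 2 * stepsize_const C.
have M0 : 0 < M.
  by rewrite /M; have := stepsize_const_ge0 C; have := normr_ge0 C; lra.
exists (M * (1 + N)); split; first by rewrite mulr_gt0// addr_gt0.
move=> E HE he hL hp mu0 hB eps eps0_gt eps_le k hk.
have [d0|] := eqVneq (dim E) 0%N; first by rewrite expected_gap_dim0// lee_fin ltW.
rewrite -lt0n => d0.
have eps1 : eps < 1 := le_lt_trans eps_le e01.
have hle : ((eta E)%:E <= eta_max E)%E by rewrite he.
apply: le_trans (expected_gap_strongly_convex HE k hle mu0) _; rewrite lee_fin.
have r0 := rho_gt0 HE mu0; have r1 := one_sub_rho_gt0 HE.
have D0 := dist0_ge0 E; have G0 := gradgap0_ge0 E; have F0 := fgap0_ge0 HE.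
have nL0 : 0 < Lf E * (n E)%:R by rewrite mulr_gt0 ?(Lf_gt0 HE)// ltr0n (n_gt0 HE).
set s := 9 * mu E * _ + _ + _ in hB.
have s0 : 0 <= s.
  have c0 : 0 <= 9 * mu E by rewrite mulr_ge0// ltW.
  have c1 : 0 <= 1 / (Lf E * (n E)%:R) by rewrite divr_ge0// ltW.
  exact: addr_ge0 (addr_ge0 (mulr_ge0 c0 D0) (mulr_ge0 c1 G0)) (mulr_ge0 _ F0).
have ll : 0 < - ln eps by rewrite oppr_gt0 ln_lt0// eps0_gt.
have rk : (1 + N) * - ln eps <= rho E * k%:R.
  have hr := rate_lower HE d0 hL hp he mu0; rewrite -/M in hr.
  have lnE : ln (1 / eps) = - ln eps by rewrite div1r lnV.
  move: hk; rewrite lnE.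
  move: hr; set S := (X in rho E * X) => hr hk.
  apply: le_trans (ler_wpM2l (ltW r0) hk).
  have -> : rho E * (M * (1 + N) * (S * - ln eps)) =
    M * (rho E * S) * ((1 + N) * - ln eps) by ring.
  by rewrite ler_peMl// mulr_ge0 ?(ltW ll)// addr_ge0// ltW.
have expN : 4 * (`|B| + 1) * expR (N * ln eps) <= 1.
  have : expR (N * ln eps) <= expR (N * ln eps0).
    by rewrite ler_expR ler_pM2l// ler_ln.
  have -> : N * ln eps0 = - ln (4 * (`|B| + 1)).
    by rewrite /N; field; rewrite lt_eqF.
  have b0 : 0 < 4 * (`|B| + 1) by apply: lt_trans b1.
  rewrite expRN lnK ?posrE// -(ler_pM2l b0) => h.
  by apply: le_trans h _; rewrite divff// gt_eqF.
(* The numerator is twice [s] except that its last coefficient is 5 instead of 6. *)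
have num_le : 18 * mu E * dist0 E + 2 / (Lf E * (n E)%:R) * gradgap0 E
    + 5 * fgap0 E <= 2 * s.
  have -> : 2 * s = 18 * mu E * dist0 E + 2 / (Lf E * (n E)%:R) * gradgap0 E
    + 6 * fgap0 E by rewrite /s; field; rewrite !gt_eqF// ?(Lf_gt0 HE)// ltr0n (n_gt0 HE).
  by move: F0; lra.
have q0 : 0 < (1 - rho E) ^+ k by rewrite exprn_gt0.
have Q0 : 0 < 1 - (1 - rho E) ^+ k.+1.
  by rewrite subr_gt0 exprn_ilt1// ?(ltW r1)// gtrBl.
apply: le_trans (@linear_rate_le E HE B s eps k _ _ r0 _).
- apply: (ler_wpM2r (ltW q0)); apply: ler_wpM2r num_le.
  by rewrite invr_ge0 ltW.
- by rewrite s0 hB.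
- by rewrite eps0_gt eps1.
- have b0 : 0 < 4 * (`|B| + 1) by apply: lt_trans b1.
  have : expR (- (rho E * k%:R)) <= expR ((1 + N) * ln eps).
    by rewrite ler_expR; move: rk; lra.
  rewrite mulrDl mul1r expRD lnK ?posrE// -(ler_pM2l b0) => h.
  apply: le_trans h _; rewrite mulrCA ger_pMr//.
Qed.

Lemma complexity_convex (C B : R) :
  exists K : R, 0 < K /\
    forall E : ec_lsvrg R, assumptions E -> (eta E)%:E = eta_max E ->
      Lbar E <= (n E)%:R * Lf E -> p E <= C * delta1 E -> mu E = 0 ->
      dist0 E <= B -> 1 / (Lf E * (n E)%:R) * gradgap0 E <= B -> fgap0 E <= B ->
    forall eps : R, 0 < eps -> forall k : nat,
      K * ((1 / p E + Lf E + L E / (n E)%:R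
            + Num.sqrt (1 - delta E) * Lf E / delta E)
           * (1 / eps)) <= k%:R ->
      (expected_gap E k <= eps%:E)%E.
Proof.
have M0 := stepsize_const_ge0 C; have B0 := normr_ge0 B.
(* 36 comes from the distance term, where [1 / eta] is at most [stepsize_const C * inv_stepsize E];
   24 = 6 + 18 comes from the two terms in [1 / p]. *)
exists ((36 * stepsize_const C + 24) * (`|B| + 1)); split.
  by apply: mulr_gt0; [move: M0; lra | move: B0; lra].
move=> E HE he hL hp mu0 hD hG hF eps eps_gt0 k.
have [d0|] := eqVneq (dim E) 0%N.
  by move=> _; rewrite expected_gap_dim0// lee_fin ltW.
rewrite -lt0n => d0.
have L0 : 0 <= L E.
  exact: smooth_ge0 d0 (fi_smooth HE (Ordinal (n_gt0 HE)) (Ordinal (m_gt0 HE))).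
have Lbar0 : 0 <= Lbar E.
  exact: smooth_ge0 d0 (fw_smooth HE (Ordinal (n_gt0 HE))).
have /andP[p0 _] := p_range HE.
have T0 := inv_stepsize_ge0 HE d0.
have -> : 1 / p E + Lf E + L E / (n E)%:R + Num.sqrt (1 - delta E) * Lf E / delta E
    = 1 / p E + inv_stepsize E by rewrite /inv_stepsize !addrA.
rewrite !(mulrA _ _ (1 / eps)) (mulrA _ 1) mulr1 ler_pdivrMr// => hk.
have hle : ((eta E)%:E <= eta_max E)%E by rewrite he.
apply: le_trans (expected_gap_convex HE k hle mu0) _; rewrite lee_fin.
rewrite mulrC ler_pdivrMr ?ltr0n//.
have hs := stepsize_lower HE L0 Lbar0 hL hp he; rewrite -/(stepsize_const C) in hs.
have D0 := dist0_ge0 E; have G0 := gradgap0_ge0 E; have F0 := fgap0_ge0 HE.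
have nL0 : 0 < Lf E * (n E)%:R by rewrite mulr_gt0 ?(Lf_gt0 HE)// ltr0n (n_gt0 HE).
have e0 := eta_gt0 HE; have BB := ler_norm B.
have pV : 0 < 1 / p E by rewrite divr_gt0.
have le1 : 36 / eta E * dist0 E <= 36 * stepsize_const C * inv_stepsize E * (`|B| + 1).
  apply: ler_pM => //; [by rewrite divr_ge0// ltW | | by move: BB; lra].
  by rewrite ler_pdivrMr// [leRHS](_ : _ = 36 * (eta E * (stepsize_const C * inv_stepsize E)));
    [move: hs; lra | ring].
have le2 : 6 / (Lf E * p E * (n E)%:R) * gradgap0 E <= 6 * (1 / p E) * (`|B| + 1).
  have -> : 6 / (Lf E * p E * (n E)%:R) * gradgap0 E =
     6 * (1 / p E) * (1 / (Lf E * (n E)%:R) * gradgap0 E).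
    by field; rewrite !gt_eqF// ?(Lf_gt0 HE)// ltr0n (n_gt0 HE).
  by apply: ler_wpM2l; [move: pV; lra | move: BB hG; lra].
have le3 : 18 / p E * fgap0 E <= 18 * (1 / p E) * (`|B| + 1).
  have -> : 18 / p E = 18 * (1 / p E) by rewrite mulrA mulr1.
  by apply: ler_wpM2l; [move: pV; lra | move: BB hF; lra].
have le4 : 36 * stepsize_const C * inv_stepsize E * (`|B| + 1) +
  6 * (1 / p E) * (`|B| + 1) + 18 * (1 / p E) * (`|B| + 1) <=
  (36 * stepsize_const C + 24) * (`|B| + 1) * (1 / p E + inv_stepsize E).
  rewrite -subr_ge0 [leRHS](_ : _ = (`|B| + 1) *
    (36 * stepsize_const C * (1 / p E) + 24 * inv_stepsize E)); last by ring.
  apply: mulr_ge0; first by move: B0; lra.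
  by apply: addr_ge0; apply: mulr_ge0 => //; [exact: mulr_ge0 | exact: ltW].
rewrite -natr1; move: le1 le2 le3 le4 hk eps_gt0; lra.
Qed.

End complexity.

Theorem theorem2p11 (R : realType) :
  (forall E : ec_lsvrg R, assumptions E -> ((eta E)%:E <= eta_max E)%E ->
     (0 < mu E -> forall k : nat,
        (expected_gap E k <=
         ((18 * mu E * dist0 E + 2 / (Lf E * (n E)%:R) * gradgap0 E
           + 5 * fgap0 E)
          / (1 - (1 - rho E) ^+ k.+1) * (1 - rho E) ^+ k)%:E)%E)
     /\
     (mu E = 0 -> forall k : nat,
        (expected_gap E k <=
         (k.+1%:R^-1 *
          (36 / eta E * dist0 E + 6 / (Lf E * p E * (n E)%:R) * gradgap0 E
           + 18 / p E * fgap0 E))%:E)%E))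
  /\
  (* Big-O constants: [C] is the constant of p <= O(delta_1), [K] that of the
     bound on k; [K] depends only on C, on a bound [B] of the initial
     quantities, and, for mu > 0, on a bound [eps0] < 1 of eps.  The condition on Lbar always
     holds when the smoothness constants are the smallest ones, since the
     f^(tau) are convex. *)
  (forall C B eps0 : R, 0 < eps0 -> eps0 < 1 -> exists K : R, 0 < K /\
     forall E : ec_lsvrg R, assumptions E -> (eta E)%:E = eta_max E ->
       Lbar E <= (n E)%:R * Lf E ->
       p E <= C * delta1 E ->
       0 < mu E ->
       9 * mu E * dist0 E + 1 / (Lf E * (n E)%:R) * gradgap0 E + 3 * fgap0 E
         <= B ->
     forall eps : R, 0 < eps -> eps <= eps0 ->
       eps <= 9 * mu E * dist0 E + 1 / (Lf E * (n E)%:R) * gradgap0 E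
              + 3 * fgap0 E ->
     forall k : nat,
       K * ((1 / delta E + 1 / p E + Lf E / mu E + L E / ((n E)%:R * mu E)
             + Num.sqrt (1 - delta E) * Lf E / (mu E * delta E))
            * ln (1 / eps)) <= k%:R ->
       (expected_gap E k <= eps%:E)%E)
  /\
  (forall C B : R, exists K : R, 0 < K /\
     forall E : ec_lsvrg R, assumptions E -> (eta E)%:E = eta_max E ->
       Lbar E <= (n E)%:R * Lf E ->
       p E <= C * delta1 E ->
       mu E = 0 ->
       dist0 E <= B -> 1 / (Lf E * (n E)%:R) * gradgap0 E <= B ->
       fgap0 E <= B ->
     forall eps : R, 0 < eps ->
     forall k : nat,
       K * ((1 / p E + Lf E + L E / (n E)%:R
             + Num.sqrt (1 - delta E) * Lf E / delta E)
            * (1 / eps)) <= k%:R ->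
       (expected_gap E k <= eps%:E)%E).
Proof.
split=> [E HE h|].
  by split=> [mu0 k|mu0 k]; [exact: expected_gap_strongly_convex|exact: expected_gap_convex].
split=> [C B eps0 e00 e01|C B].
  have [K [K0 hK]] := complexity_strongly_convex C B e00 e01.
  exists K; split=> // E HE he hL hp mu0 hB eps eps_gt0 eps_le _.
  exact: hK.
exact: complexity_convex.
Qed.
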